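(* Let $F:\mathbb{R}^n\to\mathbb{R}$ and $u^0\in\mathbb{R}^n$ be such that (a) the level set $\mathscr{L}_F(u^0):=\{x: F(x)\le F(u^0)\}$ is compact; (b) $F$ is twice Lipschitz continuously differentiable in a convex open neighborhood $\Omega$ of $\mathscr{L}_F(u^0)$, i.e., there is $L_H^F>0$ with $\|\nabla^2F(x)-\nabla^2F(y)\|\le L_H^F\|x-y\|$ for all $x,y\in\Omega$. Let $F_{\rm low}\in\mathbb{R}$, $U_g^F>0$, $U_H^F>0$ be such that $F(x)\ge F_{\rm low}$, $\|\nabla F(x)\|\le U_g^F$, $\|\nabla^2F(x)\|\le U_H^F$ for all $x\in\mathscr{L}_F(u^0)$, and let $F_{\rm hi}=F(u^0)$. Consider the Newton-CG method (defined in the context) for $\min_{x\in\mathbb{R}^n}F(x)$, with tolerances $\epsilon_g,\epsilon_H\in(0,1)$, starting point $u^0$, and parameters $\theta,\zeta,\eta,\delta\in(0,1)$. Let $$T_1:=\left\lceil\frac{F_{\rm hi}-F_{\rm low}}{\min\{c_{\rm sol},c_{\rm nc}\}}\max\{\epsilon_g^{-2}\epsilon_H,\epsilon_H^{-3}\}\right\rceil+\left\lceil\frac{F_{\rm hi}-F_{\rm low}}{c_{\rm nc}}\epsilon_H^{-3}\right\rceil+1,\qquad T_2:=\left\lceil\frac{F_{\rm hi}-F_{\rm low}}{c_{\rm nc}}\epsilon_H^{-3}\right\rceil+1,$$ where $$c_{\rm sol}:=\eta\min\left\{\left[\frac{4}{4+\zeta+\sqrt{(4+\zeta)^2+8L_H^F}}\right]^2,\left[\frac{\min\{6(1-\eta),2\}\theta}{L_H^F}\right]^2\right\},\qquad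 c_{\rm nc}:=\frac{\eta}{16}\min\left\{1,\left[\frac{\min\{3(1-\eta),1\}\theta}{L_H^F}\right]^2\right\}.$$ Then the following statements hold. (i) The total number of calls of the minimum eigenvalue oracle in the Newton-CG method is at most $T_2$. (ii) The total number of calls of the capped CG method in the Newton-CG method is at most $T_1$. (iii) The Newton-CG method terminates in at most $T_1+T_2$ iterations, with $$T_1+T_2=\mathcal{O}\big((F_{\rm hi}-F_{\rm low})(L_H^F)^2\max\{\epsilon_g^{-2}\epsilon_H,\epsilon_H^{-3}\}\big).$$ Also, its output $x^t$ satisfies $\|\nabla F(x^t)\|\le\epsilon_g$ deterministically and $\lambda_{\min}(\nabla^2F(x^t))\ge-\epsilon_H$ with probability at least $1-\delta$, for some $0\le t\le T_1+T_2$. (iv) The Newton-CG method requires at most $$\widetilde{\mathcal{O}}\big((F_{\rm hi}-F_{\rm low})(L_H^F)^2\max\{\epsilon_g^{-2}\epsilon_H,\epsilon_H^{-3}\}\min\{n,(U_H^F/\epsilon_H)^{1/2}\}\big)$$ matrix-vector products.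
   Context: Notation. $\|\cdot\|$ is the Euclidean norm of a vector or the spectral norm of a matrix; $\lambda_{\min}(H)$ is the minimum eigenvalue of a real symmetric matrix $H$; ${\rm sgn}(s)=1$ if $s\ge0$ and $-1$ otherwise. $\widetilde{\mathcal{O}}(\cdot)$ is $\mathcal{O}(\cdot)$ with logarithmic terms omitted. The order notation records the dependence on $\epsilon_g,\epsilon_H,L_H^F,F_{\rm hi}-F_{\rm low}$ (and $n,U_H^F$), with $\theta,\zeta,\eta,\delta$ treated as fixed constants and $L_H^F$, $F_{\rm hi}-F_{\rm low}$, $U_H^F$ regarded as bounded away from zero. Capped CG method. Inputs: symmetric $H\in\mathbb{R}^{n\times n}$, vector $g\ne0$, damping parameter $\varepsilon\in(0,1)$, accuracy $\zeta\in(0,1)$, scalar $U\ge0$ (default $0$). Outputs: a type d_type in {SOL, NC} and a vector $d$. Set $\bar H=H+2\varepsilon I$ and, as functions of the current $U$, $\kappa=(U+2\varepsilon)/\varepsilon$, $\widehat\zeta=\zeta/(3\kappa)$, $\tau=\sqrt\kappa/(\sqrt\kappa+1)$, $T=4\kappa^4/(1-\sqrt\tau)^2$. ''Update $U$ with $v$'' means: if $\|Hv\|>U\|v\|$, set $U=\|Hv\|/\|v\|$ and recompute $\kappa,\widehat\zeta,\tau,T$. Start with $y^0=0$, $r^0=g$, $p^0=-g$, $j=0$. If $(p^0)^T\bar Hp^0<\varepsilon\|p^0\|^2$, return $d=p^0$ with type NC; otherwise update $U$ with $p^0$. Then loop: set $\alpha_j=(r^j)^Tr^j/((p^j)^T\bar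 Hp^j)$, $y^{j+1}=y^j+\alpha_jp^j$, $r^{j+1}=r^j+\alpha_j\bar Hp^j$, $\beta_{j+1}=\|r^{j+1}\|^2/\|r^j\|^2$, $p^{j+1}=-r^{j+1}+\beta_{j+1}p^j$, $j\leftarrow j+1$; update $U$ with $p^j$, then $y^j$, then $r^j$; then apply the first of the following that is applicable (if none is, continue the loop): if $(y^j)^T\bar Hy^j<\varepsilon\|y^j\|^2$, return $d=y^j$, type NC; else if $\|r^j\|\le\widehat\zeta\|r^0\|$, return $d=y^j$, type SOL; else if $(p^j)^T\bar Hp^j<\varepsilon\|p^j\|^2$, return $d=p^j$, type NC; else if $\|r^j\|>\sqrt T\tau^{j/2}\|r^0\|$, compute $\alpha_j,y^{j+1}$ as in the loop, find $i\in\{0,\ldots,j-1\}$ with $(y^{j+1}-y^i)^T\bar H(y^{j+1}-y^i)<\varepsilon\|y^{j+1}-y^i\|^2$, and return $d=y^{j+1}-y^i$, type NC. Minimum eigenvalue oracle. Inputs: symmetric $H\in\mathbb{R}^{n\times n}$, $\varepsilon>0$, $\delta\in(0,1)$. Apply the Lanczos method to estimate $\lambda_{\min}(H)$ starting with a random vector uniformly generated on the unit sphere, for at most $N(\varepsilon,\delta):=\min\{n,1+\lceil\frac{\ln(2.75n/\delta^2)}{2}\sqrt{\|H\|/\varepsilon}\rceil\}$ iterations. If a unit vector $v$ with $v^THv\le-\varepsilon/2$ is found at some iteration, terminate and return $v$; otherwise certify that $\lambda_{\min}(H)\ge-\varepsilon$ (a certificate valid with probability at least $1-\delta$). Newton-CG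 method for $\min F$. Inputs: $\epsilon_g,\epsilon_H\in(0,1)$, backtracking ratio $\theta\in(0,1)$, starting point $u^0$, CG accuracy $\zeta\in(0,1)$, line-search parameter $\eta\in(0,1)$, probability parameter $\delta\in(0,1)$. Set $x^0=u^0$. For $t=0,1,2,\ldots$: - If $\|\nabla F(x^t)\|>\epsilon_g$: call the capped CG method with $H=\nabla^2F(x^t)$, $\varepsilon=\epsilon_H$, $g=\nabla F(x^t)$, accuracy $\zeta$, $U=0$, obtaining $d$ and d_type. If d_type = NC, set $d^t=-{\rm sgn}(d^T\nabla F(x^t))\frac{|d^T\nabla^2F(x^t)d|}{\|d\|^3}d$; if d_type = SOL, set $d^t=d$. - Otherwise: call the minimum eigenvalue oracle with $H=\nabla^2F(x^t)$, $\varepsilon=\epsilon_H$ and $\delta$. If it certifies $\lambda_{\min}(\nabla^2F(x^t))\ge-\epsilon_H$, output $x^t$ and terminate. Otherwise it returns $v$; set d_type = NC and $d^t=-{\rm sgn}(v^T\nabla F(x^t))|v^T\nabla^2F(x^t)v|v$. - Line search: $\alpha_t=\theta^{j_t}$, where $j_t$ is the smallest nonnegative integer $j$ such that $F(x^t+\theta^jd^t)<F(x^t)-\eta\epsilon_H\theta^{2j}\|d^t\|^2$ if d_type = SOL, or $F(x^t+\theta^jd^t)<F(x^t)-\eta\theta^{2j}\|d^t\|^3/2$ if d_type = NC. Set $x^{t+1}=x^t+\alpha_td^t$. ''Matrix-vector products'' are products of Hessians $\nabla^2F(x^t)$ with vectors.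
   Formalization: In (iii), ''with probability at least 1−δ'' is stated for each certificate: at any iterate reached, over that oracle call's fresh random start, a wrong output has probability at most δ. Over a whole run with many oracle calls the failure probabilities can accumulate, so that reading is false. *)

(* Defs.v *)
From HB Require Import structures.
From mathcomp Require Import all_boot all_order all_algebra.
From mathcomp Require Import all_classical all_reals all_analysis.

Set Implicit Arguments.
Unset Strict Implicit.
Unset Printing Implicit Defensive.

Import Order.TTheory GRing.Theory Num.Theory.
Import numFieldNormedType.Exports.

Local Open Scope classical_set_scope.
Local Open Scope ring_scope.

Section LinearAlgebra.
Variable R : realType.

Definition dot n (u v : 'cV[R]_n) : R := (u^T *m v) 0 0.

(* The norm that the library puts on ['cV[R]_n] is the sup norm; it induces
   the same topology, so only quantitative statements need [enorm]. *)
Definition enorm n (u : 'cV[R]_n) : R := Num.sqrt (dot u u).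

Definition spectral_norm n (A : 'M[R]_n) : R :=
  sup [set enorm (A *m v) | v in [set v : 'cV[R]_n | enorm v <= 1]].

(* Only used for symmetric [A] of positive size, where the set is finite and
   nonempty and the infimum is therefore a minimum. *)
Definition lambda_min n (A : 'M[R]_n) : R := inf [set a : R | eigenvalue A a].

(* Unlike [Num.sg], the sign of 0 is 1. *)
Definition sgn (s : R) : R := if 0 <= s then 1 else -1.

Definition grad n (F : 'cV[R]_n -> R) (x : 'cV[R]_n) : 'cV[R]_n :=
  \col_i 'D_(delta_mx i 0) F x.

Definition hess n (F : 'cV[R]_n -> R) (x : 'cV[R]_n) : 'M[R]_n :=
  \matrix_(i, j) 'D_(delta_mx j 0) ('D_(delta_mx i 0) F) x.

End LinearAlgebra.

Section Randomness.
Context (R : realType) (d : measure_display) (W : measurableType d).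
Variable P : probability W R.

(* The uniform law on the unit sphere is the rotation-invariant Borel
   probability carried by the sphere. *)
Definition uniform_on_sphere n (b : W -> 'cV[R]_n) : Prop :=
  [/\ forall A : set 'cV[R]_n, <<s [set O | open O] >> A ->
        measurable (b @^-1` A),
      forall w, enorm (b w) = 1 &
      forall Q : 'M[R]_n, Q^T *m Q = 1%:M ->
        forall A : set 'cV[R]_n, <<s [set O | open O] >> A ->
          P [set w | A (Q *m b w)] = P [set w | A (b w)]].

(* [E] itself is not required to be measurable. *)
Definition with_probability_ge (p : R) (E : set W) : Prop :=
  exists A, [/\ measurable A, A `<=` E & (p%:E <= P A)%E].

End Randomness.

Inductive dtype := SOL | NC.

Section CappedCG.
Variables (R : realType) (n : nat).
Variables (H : 'M[R]_n) (g : 'cV[R]_n) (eps zeta U0 : R).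

Definition cg_Hbar : 'M[R]_n := H + (2 * eps)%:M.

Definition cg_low (v : 'cV[R]_n) : bool :=
  dot v (cg_Hbar *m v) < eps * enorm v ^+ 2.

Fixpoint cg_state (j : nat) : 'cV[R]_n * 'cV[R]_n * 'cV[R]_n :=
  if j is i.+1 then
    let: (y, r, p) := cg_state i in
    let alpha := dot r r / dot p (cg_Hbar *m p) in
    let r' := r + alpha *: (cg_Hbar *m p) in
    let beta := enorm r' ^+ 2 / enorm r ^+ 2 in
    (y + alpha *: p, r', - r' + beta *: p)
  else (0, g, - g).

Definition cg_y j : 'cV[R]_n := (cg_state j).1.1.
Definition cg_r j : 'cV[R]_n := (cg_state j).1.2.
Definition cg_p j : 'cV[R]_n := (cg_state j).2.

Definition cg_update (U : R) (v : 'cV[R]_n) : R :=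
  if U * enorm v < enorm (H *m v) then enorm (H *m v) / enorm v else U.

(* Value of U when the tests of iteration [j] are performed. *)
Fixpoint cg_U (j : nat) : R :=
  if j is i.+1 then
    cg_update (cg_update (cg_update (cg_U i) (cg_p j)) (cg_y j)) (cg_r j)
  else cg_update U0 (cg_p 0).

Definition cg_kappa (U : R) : R := (U + 2 * eps) / eps.
Definition cg_zetahat (U : R) : R := zeta / (3 * cg_kappa U).
Definition cg_tau (U : R) : R :=
  Num.sqrt (cg_kappa U) / (Num.sqrt (cg_kappa U) + 1).
Definition cg_T (U : R) : R :=
  4 * cg_kappa U ^+ 4 / (1 - Num.sqrt (cg_tau U)) ^+ 2.

Definition cg_small_residual (j : nat) : bool :=
  enorm (cg_r j) <= cg_zetahat (cg_U j) * enorm (cg_r 0).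

Definition cg_slow_decay (j : nat) : bool :=
  Num.sqrt (cg_T (cg_U j)) * (cg_tau (cg_U j) `^ (j%:R / 2)) * enorm (cg_r 0)
    < enorm (cg_r j).

Definition cg_applicable (j : nat) : bool :=
  [|| cg_low (cg_y j), cg_small_residual j, cg_low (cg_p j) | cg_slow_decay j].

(* [capped_cg ty v J]: the method returns [v] with type [ty] after [J] passes
   through the loop.  It is a relation because the index [i] of the last case
   is not determined. *)
Definition capped_cg (ty : dtype) (v : 'cV[R]_n) (J : nat) : Prop :=
  if cg_low (cg_p 0) then [/\ J = 0%N, ty = NC & v = cg_p 0]
  else
    [/\ (0 < J)%N,
        forall j, (0 < j < J)%N -> ~~ cg_applicable j,
        cg_applicable J &
        if cg_low (cg_y J) then ty = NC /\ v = cg_y J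
        else if cg_small_residual J then ty = SOL /\ v = cg_y J
        else if cg_low (cg_p J) then ty = NC /\ v = cg_p J
        else ty = NC /\ exists i, [/\ (i < J)%N, cg_low (cg_y J.+1 - cg_y i) &
                                      v = cg_y J.+1 - cg_y i]].

(* Products of [H] with a vector, without any reuse between steps: one for
   p^0, three per pass (p^j, y^j, r^j), and at most [J] for the search of [i]. *)
Definition capped_cg_products (J : nat) : nat := (1 + 3 * J + J)%N.

End CappedCG.

Section MinEigenvalueOracle.
Variables (R : realType) (n : nat).
Variables (H : 'M[R]_n) (eps delta : R) (b : 'cV[R]_n).

(* State (q_(k-1), q_k, beta_(k-1)) of the Lanczos recursion
   beta_k q_(k+1) = H q_k - alpha_k q_k - beta_(k-1) q_(k-1), with q_0 = b. *)
Fixpoint lanczos_state (k : nat) : 'cV[R]_n * 'cV[R]_n * R :=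
  if k is i.+1 then
    let: (q', q, beta') := lanczos_state i in
    let w := H *m q - dot q (H *m q) *: q - beta' *: q' in
    (q, (enorm w)^-1 *: w, enorm w)
  else (0, b, 0).

Definition lanczos_q k : 'cV[R]_n := (lanczos_state k).1.2.
Definition lanczos_alpha k : R := dot (lanczos_q k) (H *m lanczos_q k).
Definition lanczos_beta k : R := (lanczos_state k.+1).2.

Definition lanczos_basis k : 'M[R]_(n, k) := \matrix_(i, j) lanczos_q j i 0.

Definition lanczos_tridiag k : 'M[R]_k :=
  \matrix_(i, j) if i == j then lanczos_alpha i
                 else if val j == i.+1 then lanczos_beta i
                 else if val i == j.+1 then lanczos_beta j
                 else 0.

(* Ritz vector for the smallest Ritz value of iteration [k]. *)
Definition ritz_vector k (v : 'cV[R]_n) : Prop :=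
  exists s : 'cV[R]_k,
    [/\ enorm s = 1,
        lanczos_tridiag k *m s = lambda_min (lanczos_tridiag k) *: s &
        v = lanczos_basis k *m s].

Definition oracle_N : int :=
  Num.min n%:Z
    (1 + Num.ceil (ln (275%:R / 100%:R * n%:R / delta ^+ 2) / 2
                   * Num.sqrt (spectral_norm H / eps))).

(* Iteration [k] is allowed by the cap, and the recursion has not broken down
   (beta = 0, i.e. the Krylov space has become invariant) before it. *)
Definition lanczos_performed (k : nat) : Prop :=
  [/\ (0 < k)%N, k%:Z <= oracle_N &
      forall i, (i.+1 < k)%N -> lanczos_beta i != 0].

Definition lanczos_success (k : nat) (v : 'cV[R]_n) : Prop :=
  [/\ ritz_vector k v, enorm v = 1 & dot v (H *m v) <= - eps / 2].

Definition oracle_returns (v : 'cV[R]_n) (k : nat) : Prop :=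
  [/\ lanczos_performed k, lanczos_success k v &
      forall i, (0 < i < k)%N -> ~ exists v', lanczos_success i v'].

(* All [k] Lanczos iterations have been performed without success. *)
Definition oracle_certifies (k : nat) : Prop :=
  [/\ lanczos_performed k, ~ lanczos_performed k.+1 &
      forall i, (0 < i <= k)%N -> ~ exists v', lanczos_success i v'].

End MinEigenvalueOracle.

Section NewtonCG.
Variables (R : realType) (n : nat).
Variables (F : 'cV[R]_n -> R) (u0 : 'cV[R]_n).
Variables (eps_g eps_H theta zeta eta delta : R).

Definition calls_capped_cg (x : 'cV[R]_n) : bool := eps_g < enorm (grad F x).
Definition calls_oracle (x : 'cV[R]_n) : bool := ~~ calls_capped_cg x.

(* [ncg_direction b x ty d m]: at the iterate [x] the method computes a
   direction [d] of type [ty], using [m] Hessian-vector products; [b] is the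
   starting vector drawn for the oracle.  The last product counted is the one
   used to scale the direction. *)
Definition ncg_direction (b x : 'cV[R]_n) (ty : dtype) (d : 'cV[R]_n)
    (m : nat) : Prop :=
  let g := grad F x in let H := hess F x in
  if calls_capped_cg x then
    exists v J,
      [/\ capped_cg H g eps_H zeta 0 ty v J,
          d = (match ty with
               | SOL => v
               | NC => (- sgn (dot v g) * (`|dot v (H *m v)| / enorm v ^+ 3))
                         *: v
               end) &
          m = (capped_cg_products J + 1)%N]
  else
    exists v k,
      [/\ oracle_returns H eps_H delta b v k,
          ty = NC,
          d = (- sgn (dot v g) * `|dot v (H *m v)|) *: v &
          m = (k + 1)%N].

(* [ncg_output b x m]: the method outputs [x] and terminates. *)
Definition ncg_output (b x : 'cV[R]_n) (m : nat) : Prop :=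
  calls_oracle x /\ oracle_certifies (hess F x) eps_H delta b m.

Definition sufficient_decrease (x : 'cV[R]_n) (ty : dtype) (d : 'cV[R]_n)
    (j : nat) : Prop :=
  F (x + theta ^+ j *: d) <
    match ty with
    | SOL => F x - eta * eps_H * theta ^+ (2 * j) * enorm d ^+ 2
    | NC => F x - eta * theta ^+ (2 * j) * enorm d ^+ 3 / 2
    end.

Definition line_search (x : 'cV[R]_n) (ty : dtype) (d : 'cV[R]_n)
    (j : nat) : Prop :=
  sufficient_decrease x ty d j /\
  forall i, (i < j)%N -> ~ sufficient_decrease x ty d i.

Definition ncg_step (b x x' : 'cV[R]_n) (m : nat) : Prop :=
  exists ty d j,
    [/\ ncg_direction b x ty d m, line_search x ty d j &
        x' = x + theta ^+ j *: d].

(* Iterations 0, ..., k-1 have been completed and x^k has been reached;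
   [b t] is the draw used if iteration [t] calls the oracle, and [m t] is the
   number of Hessian-vector products of iteration [t]. *)
Definition ncg_reaches (b x : nat -> 'cV[R]_n) (m : nat -> nat) (k : nat) :
    Prop :=
  x 0%N = u0 /\ forall t, (t < k)%N -> ncg_step (b t) (x t) (x t.+1) (m t).

Definition ncg_complete_run (b x : nat -> 'cV[R]_n) (m : nat -> nat) (k : nat) :
    Prop :=
  ncg_reaches b x m k /\ ncg_output (b k) (x k) (m k).

(* The iteration at [x] runs to completion: the subroutine called delivers an
   answer, and the line search succeeds for every direction it may deliver. *)
Definition ncg_iteration_succeeds (b x : 'cV[R]_n) : Prop :=
  ((exists m, ncg_output b x m) \/
   (exists ty d m, ncg_direction b x ty d m)) /\
  (forall ty d m, ncg_direction b x ty d m -> exists j, line_search x ty d j).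

End NewtonCG.

Record ncg_assumptions (R : realType) (n : nat) (F : 'cV[R]_n -> R)
    (u0 : 'cV[R]_n) (Omega : set 'cV[R]_n) (LH Flow Ug UH : R) : Prop := {
  level_compact : compact [set x | F x <= F u0];
  Omega_open : open Omega;
  Omega_convex : convex_set (Omega : set (convex_lmodType 'cV[R]_n));
  level_sub_Omega : [set x | F x <= F u0] `<=` Omega;
  F_differentiable : forall x, Omega x -> differentiable F x;
  grad_differentiable : forall x, Omega x -> differentiable (grad F) x;
  LH_gt0 : 0 < LH;
  hess_lipschitz : forall x y, Omega x -> Omega y ->
    spectral_norm (hess F x - hess F y) <= LH * enorm (x - y);
  Ug_gt0 : 0 < Ug;
  UH_gt0 : 0 < UH;
  F_ge_Flow : forall x, F x <= F u0 -> Flow <= F x;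
  grad_le_Ug : forall x, F x <= F u0 -> enorm (grad F x) <= Ug;
  hess_le_UH : forall x, F x <= F u0 -> spectral_norm (hess F x) <= UH }.

Section Constants.
Variable R : realType.
Variables (theta zeta eta LH gap eps_g eps_H : R).

Definition c_sol : R :=
  eta * Num.min
    ((4 / (4 + zeta + Num.sqrt ((4 + zeta) ^+ 2 + 8 * LH))) ^+ 2)
    ((Num.min (6 * (1 - eta)) 2 * theta / LH) ^+ 2).

Definition c_nc : R :=
  eta / 16 * Num.min 1 ((Num.min (3 * (1 - eta)) 1 * theta / LH) ^+ 2).

Definition eps_rate : R := Num.max (eps_g ^- 2 * eps_H) (eps_H ^- 3).

(* [gap] stands for F_hi - F_low. *)
Definition T2 : int := Num.ceil (gap / c_nc * eps_H ^- 3) + 1.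

Definition T1 : int :=
  Num.ceil (gap / Num.min c_sol c_nc * eps_rate)
  + Num.ceil (gap / c_nc * eps_H ^- 3) + 1.

(* The logarithms hidden by the soft O. *)
Definition log_terms (n : nat) (UH : R) : R :=
  1 + `|ln n%:R| + `|ln UH| + `|ln LH| + `|ln gap| + `|ln eps_g| + `|ln eps_H|.

End Constants.

(* Main.v *)
(* Counting.  A step along a direction of negative curvature decreases F by at
   least c_nc eps_H^3.  A step along a CG solution decreases F by at least
   c_sol min (eps_g^2 / eps_H, eps_H^3), unless it lands at a point with a small
   gradient, where the next iteration calls the oracle; so the CG calls without a
   guaranteed decrease are paid for by oracle calls.  The line search succeeds
   below an explicit step length because, as long as the segment stays in Omega,
   the cubic Taylor bound keeps its points in the level set, and hence the segment
   cannot leave Omega.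

   Capped CG.  If no pair y_{J+1}, y_i violated eps-convexity, the CG objective
   would decrease linearly with rate 1 - 1/sqrt(kappa), by Nesterov's estimate
   sequence argument, which contradicts the slow decay of the residual.

   Oracle.  Suppose that H has an eigenvalue below -eps, with unit eigenvector z,
   and that the oracle issues a certificate.  Testing the Krylov space with
   Chebyshev polynomials bounds |<b, z>|; the Pell identity between the polynomials
   of the first and second kind replaces a spectral decomposition.  Rotation
   invariance alone gives P (|<b, z>| < t) <= sqrt n * t: rotating the coordinates
   X, Y of b by a small angle in E (clip_t X * Y) = 0 yields
   E (Y^2; |X| < t) <= t E |X|, and one sums over an orthonormal family of Y. *)
Require Import Defs.
From mathcomp Require Import all_boot all_order all_algebra.
From mathcomp Require Import all_classical all_reals all_analysis.
From mathcomp Require Import measurable_realfun.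
From mathcomp Require Import ring lra zify.

Set Implicit Arguments.
Unset Strict Implicit.
Unset Printing Implicit Defensive.

Import Order.TTheory GRing.Theory Num.Theory.
Import numFieldNormedType.Exports.

Local Open Scope classical_set_scope.
Local Open Scope ring_scope.

(** * Euclidean geometry *)

Section EuclideanSpace.
Variables (R : realType) (n : nat).
Implicit Types (u v w : 'cV[R]_n) (A : 'M[R]_n) (a c : R).

Lemma dot_sum u v : dot u v = \sum_i u i 0 * v i 0.
Proof. by rewrite /dot mxE; apply: eq_bigr => i _; rewrite mxE. Qed.

Lemma dotC u v : dot u v = dot v u.
Proof. by rewrite !dot_sum; apply: eq_bigr => i _; rewrite mulrC. Qed.

Lemma dotDl u v w : dot (u + v) w = dot u w + dot v w.
Proof. by rewrite /dot linearD /= mulmxDl mxE. Qed.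

Lemma dotDr u v w : dot w (u + v) = dot w u + dot w v.
Proof. by rewrite /dot mulmxDr mxE. Qed.

Lemma dotNl u v : dot (- u) v = - dot u v.
Proof. by rewrite /dot linearN /= mulNmx mxE. Qed.

Lemma dotNr u v : dot u (- v) = - dot u v.
Proof. by rewrite /dot mulmxN mxE. Qed.

Lemma dotZl a u v : dot (a *: u) v = a * dot u v.
Proof. by rewrite /dot linearZ /= -scalemxAl mxE. Qed.

Lemma dotZr a u v : dot u (a *: v) = a * dot u v.
Proof. by rewrite /dot -scalemxAr mxE. Qed.

Lemma dot0l u : dot 0 u = 0.
Proof. by rewrite /dot linear0 mul0mx mxE. Qed.

Lemma dot0r u : dot u 0 = 0.
Proof. by rewrite /dot mulmx0 mxE. Qed.

Lemma dot_suml (I : Type) (r : seq I) (P : pred I) (f : I -> 'cV[R]_n) v :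
  dot (\sum_(i <- r | P i) f i) v = \sum_(i <- r | P i) dot (f i) v.
Proof.
by elim/big_rec2: _ => [|i y1 y2 _ <-]; rewrite ?dot0l ?dotDl.
Qed.

Lemma dot_sumr (I : Type) (r : seq I) (P : pred I) (f : I -> 'cV[R]_n) v :
  dot v (\sum_(i <- r | P i) f i) = \sum_(i <- r | P i) dot v (f i).
Proof. by rewrite dotC dot_suml; apply: eq_bigr => i _; rewrite dotC. Qed.

Definition dotE := (dotDl, dotDr, dotNl, dotNr, dotZl, dotZr, dot0l, dot0r).

Lemma dot_ge0 u : 0 <= dot u u.
Proof. by rewrite dot_sum; apply: sumr_ge0 => i _; rewrite -expr2 sqr_ge0. Qed.

Lemma dot_eq0 u : (dot u u == 0) = (u == 0).
Proof.
apply/eqP/eqP => [|->]; last exact: dot0l.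
rewrite dot_sum => /eqP; rewrite psumr_eq0 => [/allP h|i _]; last first.
  by rewrite -expr2 sqr_ge0.
apply/matrixP => i j; rewrite (ord1 j) mxE; apply/eqP.
by have := h i (mem_index_enum i); rewrite -expr2 sqrf_eq0.
Qed.

Lemma dot_gt0 u : (0 < dot u u) = (u != 0).
Proof. by rewrite lt_def dot_ge0 andbT dot_eq0. Qed.

Lemma sqr_enorm u : enorm u ^+ 2 = dot u u.
Proof. by rewrite /enorm sqr_sqrtr // dot_ge0. Qed.

Lemma enorm_ge0 u : 0 <= enorm u.
Proof. exact: sqrtr_ge0. Qed.

Lemma enorm_eq0 u : (enorm u == 0) = (u == 0).
Proof. by rewrite -dot_eq0 -sqr_enorm sqrf_eq0. Qed.

Lemma enorm0 : enorm (0 : 'cV[R]_n) = 0.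
Proof. by apply/eqP; rewrite enorm_eq0. Qed.

Lemma enorm_gt0 u : (0 < enorm u) = (u != 0).
Proof. by rewrite lt_def enorm_ge0 andbT enorm_eq0. Qed.

Lemma enormZ a u : enorm (a *: u) = `|a| * enorm u.
Proof.
by rewrite /enorm dotZl dotZr mulrA -expr2 sqrtrM ?sqr_ge0 // sqrtr_sqr.
Qed.

Lemma enormN u : enorm (- u) = enorm u.
Proof. by rewrite -scaleN1r enormZ normrN1 mul1r. Qed.

Lemma dot_sqr_le u v : dot u v ^+ 2 <= dot u u * dot v v.
Proof.
have [->|v0] := eqVneq v 0; first by rewrite !dot0r expr0n mulr0.
have v1 : 0 < dot v v by rewrite dot_gt0.
rewrite -subr_ge0 -(pmulr_rge0 _ v1).
have := dot_ge0 (dot v v *: u - dot u v *: v).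
rewrite !dotE (dotC v u); congr (0 <= _); ring.
Qed.

Lemma normr_dot_le u v : `|dot u v| <= enorm u * enorm v.
Proof.
rewrite -(ler_pXn2r (n:=2)) ?nnegrE ?mulr_ge0 ?enorm_ge0 //.
by rewrite real_normK ?num_real // exprMn !sqr_enorm dot_sqr_le.
Qed.

Lemma dot_le u v : dot u v <= enorm u * enorm v.
Proof. exact: le_trans (ler_norm _) (normr_dot_le u v). Qed.

Lemma enormD u v : enorm (u + v) <= enorm u + enorm v.
Proof.
rewrite -(ler_pXn2r (n:=2)) ?nnegrE ?addr_ge0 ?enorm_ge0 //.
rewrite sqr_enorm !dotE (dotC v u) -!sqr_enorm.
by have := dot_le u v; nra.
Qed.

Lemma enorm_le_dot (c : R) u : 0 <= c ->
  (forall e, dot e u <= c * enorm e) -> enorm u <= c.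
Proof.
move=> c0 /(_ u); rewrite -sqr_enorm expr2.
have [-> //|u0] := eqVneq (enorm u) 0.
by rewrite ler_pM2r // lt_def u0 enorm_ge0.
Qed.

Lemma dot_mulmxl A u v : dot (A *m u) v = dot u (A^T *m v).
Proof. by rewrite /dot trmx_mul mulmxA. Qed.

Lemma dot_sym A u v : A^T = A -> dot u (A *m v) = dot v (A *m u).
Proof. by move=> sA; rewrite -{1}sA -dot_mulmxl dotC. Qed.

Lemma normr_coord_le u i : `|u i 0| <= enorm u.
Proof.
rewrite -sqrtr_sqr /enorm ler_wsqrtr // dot_sum (bigD1 i) //= -expr2 lerDl.
by apply: sumr_ge0 => j _; rewrite -expr2 sqr_ge0.
Qed.

Lemma enorm_le_sum u : enorm u <= \sum_i `|u i 0|.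
Proof.
rewrite -(ler_pXn2r (n:=2)) ?nnegrE ?sumr_ge0 ?enorm_ge0 //.
rewrite sqr_enorm dot_sum expr2 mulr_suml; apply: ler_sum => i _.
rewrite -expr2 -real_normK ?num_real // expr2 ler_wpM2l //.
by rewrite (bigD1 i) //= lerDl sumr_ge0.
Qed.

Lemma enorm_mulmx_bounded A :
  exists c : R, 0 <= c /\ forall v, enorm (A *m v) <= c * enorm v.
Proof.
exists (\sum_i \sum_j `|A i j|); split; first by do 2!apply: sumr_ge0 => ? _.
move=> v; apply: le_trans (enorm_le_sum _) _.
rewrite mulr_suml; apply: ler_sum => i _; rewrite mxE.
apply: le_trans (ler_norm_sum _ _ _) _; rewrite mulr_suml.
by apply: ler_sum => j _; rewrite normrM ler_wpM2l // normr_coord_le.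
Qed.

Lemma spectral_norm_has_sup A :
  has_sup [set enorm (A *m v) | v in [set v : 'cV[R]_n | enorm v <= 1]].
Proof.
split; first by exists (enorm (A *m 0)); exists 0 => //=; rewrite enorm0.
have [c [c0 hc]] := enorm_mulmx_bounded A.
exists c => _ [v /= v1 <-]; apply: le_trans (hc v) _.
by rewrite -[leRHS]mulr1 ler_wpM2l.
Qed.

Lemma spectral_norm_ge0 A : 0 <= spectral_norm A.
Proof.
apply: sup_upper_bound; first exact: spectral_norm_has_sup.
by exists 0 => /=; rewrite ?mulmx0 enorm0.
Qed.

Lemma enorm_mulmx_le A v : enorm (A *m v) <= spectral_norm A * enorm v.
Proof.
have [->|v0] := eqVneq v 0; first by rewrite mulmx0 enorm0 mulr0.
have v1 : 0 < enorm v by rewrite enorm_gt0.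
rewrite -ler_pdivrMr //.
apply: sup_upper_bound; first exact: spectral_norm_has_sup.
exists ((enorm v)^-1 *: v) => /=.
  by rewrite enormZ ger0_norm ?invr_ge0 ?enorm_ge0 // mulVf ?gt_eqF.
by rewrite -scalemxAr enormZ ger0_norm ?invr_ge0 ?enorm_ge0 // mulrC.
Qed.

Lemma normr_dot_mulmx_le A u v :
  `|dot u (A *m v)| <= spectral_norm A * enorm u * enorm v.
Proof.
apply: le_trans (normr_dot_le _ _) _.
by rewrite -mulrA mulrCA ler_wpM2l ?enorm_ge0 // enorm_mulmx_le.
Qed.

Lemma dot_delta i u : dot (delta_mx i 0) u = u i 0.
Proof.
rewrite dot_sum (bigD1 i) //= mxE !eqxx mul1r big1 ?addr0 // => j ji.
by rewrite mxE (negbTE ji) mul0r.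
Qed.

Lemma vector_sum u : u = \sum_i u i 0 *: delta_mx i 0.
Proof.
apply/matrixP => i j; rewrite (ord1 j) summxE (bigD1 i) //= !mxE !eqxx mulr1.
by rewrite big1 ?addr0 // => k ki; rewrite !mxE eq_sym (negbTE ki) mulr0.
Qed.

End EuclideanSpace.

(** * The capped conjugate gradient method *)

Section CappedCGTheory.
Variables (R : realType) (n : nat).
Variables (H : 'M[R]_n) (g : 'cV[R]_n) (eps : R).
Hypotheses (symH : H^T = H) (eps0 : 0 < eps).

Local Notation Hb := (cg_Hbar H eps).
Local Notation y := (cg_y H g eps).
Local Notation r := (cg_r H g eps).
Local Notation p := (cg_p H g eps).
Local Notation curv v := (dot v (Hb *m v)).
Local Notation alpha j := (dot (r j) (r j) / curv (p j)).

Lemma sym_cg_Hbar : Hb^T = Hb.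
Proof. by rewrite /cg_Hbar linearD /= tr_scalar_mx symH. Qed.

Lemma cg_curvE (v : 'cV[R]_n) : curv v = dot v (H *m v) + 2 * eps * dot v v.
Proof. by rewrite /cg_Hbar mulmxDl mul_scalar_mx dotDr dotZr. Qed.

Lemma cg_lowE (v : 'cV[R]_n) :
  cg_low H eps v = (dot v (H *m v) < - eps * dot v v).
Proof. by rewrite /cg_low cg_curvE sqr_enorm; apply/idP/idP; lra. Qed.

Lemma cg_stateS j : cg_state H g eps j.+1 =
  (y j + alpha j *: p j, r j + alpha j *: (Hb *m p j),
   - (r j + alpha j *: (Hb *m p j)) +
   (enorm (r j + alpha j *: (Hb *m p j)) ^+ 2 / enorm (r j) ^+ 2) *: p j).
Proof. by rewrite /cg_y /cg_r /cg_p /=; case: (cg_state H g eps j) => [[]]. Qed.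

Lemma cg_yS j : y j.+1 = y j + alpha j *: p j.
Proof. by rewrite /cg_y cg_stateS. Qed.

Lemma cg_rS j : r j.+1 = r j + alpha j *: (Hb *m p j).
Proof. by rewrite /cg_r cg_stateS. Qed.

Lemma cg_pS j : p j.+1 = - r j.+1 +
  (dot (r j.+1) (r j.+1) / dot (r j) (r j)) *: p j.
Proof. by rewrite -!sqr_enorm cg_rS /cg_p cg_stateS. Qed.

Lemma cg_residualE j : r j = g + Hb *m y j.
Proof.
elim: j => [|j IH]; first by rewrite mulmx0 addr0.
by rewrite cg_rS cg_yS {1}IH mulmxDr -scalemxAr addrA.
Qed.

Definition cg_regular k :=
  forall i, (i < k)%N -> 0 < curv (p i) /\ r i != 0.

Lemma cg_regularW k j : (j <= k)%N -> cg_regular k -> cg_regular j.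
Proof. by move=> jk h i ij; apply: h; exact: leq_trans jk. Qed.

Lemma cg_orthogonality k : cg_regular k ->
  [/\ forall i j, (i < j <= k)%N -> dot (r j) (p i) = 0,
      forall i j, (i < j <= k)%N -> dot (r j) (r i) = 0,
      forall i j, (i < j <= k)%N -> dot (p j) (Hb *m p i) = 0 &
      forall j, (j <= k)%N -> dot (r j) (p j) = - dot (r j) (r j)].
Proof.
elim: k => [_|k IH reg].
  split=> [i j|i j|i j|j]; try by case: j => [|j]; rewrite ?ltn0 ?andbF.
  by rewrite leqn0 => /eqP->; rewrite /cg_p /= dotNr.
have [rp rr pHp rpj] := IH (cg_regularW (leqnSn _) reg).
have [curv_k rk0] := reg k (ltnSn k).
have rk1 : dot (r k) (r k) != 0 by rewrite dot_eq0.
have rp1 i : (i <= k)%N -> dot (r k.+1) (p i) = 0.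
  rewrite leq_eqVlt => /orP[/eqP->|ik].
    rewrite cg_rS dotDl dotZl rpj // (dotC (Hb *m _)) divfK ?gt_eqF //.
    by rewrite addNr.
  rewrite cg_rS dotDl dotZl rp ?ik ?leqnn // (dotC (Hb *m _)).
  by rewrite (dot_sym (p i) _ sym_cg_Hbar) (pHp i k) ?ik ?leqnn // mulr0 addr0.
have rr1 i : (i <= k)%N -> dot (r k.+1) (r i) = 0.
  case: i => [_|i ik].
    have -> : r 0 = - p 0 by rewrite /cg_r /cg_p /= opprK.
    by rewrite dotNr rp1 // oppr0.
  have -> : r i.+1 = - p i.+1 +
      (dot (r i.+1) (r i.+1) / dot (r i) (r i)) *: p i.
    by rewrite cg_pS opprD opprK addrNK.
  by rewrite !dotE !rp1 ?(ltnW ik) // oppr0 mulr0 addr0.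
have pHp1 i : (i <= k)%N -> dot (p k.+1) (Hb *m p i) = 0.
  move=> ik; have [ci ri0] := reg i ik.
  have ai0 : alpha i != 0.
    by rewrite mulf_neq0 ?invr_eq0 ?dot_eq0 ?(gt_eqF ci).
  have HpE : Hb *m p i = (alpha i)^-1 *: (r i.+1 - r i).
    by rewrite cg_rS addrC addKr scalerA mulVf // scale1r.
  rewrite cg_pS dotDl dotNl dotZl.
  have -> : dot (r k.+1) (Hb *m p i) =
      (if i == k then dot (r k.+1) (r k.+1) / alpha k else 0).
    rewrite HpE dotZr dotDr dotNr (rr1 i ik) subr0; case: eqP => [->|/eqP ne].
      by rewrite mulrC.
    by rewrite rr1 ?mulr0 // ltn_neqAle ne.
  case: eqP => [->|/eqP ne]; last first.
    by rewrite (pHp i k) ?mulr0 ?addr0 ?oppr0 // leqnn andbT ltn_neqAle ne.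
  field; rewrite rk1 /=.
  by rewrite gt_eqF.
split=> [i j|i j|i j|j].
- move=> /andP[ij]; rewrite leq_eqVlt => /orP[/eqP e|jk].
    by move: ij; rewrite e => ij; exact: rp1.
  by apply: rp; rewrite ij.
- move=> /andP[ij]; rewrite leq_eqVlt => /orP[/eqP e|jk].
    by move: ij; rewrite e => ij; exact: rr1.
  by apply: rr; rewrite ij.
- move=> /andP[ij]; rewrite leq_eqVlt => /orP[/eqP e|jk].
    by move: ij; rewrite e => ij; exact: pHp1.
  by apply: pHp; rewrite ij.
rewrite leq_eqVlt => /orP[/eqP->|]; last exact: rpj.
by rewrite [in dot _ (p _)]cg_pS dotDr dotNr dotZr rp1 // mulr0 addr0.
Qed.

Lemma cg_residual_orth_y k s t : cg_regular k -> (s <= t <= k)%N ->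
  dot (r t) (y s) = 0.
Proof.
move=> /cg_orthogonality[rp _ _ _].
elim: s => [|s IH] /andP[st tk]; first by rewrite dot0r.
by rewrite cg_yS dotDr dotZr IH ?(ltnW st) // rp ?st // mulr0 addr0.
Qed.

Lemma cg_curv_p_le k j : cg_regular k -> (j <= k)%N -> curv (p j) <= curv (r j).
Proof.
move=> reg jk; have [_ _ pHp _] := cg_orthogonality reg.
case: j jk => [_|j jk].
  by rewrite /cg_p /cg_r /= mulmxN dotNl dotNr opprK.
have := pHp j j.+1; rewrite leqnn jk => /(_ isT).
have [cj _] := reg j jk.
set b := dot (r j.+1) (r j.+1) / dot (r j) (r j).
have pE : p j.+1 = - r j.+1 + b *: p j by rewrite cg_pS.
move=> e0; have e : dot (r j.+1) (Hb *m p j) = b * curv (p j).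
  by apply/esym/eqP; rewrite -subr_eq0 -e0 pE dotDl dotNl dotZl addrC.
rewrite [leLHS](_ : _ = - dot (r j.+1) (Hb *m p j.+1)); last first.
  rewrite {1}pE dotDl dotNl dotZl (dot_sym (p j) _ sym_cg_Hbar) e0.
  by rewrite mulr0 addr0.
rewrite pE mulmxDr mulmxN -scalemxAr dotDr dotNr dotZr e.
by nra.
Qed.

Definition cg_model (v : 'cV[R]_n) : R := curv v / 2 + dot g v.

Lemma cg_modelE (z v : 'cV[R]_n) :
  cg_model z = cg_model v + dot (g + Hb *m v) (z - v) + curv (z - v) / 2.
Proof.
have {1}-> : z = v + (z - v) by rewrite addrC subrK.
move: (z - v) => w; rewrite /cg_model mulmxDr.
rewrite !dotE (dot_sym v w sym_cg_Hbar) (dotC (Hb *m v) w); by field.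
Qed.

Lemma cg_model_decrease k j (L : R) : cg_regular k -> (j < k)%N -> 0 < L ->
  curv (r j) <= L * dot (r j) (r j) ->
  cg_model (y j.+1) <= cg_model (y j) - dot (r j) (r j) / (2 * L).
Proof.
move=> reg jk L0 curv_le; have [cj rj] := reg j jk.
have [_ _ _ rpj] := cg_orthogonality reg.
rewrite (cg_modelE (y j.+1) (y j)) -cg_residualE cg_yS.
have -> : y j + alpha j *: p j - y j = alpha j *: p j by rewrite addrC addKr.
rewrite -scalemxAr !dotE rpj ?(ltnW jk) //.
have cle := le_trans (cg_curv_p_le reg (ltnW jk)) curv_le.
have rj0 : 0 < dot (r j) (r j) by rewrite dot_gt0.
set a := dot (r j) (r j) in rj0 cle *; set c := curv (p j) in cj cle *.
have -> : cg_model (y j) + a / c * - a + a / c * (a / c * c) / 2 =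
    cg_model (y j) - a ^+ 2 / (2 * c) by field; rewrite gt_eqF.
rewrite lerD2l lerN2 ler_pdivrMr ?mulr_gt0 // mulrAC ler_pdivlMr ?mulr_gt0 //.
by nra.
Qed.

(* Nesterov's estimate sequence: the quadratics [c_i + eps/2 |z - v_i|^2]
   average the lower models of the objective at [y 0, ..., y (i-1)].  For CG the
   cross term of the recursion vanishes, as [r i] is orthogonal to [v_i]. *)
Lemma cg_estimate_sequence k j (s : R) : cg_regular k -> (j < k)%N ->
  0 < s <= 1 ->
  (forall i, (i <= j)%N ->
     s ^+ 2 * curv (r i) <= eps * dot (r i) (r i)) ->
  (forall i, (i <= j)%N -> eps * dot (y j.+1 - y i) (y j.+1 - y i)
                           <= curv (y j.+1 - y i)) ->
  cg_model (y j) - cg_model (y j.+1) <=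
    (1 - s) ^+ j * (eps / 2 * dot (y j.+1) (y j.+1) - cg_model (y j.+1)).
Proof.
move=> reg jk /andP[s0 s1] curv_le strong; set z := y j.+1.
suff est i : (i <= j)%N -> exists (v : 'cV[R]_n) (c : R),
    [/\ forall t, (i <= t <= j)%N -> dot (r t) v = 0,
        cg_model (y i) <= c &
        c + eps / 2 * dot (z - v) (z - v) - cg_model z <=
        (1 - s) ^+ i * (eps / 2 * dot z z - cg_model z)].
  have [v [c [_ h1 h2]]] := est j (leqnn j).
  apply: le_trans h2; rewrite lerD2r (le_trans h1) // lerDl.
  by rewrite mulr_ge0 ?dot_ge0 // divr_ge0 // ltW.
elim: i => [_|i IH ij].
  exists 0, 0; split=> [t _||]; rewrite ?dot0r //.
    by rewrite /cg_model /cg_y /= mulmx0 !dot0r mul0r addr0.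
  by rewrite subr0 add0r expr0 mul1r.
have [v [c [rv h1 h2]]] := IH (ltnW ij).
have rvi : dot (r i) v = 0 by apply: rv; rewrite leqnn ltnW.
have ryi : dot (r i) (y i) = 0.
  by apply: cg_residual_orth_y reg _; rewrite leqnn /= ltnW // (ltn_trans ij).
have [_ rr _ _] := cg_orthogonality reg.
exists ((1 - s) *: v + s *: y i - (s / eps) *: r i).
exists ((1 - s) * c + s * cg_model (y i) +
  eps / 2 * s * (1 - s) * dot (y i - v) (y i - v)
  - s ^+ 2 / (2 * eps) * dot (r i) (r i)); split=> [t /andP[it tj]||].
- rewrite !dotE rv ?tj ?(ltnW it) // rr ?it /= ?(leq_trans tj) 1?ltnW //.
  rewrite (cg_residual_orth_y (k := k)) // ?(ltnW it) ?(leq_trans tj) 1?ltnW //.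
  by rewrite !mulr0 oppr0 !addr0.
- have s20 : 0 < s ^+ 2 by rewrite exprn_gt0.
  have L0 : 0 < eps / s ^+ 2 by rewrite divr_gt0.
  have := cg_model_decrease (j := i) (L := eps / s ^+ 2) reg.
  rewrite (leq_trans ij (ltnW jk)) L0 => /(_ isT isT).
  have -> : dot (r i) (r i) / (2 * (eps / s ^+ 2)) =
      s ^+ 2 / (2 * eps) * dot (r i) (r i).
    by field; rewrite !gt_eqF.
  rewrite mulrAC ler_pdivlMr // mulrC => /(_ (curv_le _ (ltnW ij))).
  have := mulr_ge0 (mulr_ge0 (mulr_ge0 (ltW eps0) (ltW s0)) _)
     (dot_ge0 (y i - v)).
  move=> /(_ (1 - s)); rewrite subr_ge0 => /(_ s1).
  have : 0 <= (1 - s) * (c - cg_model (y i)).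
    by rewrite mulr_ge0 // subr_ge0.
  lra.
- have := strong i (ltnW ij); rewrite -/z => strongi.
  have := cg_modelE z (y i); rewrite -cg_residualE => mE.
  have low : cg_model (y i) + dot (r i) (z - y i) +
      eps / 2 * dot (z - y i) (z - y i) <= cg_model z by lra.
  rewrite [(1 - s) ^+ i.+1]exprS -[leRHS]mulrA.
  set E := (1 - s) ^+ i * _ in h2 *.
  apply: (@le_trans _ _ ((1 - s) *
     (c + eps / 2 * dot (z - v) (z - v) - cg_model z))); last first.
    by rewrite ler_wpM2l // subr_ge0.
  set q := cg_model (y i) in low h1 *; set qz := cg_model z in low h2 mE *.
  have : 0 <= s * (qz - (q + dot (r i) (z - y i) +
      eps / 2 * dot (z - y i) (z - y i))).
    by rewrite mulr_ge0 ?(ltW s0) // subr_ge0.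
  rewrite -subr_ge0 => hs; rewrite -subr_ge0.
  move: hs; rewrite !dotE (dotC v z) (dotC (y i) z) (dotC (r i) z) (dotC v (r i))
    (dotC (y i) (r i)) (dotC (y i) v) rvi ryi.
  congr (0 <= _); field; rewrite gt_eqF //.
Qed.

Lemma cg_residual_decay k j (L : R) : cg_regular k -> (j < k)%N -> eps <= L ->
  (forall i, (i <= j)%N -> curv (r i) <= L * dot (r i) (r i)) ->
  (forall i, (i <= j)%N -> eps * dot (y j.+1 - y i) (y j.+1 - y i)
                           <= curv (y j.+1 - y i)) ->
  dot (r j) (r j) <=
    4 * (L / eps) * (1 - (Num.sqrt (L / eps))^-1) ^+ j * dot g g.
Proof.
move=> reg jk epsL curv_le strong.
have L0 : 0 < L by exact: lt_le_trans epsL.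
set K := Num.sqrt (L / eps).
have K2 : K ^+ 2 = L / eps by rewrite sqr_sqrtr // divr_ge0 // ltW.
have K1 : 1 <= K.
  rewrite -sqrtr1 ler_wsqrtr // ler_pdivlMr // mul1r //.
have K0 : 0 < K by rewrite (lt_le_trans ltr01).
have s01 : 0 < K^-1 <= 1 by rewrite invr_gt0 K0 invf_le1.
have s2 : K^-1 ^+ 2 = eps / L.
  by rewrite exprVn K2 invf_div.
have h1 : forall i, (i <= j)%N -> K^-1 ^+ 2 * curv (r i) <= eps * dot (r i) (r i).
  move=> i ij; rewrite s2 -mulrA ler_pM2l // ler_pdivrMl //; exact: curv_le.
have est := cg_estimate_sequence reg jk s01 h1 strong.
have dec i (ij : (i <= j)%N) : cg_model (y i.+1) <= cg_model (y i)
    - dot (r i) (r i) / (2 * L).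
  by apply: cg_model_decrease reg _ L0 (curv_le i ij); exact: leq_ltn_trans jk.
have mono i : (i <= j)%N -> cg_model (y i.+1) <= 0.
  elim: i => [|i IH] ij; apply: le_trans (dec _ ij) _.
    rewrite /cg_model /cg_y /= mulmx0 !dot0r mul0r add0r sub0r oppr_le0.
    by rewrite divr_ge0 ?dot_ge0 // mulr_ge0 // ltW.
  apply: le_trans (IH (ltnW ij)).
  by rewrite gerBl divr_ge0 ?dot_ge0 // mulr_ge0 // ltW.
have z0 := mono j (leqnn j); have decj := dec j (leqnn j).
set z := y j.+1 in est decj z0 strong *.
have strong0 := strong 0%N (leq0n j).
rewrite /cg_y /= subr0 in strong0.
have gz : eps / 2 * dot z z <= cg_model z - dot g z.
  by rewrite /cg_model; lra.
have nz : enorm z <= 2 * enorm g / eps.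
  rewrite ler_pdivlMr //.
  have [->|zn0] := eqVneq (enorm z) 0; first by rewrite mul0r mulr_ge0 ?enorm_ge0.
  rewrite -(ler_pM2r (x := enorm z)); last by rewrite lt_def zn0 enorm_ge0.
  have := dot_le (- g) z; rewrite dotNl enormN => gz2.
  have := sqr_enorm z; nra.
have bnd : eps / 2 * dot z z - cg_model z <= 2 / eps * dot g g.
  have := dot_le (- g) z; rewrite dotNl enormN => gz2.
  apply: (@le_trans _ _ (enorm g * enorm z)); first by lra.
  rewrite -sqr_enorm.
  apply: le_trans (ler_wpM2l (enorm_ge0 g) nz) _.
  by rewrite le_eqVlt; apply/orP; left; apply/eqP; field; rewrite gt_eqF.
have q0 : 0 <= (1 - K^-1) ^+ j.
  by apply: exprn_ge0; rewrite subr_ge0; case/andP: s01.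
have : dot (r j) (r j) / (2 * L) <= (1 - K^-1) ^+ j * (2 / eps * dot g g).
  apply: (@le_trans _ _ ((1 - K^-1) ^+ j * (eps / 2 * dot z z - cg_model z))).
    by lra.
  by rewrite ler_wpM2l.
rewrite ler_pdivrMr ?mulr_gt0 // => /le_trans; apply.
rewrite le_eqVlt; apply/orP; left; apply/eqP; field; rewrite gt_eqF //.
Qed.

End CappedCGTheory.

Lemma orthogonal_family_size (R : realType) (n m : nat) (f : 'I_m -> 'cV[R]_n) :
  (forall i, f i != 0) -> (forall i j, i != j -> dot (f i) (f j) = 0) ->
  (m <= n)%N.
Proof.
move=> f0 orth.
pose M : 'M[R]_(m, n) := \matrix_(i, k) f i k 0.
pose N : 'M[R]_(n, m) := \matrix_(k, i) (f i k 0 / dot (f i) (f i)).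
apply: (@mulmx1_min R _ _ M N).
apply/matrixP => i j; rewrite !mxE.
under eq_bigr do rewrite !mxE mulrA.
rewrite -mulr_suml -dot_sum; have [->|ij] := eqVneq i j.
  by rewrite divff // dot_eq0.
by rewrite orth // mul0r.
Qed.

Section CappedCGGuarantees.
Variables (R : realType) (n : nat).
Variables (H : 'M[R]_n) (g : 'cV[R]_n) (eps zeta : R).
Hypotheses (symH : H^T = H) (eps0 : 0 < eps) (zeta01 : 0 < zeta < 1).
Hypothesis g0 : g != 0.

Local Notation Hb := (cg_Hbar H eps).
Local Notation y := (cg_y H g eps).
Local Notation r := (cg_r H g eps).
Local Notation p := (cg_p H g eps).
Local Notation U := (cg_U H g eps 0).
Local Notation curv v := (dot v (Hb *m v)).
Local Notation low := (cg_low H eps).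
Local Notation applicable := (cg_applicable H g eps zeta 0).

Lemma cg_update_ge (V : R) (v : 'cV[R]_n) : V <= cg_update H V v.
Proof.
rewrite /cg_update; case: ifP => // h; rewrite ler_pdivlMr ?ltW //.
rewrite enorm_gt0; apply: contraTneq h => ->.
by rewrite mulmx0 enorm0 mulr0 ltxx.
Qed.

Lemma cg_update_bound (V : R) (v : 'cV[R]_n) :
  enorm (H *m v) <= cg_update H V v * enorm v.
Proof.
rewrite /cg_update; case: ifP => [h|/negbT]; last by rewrite -leNgt.
rewrite divfK // enorm_eq0; apply: contraTneq h => ->.
by rewrite mulmx0 enorm0 mulr0 ltxx.
Qed.

Lemma cg_update_le (M V : R) (v : 'cV[R]_n) :
  V <= M -> enorm (H *m v) <= M * enorm v -> cg_update H V v <= M.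
Proof.
rewrite /cg_update; case: ifP => // h _ hM; rewrite ler_pdivrMr //.
rewrite enorm_gt0; apply: contraTneq h => ->.
by rewrite mulmx0 enorm0 mulr0 ltxx.
Qed.

Lemma cg_U_nondecreasing i j : (i <= j)%N -> U i <= U j.
Proof.
elim: j => [|j IH]; first by rewrite leqn0 => /eqP->.
rewrite leq_eqVlt => /orP[/eqP->//|/IH]; move/le_trans; apply.
by rewrite /=; do 3!apply: le_trans (cg_update_ge _ _).
Qed.

Lemma cg_U_r j : enorm (H *m r j) <= U j * enorm (r j).
Proof.
case: j => [|j]; first last.
  exact: (cg_update_bound (cg_update H (cg_update H (U j) (p j.+1)) (y j.+1))).
have -> : r 0 = - p 0 by rewrite /cg_r /cg_p /= opprK.
rewrite mulmxN (enormN (H *m p 0)) (enormN (p 0)).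
exact: (cg_update_bound 0 (p 0)).
Qed.

Lemma cg_U_y j : enorm (H *m y j) <= U j * enorm (y j).
Proof.
case: j => [|j]; first by rewrite /cg_y /= mulmx0 enorm0 mulr0.
set V := cg_update H (cg_update H (U j) (p j.+1)) (y j.+1).
apply: (@le_trans _ _ (V * enorm (y j.+1))); first exact: cg_update_bound.
by rewrite ler_wpM2r ?enorm_ge0 // (cg_update_ge V).
Qed.

Lemma cg_U_ge0 j : 0 <= U j.
Proof.
apply: le_trans (cg_U_nondecreasing (leq0n j)); exact: cg_update_ge.
Qed.

Lemma cg_U_le j : U j <= spectral_norm H.
Proof.
elim: j => [|j IH] /=; do ?apply: cg_update_le; rewrite ?enorm_mulmx_le //.
exact: spectral_norm_ge0.
Qed.

Lemma cg_kappa_ge2 (V : R) : 0 <= V -> 2 <= cg_kappa eps V.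
Proof. by move=> V0; rewrite /cg_kappa ler_pdivlMr // lerDr. Qed.

Lemma cg_zetahat_bounds (V : R) : 0 <= V ->
  0 < cg_zetahat eps zeta V <= 1 / 6.
Proof.
move=> /cg_kappa_ge2; have /andP[z0 z1] := zeta01.
rewrite /cg_zetahat; set K := cg_kappa _ _ => K2.
rewrite divr_gt0 //=; last by rewrite mulr_gt0 //; lra.
by rewrite ler_pdivrMr; lra.
Qed.

Lemma cg_curv_le (V : R) (v : 'cV[R]_n) : enorm (H *m v) <= V * enorm v ->
  curv v <= (V + 2 * eps) * dot v v.
Proof.
move=> h; rewrite cg_curvE [(V + _) * _]mulrDl lerD2r; apply: le_trans (dot_le _ _) _.
by rewrite -sqr_enorm expr2 mulrCA ler_wpM2l ?enorm_ge0.
Qed.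

Lemma cg_regular_not_applicable J : ~~ low (p 0) ->
  (forall j, (0 < j < J)%N -> ~~ applicable j) -> cg_regular H g eps J.
Proof.
move=> p00 na; suff reg k : (k <= J)%N -> cg_regular H g eps k by exact: reg.
elim: k => [_ i //|k IH kJ].
have regk := IH (ltnW kJ).
have [_ _ _ rp] := cg_orthogonality symH regk.
have [nlow rk0] : ~~ low (p k) /\ r k != 0.
  case: k kJ {IH regk rp} => [|k] kJ; first by split=> //; rewrite /cg_r.
  have := na k.+1; rewrite kJ => /(_ isT).
  rewrite /cg_applicable => /norP[_ /norP[rl /norP[pl _]]]; split=> //.
  move: rl; rewrite /cg_small_residual -ltNge => /le_lt_trans h.
  rewrite -enorm_gt0; apply: h; rewrite mulr_ge0 ?enorm_ge0 //.
  by case/andP: (cg_zetahat_bounds (cg_U_ge0 k.+1)) => /ltW.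
have pk0 : p k != 0.
  have := rp k (leqnn k); apply: contra_eq_neq => ->.
  by rewrite dot0r eq_sym oppr_eq0 dot_eq0.
move=> i; rewrite ltnS leq_eqVlt => /orP[/eqP->|ik]; last exact: regk.
split=> //; move: nlow; rewrite /cg_low -leNgt; apply: lt_le_trans.
by rewrite mulr_gt0 // exprn_gt0 // enorm_gt0.
Qed.

Lemma cg_regular_size J : cg_regular H g eps J -> (J <= n)%N.
Proof.
move=> reg; have [_ rr _ _] := cg_orthogonality symH reg.
apply: (@orthogonal_family_size R n J (fun i => r i)) => [i|i j ij].
  by have [] := reg i (ltn_ord i).
have [ltij|ltji|/ord_inj e] := ltngtP i j; last by rewrite e eqxx in ij.
- by rewrite dotC rr // ltij ltnW.
- by rewrite rr // ltji ltnW.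
Qed.

Lemma cg_slow_decay_search J : cg_regular H g eps J.+1 -> ~~ low (p J) ->
  cg_slow_decay H g eps 0 J ->
  exists i, (i < J)%N && low (y J.+1 - y i).
Proof.
move=> reg nlow slow; apply: contrapT => noi.
have strong i : (i <= J)%N ->
    eps * dot (y J.+1 - y i) (y J.+1 - y i) <= curv (y J.+1 - y i).
  rewrite leq_eqVlt => /orP[/eqP->|iJ].
    have -> : y J.+1 - y J = (dot (r J) (r J) / curv (p J)) *: p J.
      by rewrite cg_yS addrC addKr.
    rewrite -scalemxAr !dotZl !dotZr; move: nlow.
    rewrite /cg_low -leNgt sqr_enorm => nlow.
    set a := _ / _; rewrite -sqr_enorm in nlow *.
    have := sqr_ge0 a; nra.
  rewrite -sqr_enorm leNgt; apply/negP => lowi.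
  by apply: noi; exists i; rewrite iJ.
have U0 := cg_U_ge0 J.
have K2 := cg_kappa_ge2 U0.
have epsL : eps <= U J + 2 * eps by move: eps0 U0; set V := U J; lra.
have curv_le i : (i <= J)%N -> curv (r i) <= (U J + 2 * eps) * dot (r i) (r i).
  move=> iJ; apply: cg_curv_le; apply: le_trans (cg_U_r i) _.
  by rewrite ler_wpM2r ?enorm_ge0 // cg_U_nondecreasing.
have := cg_residual_decay symH eps0 reg (ltnSn J) epsL curv_le strong.
rewrite -/(cg_kappa eps (U J)); move: slow.
rewrite /cg_slow_decay /cg_T /cg_tau -[cg_r _ _ _ 0]/g.
move: (cg_kappa _ _) K2 => K K2.
set S := Num.sqrt K; set t := S / (S + 1) => slow.
have S1 : 1 <= S.
  by rewrite /S -[leLHS]sqrtr1 ler_wsqrtr //; apply: le_trans K2; rewrite ler1n.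
have t01 : 0 < t < 1.
  have S10 : 0 < S + 1 by lra.
  by rewrite /t divr_gt0 ?ltr_pdivrMr //=; lra.
have /andP[t0 t1] := t01.
have st : 0 < Num.sqrt t < 1.
  by rewrite sqrtr_gt0 t0 -[ltRHS]sqrtr1 ltr_sqrt.
set D := (1 - Num.sqrt t) ^+ 2.
have D01 : 0 < D <= 1.
  have /andP[s0 s1] := st; rewrite /D exprn_gt0 ?subr_gt0 //=.
  by rewrite expr_le1 //; lra.
have T4 : 4 * K <= 4 * K ^+ 4 / D.
  have /andP[D0 D1] := D01.
  rewrite ler_pdivlMr // -!mulrA ler_pM2l //.
  apply: (@le_trans _ _ K); first by rewrite ler_piMr //; lra.
  rewrite -[leLHS]expr1 ler_weXn2l //; lra.
apply/negP; rewrite -ltNge -!sqr_enorm.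
have pos : 0 <= 4 * K ^+ 4 / D.
  by apply: le_trans T4; lra.
apply: (@le_lt_trans _ _
  ((Num.sqrt (4 * K ^+ 4 / D) * t `^ (J%:R / 2) * enorm g) ^+ 2)); last first.
  by rewrite ltr_pXn2r ?nnegrE ?enorm_ge0 // !mulr_ge0 ?enorm_ge0
     ?sqrtr_ge0 ?powR_ge0.
rewrite !exprMn (sqr_sqrtr pos) !sqr_enorm.
have -> : (t `^ (J%:R / 2)) ^+ 2 = t ^+ J.
  rewrite -powR_mulrn ?powR_ge0 // -powRrM divfK // powR_mulrn //; exact: ltW.
rewrite ler_wpM2r ?dot_ge0 //.
have iS1 : S^-1 <= 1 by rewrite invf_le1 //; lra.
have iS0 : 0 < S^-1 by rewrite invr_gt0; lra.
apply: ler_pM => //; [by lra|by rewrite exprn_ge0 // subr_ge0|].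
apply: lerXn2r; rewrite ?nnegrE ?subr_ge0 ?(ltW t0) //.
have -> : t = 1 - (S + 1)^-1 by rewrite /t; field; rewrite gt_eqF //; lra.
rewrite lerD2l lerN2 lef_pV2 ?posrE; lra.
Qed.

Lemma capped_cg_terminates :
  exists ty v J, capped_cg H g eps zeta 0 ty v J.
Proof.
have [p0|p0] := boolP (low (p 0)).
  by exists NC, (p 0), 0%N; rewrite /capped_cg p0.
have ex : exists j, (0 < j)%N && applicable j.
  apply: contrapT => no.
  have reg : cg_regular H g eps n.+1.
    apply: cg_regular_not_applicable => // j /andP[j0 _]; apply/negP => a.
    by apply: no; exists j; rewrite j0.
  by have := cg_regular_size reg; rewrite ltnn.
case: (ex_minnP ex) => J /andP[J0 aJ] minJ.
have na j : (0 < j < J)%N -> ~~ applicable j.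
  move=> /andP[j0 jJ]; apply/negP => a.
  by have := minJ j; rewrite j0 a => /(_ isT); rewrite leqNgt jJ.
have reg := cg_regular_not_applicable p0 na.
rewrite /capped_cg (negbTE p0).
have [yl|yl] := boolP (low (y J)); first by exists NC, (y J), J; rewrite yl.
have [rs|rs] := boolP (cg_small_residual H g eps zeta 0 J).
  by exists SOL, (y J), J; rewrite (negbTE yl) rs.
have [pl|pl] := boolP (low (p J)).
  by exists NC, (p J), J; rewrite (negbTE yl) (negbTE rs) pl.
have slow : cg_slow_decay H g eps 0 J.
  by move: aJ; rewrite /cg_applicable (negbTE yl) (negbTE rs) (negbTE pl).
have regS : cg_regular H g eps J.+1.
  have [_ _ _ rp] := cg_orthogonality symH reg.
  have rJ0 : r J != 0.
    move: rs; rewrite /cg_small_residual -ltNge => /le_lt_trans h.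
    rewrite -enorm_gt0; apply: h; rewrite mulr_ge0 ?enorm_ge0 //.
    by case/andP: (cg_zetahat_bounds (cg_U_ge0 J)) => /ltW.
  have pJ0 : p J != 0.
    have := rp J (leqnn J); apply: contra_eq_neq => ->.
    by rewrite dot0r eq_sym oppr_eq0 dot_eq0.
  move=> i; rewrite ltnS leq_eqVlt => /orP[/eqP->|iJ]; last exact: reg.
  split=> //; move: (pl); rewrite /cg_low -leNgt; apply: lt_le_trans.
  by rewrite mulr_gt0 // exprn_gt0 // enorm_gt0.
have [i /andP[iJ li]] := cg_slow_decay_search regS pl slow.
exists NC, (y J.+1 - y i), J; rewrite (negbTE yl) (negbTE rs) (negbTE pl).
by split=> //; split=> //; exists i.
Qed.

Lemma capped_cg_NC v J : capped_cg H g eps zeta 0 NC v J ->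
  dot v (H *m v) < - eps * dot v v.
Proof.
rewrite -cg_lowE /capped_cg; case: ifP => [p0 [_ _ ->] //|_ [_ _ _]].
case: ifP => [yl [_ ->] //|_]; case: ifP => [_ [] //|_].
by case: ifP => [pl [_ ->] //|_ [_ [i [_ li ->]]]].
Qed.

Lemma capped_cg_SOL v J : capped_cg H g eps zeta 0 SOL v J ->
  [/\ v != 0, dot v g = - curv v, eps * dot v v <= curv v &
      enorm (Hb *m v + g) <= zeta * eps / 2 * enorm v].
Proof.
rewrite /capped_cg; case: ifP => [_ [] //|/negbT p0 [J0 na _]].
case: ifP => [_ [] //|/negbT yl].
case: ifP => [rs [_ ->]|_]; last by case: ifP => [_ []|_ []].
have reg := cg_regular_not_applicable p0 na.
have U0 := cg_U_ge0 J.
have /andP[zh0 zh6] := cg_zetahat_bounds U0.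
have /andP[z0 z1] := zeta01.
have ng : 0 < enorm g by rewrite enorm_gt0.
move: rs; rewrite /cg_small_residual cg_residualE -[cg_r _ _ _ 0]/g => rs.
split.
- apply: contraTneq rs => ->; rewrite mulmx0 addr0 -ltNge; nra.
- have := @cg_residual_orth_y _ _ H g eps symH J J J reg.
  rewrite !leqnn => /(_ isT); rewrite cg_residualE dotDl.
  by rewrite (dotC (Hb *m _)) (dotC g) => /eqP; rewrite addr_eq0 => /eqP.
- by move: yl; rewrite /cg_low -leNgt sqr_enorm.
rewrite addrC; have Hv : enorm (Hb *m y J) <= (U J + 2 * eps) * enorm (y J).
  rewrite /cg_Hbar mulmxDl mul_scalar_mx; apply: le_trans (enormD _ _) _.
  rewrite enormZ [(U J + _) * _]mulrDl ger0_norm ?mulr_ge0 ?(ltW eps0) //.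
  by rewrite lerD2r cg_U_y.
have gle : enorm g <= enorm (g + Hb *m y J) + enorm (Hb *m y J).
  by have := enormD (g + Hb *m y J) (- (Hb *m y J)); rewrite addrK enormN.
have K2 := cg_kappa_ge2 U0.
have UE : U J + 2 * eps = cg_kappa eps (U J) * eps.
  by rewrite /cg_kappa divfK // gt_eqF.
have zE : cg_zetahat eps zeta (U J) * cg_kappa eps (U J) = zeta / 3.
  rewrite /cg_zetahat; field; rewrite gt_eqF //; lra.
rewrite UE in Hv.
move: (cg_zetahat _ _ _) (cg_kappa _ _) zh0 zh6 rs zE Hv K2 => zh K.
have := enorm_ge0 (g + Hb *m y J).
move: (enorm (g + _)) (enorm (y J)) (enorm_ge0 (y J)) (enorm (Hb *m _)) gle.
move=> a b b0 c gle a0 zh0 zh6 rs zE Hv K2.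
have h1 : a <= zh * a + zh * c by nra.
have h2 : zh * c <= zeta / 3 * eps * b.
  by rewrite -zE -!mulrA ler_pM2l // mulrA.
have W0 : 0 <= zeta * eps * b by rewrite !mulr_ge0 // ltW.
have h3 : zh * a <= 1 / 6 * a by rewrite ler_wpM2r.
lra.
Qed.

Lemma capped_cg_size ty v J : capped_cg H g eps zeta 0 ty v J -> (J <= n)%N.
Proof.
rewrite /capped_cg; case: ifP => [_ [-> //]|/negbT p0 [_ na _ _]].
exact/cg_regular_size/cg_regular_not_applicable.
Qed.

End CappedCGGuarantees.

(** * The uniform law on the sphere *)


Lemma continuous_sum (R : realType) (T : topologicalType) (I : Type) (s : seq I)
    (f : I -> T -> R) :
  (forall i, continuous (f i)) -> continuous (fun x => \sum_(i <- s) f i x).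
Proof.
move=> cf; elim: s => [|i s IH].
  rewrite (_ : (fun _ => _) = fun=> 0); first exact: cst_continuous.
  by apply/funext => v; rewrite big_nil.
rewrite (_ : (fun _ => _) = fun x => f i x + \sum_(j <- s) f j x); last first.
  by apply/funext => v; rewrite big_cons.
by move=> v; apply: (@continuousD _ _ _ (f i)); [exact: cf|exact: IH].
Qed.

Section DotContinuity.
Variables (R : realType) (n : nat).

Lemma continuous_dot (u : 'cV[R]_n) : continuous (dot u).
Proof.
rewrite (_ : dot u = fun v : 'cV[R]_n => \sum_i u i 0 * v i 0); last first.
  by apply/funext => v; rewrite dot_sum.
apply: continuous_sum => i v.
by apply: continuousM; [exact: cst_continuous|exact: coord_continuous].
Qed.

End DotContinuity.

Definition householder (R : realType) n (u : 'cV[R]_n) : 'M[R]_n :=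
  1%:M - 2 *: (u *m u^T).

Section Householder.
Variables (R : realType) (n : nat).
Implicit Types u v z : 'cV[R]_n.

Lemma householder_mulmx u v : householder u *m v = v - (2 * dot u v) *: u.
Proof.
rewrite /householder mulmxBl mul1mx -scalemxAl -mulmxA [u^T *m v]mx11_scalar.
by rewrite mul_mx_scalar scalerA.
Qed.

Lemma householder_orthogonal u : dot u u = 1 ->
  (householder u)^T *m householder u = 1%:M.
Proof.
move=> u1; have sy : (householder u)^T = householder u.
  by rewrite /householder linearB /= trmx1 linearZ /= trmx_mul trmxK.
rewrite sy {1}/householder mulmxBl mul1mx -scalemxAl -mulmxA.
have -> : u^T *m householder u = - u^T.
  apply: trmx_inj; rewrite trmx_mul sy trmxK householder_mulmx u1 linearN /=.
  by rewrite trmxK mulr1 scaler_nat mulr2n opprD addrA subrr add0r.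
by rewrite /householder mulmxN scalerN opprK subrK.
Qed.

Lemma dot_householder u v z :
  dot z (householder u *m v) = dot z v - 2 * dot u v * dot z u.
Proof. by rewrite householder_mulmx !dotE. Qed.

End Householder.

Section BoundedExpectation.
Context (R : realType) (d : measure_display) (W : measurableType d).
Variable P : probability W R.
Implicit Types X Y : W -> R.

Definition bounded_rv X :=
  measurable_fun setT X /\ exists M : R, forall w, `|X w| <= M.

Definition mean X : R := \int[P]_w X w.

Lemma bounded_rv_integrable X : bounded_rv X -> P.-integrable setT (EFin \o X).
Proof.
move=> [mX [M XM]]; apply: measurable_bounded_integrable => //.
  by rewrite (le_lt_trans (probability_le1 _ _)) // ltry.
exists M; split; rewrite ?num_real // => x Mx w _; exact: le_trans (ltW Mx).
Qed.

Lemma bounded_rv_cst (c : R) : bounded_rv (fun=> c).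
Proof. by split; [exact: measurable_cst|exists `|c|]. Qed.

Lemma bounded_rvD X Y : bounded_rv X -> bounded_rv Y ->
  bounded_rv (fun w => X w + Y w).
Proof.
move=> [mX [M XM]] [mY [N YN]]; split; first exact: measurable_funD.
by exists (M + N) => w; apply: le_trans (ler_normD _ _) _; rewrite lerD.
Qed.

Lemma bounded_rvM X Y : bounded_rv X -> bounded_rv Y ->
  bounded_rv (fun w => X w * Y w).
Proof.
move=> [mX [M XM]] [mY [N YN]]; split; first exact: measurable_funM.
by exists (M * N) => w; rewrite normrM ler_pM.
Qed.

Lemma bounded_rvZ (c : R) X : bounded_rv X -> bounded_rv (fun w => c * X w).
Proof. by apply: bounded_rvM; exact: bounded_rv_cst. Qed.

Lemma bounded_rv_norm X : bounded_rv X -> bounded_rv (fun w => `|X w|).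
Proof.
move=> [mX [M XM]]; split; first exact: measurableT_comp.
by exists M => w; rewrite normr_id.
Qed.

Lemma bounded_rv_indic (A : set W) : measurable A -> bounded_rv \1_A.
Proof.
move=> mA; split; first exact: measurable_indic.
by exists 1 => w; rewrite indicE; case: (_ \in _); rewrite ?normr0 ?normr1.
Qed.

Lemma bounded_rv_sum (I : Type) (s : seq I) (X : I -> W -> R) :
  (forall i, bounded_rv (X i)) -> bounded_rv (fun w => \sum_(i <- s) X i w).
Proof.
move=> bX; elim: s => [|i s IH].
  by under eq_fun do rewrite big_nil; exact: bounded_rv_cst.
by under eq_fun do rewrite big_cons; exact: bounded_rvD.
Qed.

Lemma mean_cst (c : R) : mean (fun=> c) = c.
Proof. by rewrite /mean Rintegral_cst //= probability_setT mulr1. Qed.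

Lemma meanD X Y : bounded_rv X -> bounded_rv Y ->
  mean (fun w => X w + Y w) = mean X + mean Y.
Proof. by move=> bX bY; apply: RintegralD => //; exact: bounded_rv_integrable. Qed.

Lemma meanZ (c : R) X : bounded_rv X -> mean (fun w => c * X w) = c * mean X.
Proof. by move=> bX; apply: RintegralZl => //; exact: bounded_rv_integrable. Qed.

Lemma le_mean X Y : bounded_rv X -> bounded_rv Y ->
  (forall w, X w <= Y w) -> mean X <= mean Y.
Proof.
by move=> bX bY XY; apply: le_Rintegral => //; exact: bounded_rv_integrable.
Qed.

Lemma mean_sum (I : Type) (s : seq I) (X : I -> W -> R) :
  (forall i, bounded_rv (X i)) ->
  mean (fun w => \sum_(i <- s) X i w) = \sum_(i <- s) mean (X i).
Proof.
move=> bX; elim: s => [|i s IH].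
  by under [X in mean X]eq_fun do rewrite big_nil; rewrite mean_cst big_nil.
under [X in mean X]eq_fun do rewrite big_cons.
by rewrite meanD ?IH ?big_cons //; exact: bounded_rv_sum.
Qed.

Lemma mean_indic (A : set W) : measurable A -> mean \1_A = fine (P A).
Proof. by move=> mA; rewrite /mean /Rintegral integral_indic // setIT. Qed.

Lemma mean_eq_law X Y : bounded_rv X -> bounded_rv Y ->
  (forall B, measurable B -> P (X @^-1` B) = P (Y @^-1` B)) ->
  mean X = mean Y.
Proof.
move=> bX bY XY.
have eqm : forall Z : W -> R, bounded_rv Z ->
    (\int[P]_w (Z w)%:E = \int[pushforward P Z]_y y%:E)%E.
  move=> Z bZ; have [mZ _] := bZ; apply/esym.
  by apply: (integral_pushforward mZ _ (bounded_rv_integrable bZ)).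
rewrite /mean /Rintegral; congr fine; rewrite (eqm _ bX) (eqm _ bY).
by apply: eq_measure_integral; rewrite ?setTI; try exact: (proj1 bX);
  try exact: (proj1 bY); move=> mX mY B mB _; exact: XY.
Qed.

End BoundedExpectation.

Section UniformSphere.
Context (R : realType) (d : measure_display) (W : measurableType d).
Variable P : probability W R.
Variables (n : nat) (b : W -> 'cV[R]_n).
Hypothesis unif : uniform_on_sphere P b.

Let b1 w : enorm (b w) = 1. Proof. by case: unif. Qed.

Lemma continuous_preimage_borel (phi : 'cV[R]_n -> R) (B : set R) :
  continuous phi -> measurable B -> <<s [set O | open O] >> (phi @^-1` B).
Proof.
move=> cphi mB.
pose V := g_sigma_algebraType [set O : set 'cV[R]_n | open O].
have mphi : measurable_fun setT (phi : V -> R).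
  apply: (measurability _ (RGenOpens.measurableE R)).
  move=> _ [_ [x [y ->] <-]]; rewrite setTI; apply: sub_sigma_algebra.
  by move/continuousP: cphi; apply; exact: interval_open.
by have := mphi measurableT B mB; rewrite setTI.
Qed.

Lemma measurable_comp_sphere (phi : 'cV[R]_n -> R) :
  continuous phi -> measurable_fun setT (phi \o b).
Proof.
move=> cphi _ B mB; rewrite setTI comp_preimage.
by case: unif => + _ _; apply; exact: continuous_preimage_borel.
Qed.

Lemma bounded_rv_dot (z : 'cV[R]_n) : bounded_rv (fun w => dot z (b w)).
Proof.
split; first exact: (measurable_comp_sphere (@continuous_dot _ _ z)).
by exists (enorm z) => w; have := normr_dot_le z (b w); rewrite b1 mulr1.
Qed.

Lemma mean_householder (phi : 'cV[R]_n -> R) (u : 'cV[R]_n) :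
  continuous phi -> bounded_rv (fun w => phi (b w)) ->
  bounded_rv (fun w => phi (householder u *m b w)) -> dot u u = 1 ->
  mean P (fun w => phi (householder u *m b w)) = mean P (fun w => phi (b w)).
Proof.
move=> cphi b1' b2' u1; apply: mean_eq_law => // B mB.
case: unif => _ _ /(_ (householder u) (householder_orthogonal u1)).
by move=> /(_ (phi @^-1` B)); apply; exact: continuous_preimage_borel.
Qed.

Definition clip (t x : R) : R := (`|x + t| - `|x - t|) / 2.

Lemma normr_clip_le (t x : R) : 0 <= t -> `|clip t x| <= t.
Proof.
rewrite /clip; case: (ler0P (x + t)); case: (ler0P (x - t)) => ? ? ?;
  by rewrite ler_norml; lra.
Qed.

Lemma clip_small (t x : R) : `|x| <= t -> clip t x = x.
Proof.
by rewrite ler_norml /clip => /andP[? ?]; rewrite ger0_norm ?ler0_norm; lra.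
Qed.

Lemma clip_homo (t : R) : 0 <= t -> {homo clip t : x y / x <= y}.
Proof.
rewrite /clip => t0 x y xy; case: (ler0P (x + t)); case: (ler0P (x - t));
  case: (ler0P (y + t)); case: (ler0P (y - t)) => *; lra.
Qed.

Lemma continuous_clip_dot (t : R) (z : 'cV[R]_n) :
  continuous (fun v => clip t (dot z v)).
Proof.
have cc (s : R) : continuous (fun v : 'cV[R]_n => `|dot z v + s|).
  move=> v; apply: (@continuous_comp _ _ _ (fun v => dot z v + s) (fun x : R => `|x|)).
    apply: (@continuousD _ _ _ (dot z)); first exact: continuous_dot.
    exact: cst_continuous.
  exact: norm_continuous.
move=> v; apply: (@continuousM _ _ (fun v => `|dot z v + t| - `|dot z v - t|)).
  by apply: (@continuousB _ _ _ (fun v => `|dot z v + t|)); exact: cc.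
exact: cst_continuous.
Qed.

Lemma bounded_rv_clip (t : R) (z : 'cV[R]_n) : 0 <= t ->
  bounded_rv (fun w => clip t (dot z (b w))).
Proof.
move=> t0; split.
  exact: (measurable_comp_sphere (@continuous_clip_dot t z)).
by exists t => w; exact: normr_clip_le.
Qed.

End UniformSphere.

Section SlabProbability.
Context (R : realType) (d : measure_display) (W : measurableType d).
Variable P : probability W R.
Variables (n : nat) (b : W -> 'cV[R]_n).
Hypothesis unif : uniform_on_sphere P b.

Let b1 w : enorm (b w) = 1. Proof. by case: unif. Qed.

Lemma measurable_slab (z : 'cV[R]_n) (t : R) :
  measurable [set w | `|dot z (b w)| < t].
Proof.
have [mX _] := bounded_rv_norm (bounded_rv_dot unif z).
have := mX measurableT `]-oo, t[%classic (measurable_itv _).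
by rewrite setTI; congr measurable; apply/seteqP; split=> w /=; rewrite in_itv.
Qed.

Lemma mean_clip_dot_eq0 (z w : 'cV[R]_n) (t : R) : 0 <= t ->
  dot w w = 1 -> dot z w = 0 ->
  mean P (fun x => clip t (dot z (b x)) * dot w (b x)) = 0.
Proof.
move=> t0 w1 zw.
have bX := bounded_rvM (bounded_rv_clip unif z t0) (bounded_rv_dot unif w).
pose phi v := clip t (dot z v) * dot w v.
have phiN v : phi (householder w *m v) = -1 * phi v.
  rewrite /phi !dot_householder zw w1 mulr0 subr0; ring.
have := @mean_householder _ _ _ P n b unif phi w _ bX _ w1.
have -> : (fun x => phi (householder w *m b x)) = (fun x => -1 * phi (b x)).
  by apply/funext => x; exact: phiN.
rewrite meanZ // => h; have : -1 * mean P (phi \o b) = mean P (phi \o b).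
  apply: h; last exact: bounded_rvZ.
  move=> v; apply: (@continuousM _ _ (fun v => clip t (dot z v)) (dot w)).
    exact: continuous_clip_dot.
  exact: continuous_dot.
rewrite -[mean P _]/(mean P (phi \o b)); lra.
Qed.

(* The clipped coordinate, multiplied by an orthogonal coordinate, has mean zero;
   rotating both coordinates by a small angle and comparing gives an inequality
   that becomes [slab_second_moment] in the limit. *)
Lemma slab_second_moment_rotation (z w : 'cV[R]_n) (t be : R) : 0 < t ->
  dot z z = 1 -> dot w w = 1 -> dot z w = 0 -> 0 < be < 1 / 2 ->
  (1 - 2 * be ^+ 2) *
    mean P (fun x => dot w (b x) ^+ 2 * \1_[set x | `|dot z (b x)| < t] x)
  <= (t + 2 * be) * mean P (fun x => `|dot z (b x)|).
Proof.
move=> t0 z1 w1 zw /andP[be0 be1]; have wz : dot w z = 0 by rewrite dotC.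
pose al := Num.sqrt (1 - be ^+ 2).
have al2 : al ^+ 2 = 1 - be ^+ 2 by rewrite sqr_sqrtr //; nra.
have al0 : 0 < al by rewrite sqrtr_gt0; nra.
have al1 : al <= 1 by rewrite -sqrtr1 ler_wsqrtr //; nra.
pose s := 2 * al * be; pose c := 1 - 2 * be ^+ 2; pose ta := t + 2 * be.
have s0 : 0 < s by rewrite /s !mulr_gt0.
have c0 : 0 <= c <= 1 by rewrite /c; nra.
have sb : s <= 2 * be by rewrite /s; nra.
have ta0 : 0 <= ta by rewrite /ta; lra.
pose u := (- be) *: z + al *: w.
have u1 : dot u u = 1 by rewrite /u !dotE z1 w1 zw wz; nra.
pose phi v := clip ta (dot z v) * dot w v.
pose psi v := clip ta (dot (c *: z) v) * dot w v.
pose X x := dot z (b x); pose Y x := dot w (b x).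
have bX : bounded_rv X := bounded_rv_dot unif z.
have bY : bounded_rv Y := bounded_rv_dot unif w.
have mS := measurable_slab z t.
have b2 : bounded_rv (fun x => Y x ^+ 2 * \1_[set x | `|X x| < t] x).
  under eq_fun do rewrite expr2.
  by apply: bounded_rvM; [exact: bounded_rvM|exact: bounded_rv_indic].
have XQ x : dot z (householder u *m b x) = dot (c *: z + s *: w) (b x).
  by rewrite dot_householder /u /c /s !dotE z1 zw; ring.
have YQ x : dot w (householder u *m b x) = dot (s *: z - c *: w) (b x).
  rewrite dot_householder /u /c /s !dotE wz w1.
  have : al ^+ 2 * dot w (b x) = (1 - be ^+ 2) * dot w (b x) by rewrite al2.
  by lra.
have bphiQ : bounded_rv (fun x => phi (householder u *m b x)).
  under eq_fun do rewrite /phi XQ YQ.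
  exact: bounded_rvM (bounded_rv_clip unif _ ta0) (bounded_rv_dot unif _).
have bphi : bounded_rv (fun x => phi (b x)).
  exact: bounded_rvM (bounded_rv_clip unif _ ta0) (bounded_rv_dot unif _).
have bpsi : bounded_rv (fun x => psi (b x)).
  exact: bounded_rvM (bounded_rv_clip unif _ ta0) (bounded_rv_dot unif _).
have e1 : mean P (fun x => phi (householder u *m b x)) = 0.
  rewrite mean_householder // ?mean_clip_dot_eq0 //.
  move=> v; apply: (@continuousM _ _ (fun v => clip ta (dot z v)) (dot w)).
    exact: continuous_clip_dot.
  exact: continuous_dot.
have e2 : mean P (fun x => psi (b x)) = 0.
  by apply: mean_clip_dot_eq0 => //; rewrite dotZl zw mulr0.
have : mean P (fun x => phi (householder u *m b x) + c * psi (b x)) <=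
    mean P (fun x => s * ta * `|X x| +
       (- (c * s)) * (Y x ^+ 2 * \1_[set x | `|X x| < t] x)).
  apply: le_mean => [||x].
  - by apply: bounded_rvD => //; exact: bounded_rvZ.
  - by apply: bounded_rvD; apply: bounded_rvZ => //; exact: bounded_rv_norm.
  rewrite /phi /psi XQ YQ !dotE -/(X x) -/(Y x).
  have Y1 : `|Y x| <= 1.
    have := normr_dot_le w (b x); rewrite b1 mulr1.
    by have := sqr_enorm w; rewrite w1 => /eqP; rewrite sqrp_eq1 ?enorm_ge0 // => /eqP->.
  have h1 : clip ta (c * X x + s * Y x) * X x <= ta * `|X x|.
    apply: le_trans (ler_norm _) _; rewrite normrM ler_wpM2r //.
    exact: normr_clip_le.
  suff h2 : s * (Y x ^+ 2 * \1_[set x | `|X x| < t] x) <=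
      (clip ta (c * X x + s * Y x) - clip ta (c * X x)) * Y x.
    by case/andP: c0 => c0 _; nra.
  rewrite indicE; have [Xt|Xt] := ltP `|X x| t.
    have cX : `|c * X x| <= t.
      rewrite normrM ger0_norm; last by case/andP: c0.
      by case/andP: c0 => c0 c1; have := normr_ge0 (X x); nra.
    have sY : `|s * Y x| <= 2 * be.
      rewrite normrM gtr0_norm //.
      by have := normr_ge0 (Y x); nra.
    rewrite mem_set //= mulr1 !clip_small; last 2 first.
    - by apply: le_trans cX _; rewrite /ta; lra.
    - by apply: le_trans (ler_normD _ _) _; rewrite /ta lerD.
    by rewrite [c * X x + _]addrC addrK expr2 mulrA.
  rewrite memNset /=; last by apply/negP; rewrite -leNgt.
  rewrite !mulr0; have [Y0|Y0] := leP 0 (Y x).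
    by rewrite mulr_ge0 // subr_ge0 clip_homo // lerDl mulr_ge0 // ltW.
  rewrite nmulr_lge0 // subr_le0 clip_homo // gerDl.
  by rewrite pmulr_rle0 // ltW.
have bnX := bounded_rv_norm bX.
rewrite (meanD P bphiQ (bounded_rvZ c bpsi)) (meanZ P c bpsi).
rewrite (meanD P (bounded_rvZ (s * ta) bnX) (bounded_rvZ (- (c * s)) b2)).
rewrite (meanZ P _ bnX) (meanZ P _ b2).
rewrite e1 e2 mulr0 addr0 -mulrA mulNr subr_ge0 mulrAC mulrC ler_pM2l //.
Qed.

Lemma slab_second_moment (z w : 'cV[R]_n) (t : R) : 0 < t ->
  dot z z = 1 -> dot w w = 1 -> dot z w = 0 ->
  mean P (fun x => dot w (b x) ^+ 2 * \1_[set x | `|dot z (b x)| < t] x)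
  <= t * mean P (fun x => `|dot z (b x)|).
Proof.
move=> t0 z1 w1 zw.
have key := slab_second_moment_rotation t0 z1 w1 zw.
have e1 (v : 'cV[R]_n) x : dot v v = 1 -> `|dot v (b x)| <= 1.
  move=> v1; have := normr_dot_le v (b x); rewrite b1 mulr1.
  by have := sqr_enorm v; rewrite v1 => /eqP; rewrite sqrp_eq1 ?enorm_ge0 // => /eqP->.
have bX := bounded_rv_norm (bounded_rv_dot unif z).
have m1 : mean P (fun x => `|dot z (b x)|) <= 1.
  rewrite -(mean_cst P 1); apply: le_mean => //; first exact: bounded_rv_cst.
  by move=> x; exact: e1.
have m2 : mean P (fun x => dot w (b x) ^+ 2 *
    \1_[set x | `|dot z (b x)| < t] x) <= 1.
  rewrite -(mean_cst P 1); apply: le_mean => [||x]; first last.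
  - have := e1 w x w1; rewrite indicE; case: (_ \in _) => /= h; last first.
      by rewrite mulr0.
    by rewrite mulr1 -real_normK ?num_real // expr_le1.
  - exact: bounded_rv_cst.
  have bY := bounded_rv_dot unif w.
  under eq_fun do rewrite expr2.
  apply: bounded_rvM; first exact: bounded_rvM.
  exact/bounded_rv_indic/measurable_slab.
move: (mean _ _) (mean _ _) m1 m2 key => M2 M1 h1 h2 key.
rewrite leNgt; apply/negP => lt.
pose be := Num.min (1 / 4) ((M2 - t * M1) / 6).
have be0 : 0 < be by rewrite lt_min; apply/andP; split; lra.
have be4 : be <= 1 / 4 by rewrite ge_min lexx.
have be6 : be <= (M2 - t * M1) / 6 by rewrite ge_min lexx orbT.
have := key be; rewrite be0 => /(_ ltac:(lra)).
nra.
Qed.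

Lemma householder_swap (z z' : 'cV[R]_n) :
  dot z z = 1 -> dot z' z' = 1 -> z != z' ->
  exists u, dot u u = 1 /\ forall v, dot z' (householder u *m v) = dot z v.
Proof.
move=> z1 z'1 zz'; have d0 : z - z' != 0 by rewrite subr_eq0.
have N0 : enorm (z - z') != 0 by rewrite enorm_eq0.
have NN : dot (z - z') (z - z') = enorm (z - z') ^+ 2 by rewrite sqr_enorm.
have N2 : enorm (z - z') ^+ 2 = 2 - 2 * dot z z'.
  by rewrite sqr_enorm !dotE z1 z'1 (dotC z' z); ring.
move: (enorm _) N0 NN N2 => N N0 NN N2.
have e : dot z' (N^-1 *: (z - z')) = - N / 2.
  have -> : - N / 2 = - N ^+ 2 / 2 / N by field.
  by rewrite N2 !dotE z'1 (dotC z' z); field.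
exists (N^-1 *: (z - z')); split; first by rewrite dotZl dotZr NN; field.
by move=> v; rewrite dot_householder e !dotE; field.
Qed.

Lemma mean_sqr_dot (z z' : 'cV[R]_n) : dot z z = 1 -> dot z' z' = 1 ->
  mean P (fun x => dot z (b x) ^+ 2) = mean P (fun x => dot z' (b x) ^+ 2).
Proof.
move=> z1 z'1; have [->//|zz'] := eqVneq z z'.
have [u [u1 hu]] := householder_swap z1 z'1 zz'.
have bz (v : 'cV[R]_n) : bounded_rv (fun x => dot v (b x) ^+ 2).
  by under eq_fun do rewrite expr2; apply: bounded_rvM; exact: (bounded_rv_dot unif).
have bQ : bounded_rv (fun x => dot z' (householder u *m b x) ^+ 2).
  by under eq_fun do rewrite hu; exact: bz.
rewrite -(@mean_householder _ _ _ P n b unif (fun v => dot z' v ^+ 2) u) //.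
  by congr mean; apply/funext => x; rewrite hu.
move=> v; under eq_fun do rewrite expr2.
by apply: (@continuousM _ _ (dot z') (dot z')); exact: continuous_dot.
Qed.

Lemma dot_delta_delta i j :
  dot (delta_mx i 0 : 'cV[R]_n) (delta_mx j 0) = (i == j)%:R.
Proof. by rewrite dot_delta mxE eqxx andbT. Qed.

Lemma sum_sqr_coord x : \sum_i dot (delta_mx i 0) (b x) ^+ 2 = 1.
Proof.
have <- : dot (b x) (b x) = 1 by rewrite -sqr_enorm b1 expr1n.
by rewrite dot_sum; apply: eq_bigr => i _; rewrite dot_delta expr2.
Qed.

Lemma mean_normr_coord_le i : 
  mean P (fun x => `|dot (delta_mx i 0) (b x)|) <= (Num.sqrt n%:R)^-1.
Proof.
have n0 : (0 < n)%N by case: (n) i => [[]|].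
have rn0 : 0 < (n%:R : R) by rewrite ltr0n.
set S := Num.sqrt n%:R; have S0 : 0 < S by rewrite sqrtr_gt0.
have S2 : S ^+ 2 = n%:R by rewrite sqr_sqrtr // ltW.
have bz (v : 'cV[R]_n) : bounded_rv (fun x => dot v (b x) ^+ 2).
  by under eq_fun do rewrite expr2; apply: bounded_rvM; exact: (bounded_rv_dot unif).
have m2 : n%:R * mean P (fun x => dot (delta_mx i 0) (b x) ^+ 2) = 1.
  rewrite -[RHS](mean_cst P 1).
  have -> : (fun=> 1) = fun x => \sum_j dot (delta_mx j 0) (b x) ^+ 2.
    by apply/funext => x; rewrite sum_sqr_coord.
  rewrite mean_sum // (eq_bigr (fun=> mean P (fun x => dot (delta_mx i 0) (b x) ^+ 2))).
    by rewrite sumr_const card_ord mulr_natl.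
  by move=> j _; apply: mean_sqr_dot; rewrite dot_delta_delta eqxx.
have bX := bounded_rv_dot unif (delta_mx i 0).
apply: (@le_trans _ _ (mean P (fun x => S / 2 * dot (delta_mx i 0) (b x) ^+ 2 +
   S^-1 / 2))).
  apply: le_mean => [||x]; first exact: bounded_rv_norm.
    by apply: bounded_rvD; [exact: bounded_rvZ|exact: bounded_rv_cst].
  set c := dot _ _; rewrite -[c ^+ 2]real_normK ?num_real //.
  rewrite -subr_ge0 [leRHS](_ : _ = (S * `|c| - 1) ^+ 2 / (2 * S)).
    by rewrite divr_ge0 ?sqr_ge0 // mulr_ge0 // ltW.
  by field; rewrite gt_eqF.
rewrite (meanD P (bounded_rvZ (S / 2) (bz _)) (bounded_rv_cst W (S^-1 / 2))).
rewrite (meanZ P _ (bz _)) mean_cst.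
move: m2; set m := mean _ _ => m2.
rewrite le_eqVlt; apply/orP; left; apply/eqP.
have nn0 : n%:R != 0 :> R by rewrite gt_eqF.
have -> : m = (S ^+ 2)^-1 by rewrite S2; apply: (mulfI nn0); rewrite m2 divff.
by field; rewrite gt_eqF.
Qed.

Lemma slab_probability_coord i (t : R) : 0 < t -> 
  fine (P [set x | `|dot (delta_mx i 0) (b x)| < t]) <= Num.sqrt n%:R * t.
Proof.
move=> t0; have n0 : (0 < n)%N by case: (n) i => [[]|].
have rn1 : 1 <= (n%:R : R) by rewrite ler1n.
have mA := measurable_slab (delta_mx i 0) t.
set A := [set x | _] in mA *; rewrite -(mean_indic P mA).
set S := Num.sqrt n%:R; have S1 : 1 <= S by rewrite -[leLHS]sqrtr1 ler_wsqrtr.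
have S0 : 0 < S by exact: lt_le_trans S1.
have S2 : S ^+ 2 = n%:R by rewrite sqr_sqrtr.
have bA := bounded_rv_indic R mA.
have p1 : mean P \1_A <= 1.
  rewrite -(mean_cst P 1); apply: le_mean => //; first exact: bounded_rv_cst.
have [tS|tS] := leP 1 (S * t); first exact: le_trans p1 tS.
have bz j : bounded_rv (fun x => dot (delta_mx j 0) (b x) ^+ 2 * \1_A x).
  under eq_fun do rewrite expr2.
  by apply: bounded_rvM => //; apply: bounded_rvM; exact: (bounded_rv_dot unif).
have est : (1 - t ^+ 2) * mean P \1_A <= (n%:R - 1) * (t * S^-1).
  rewrite -meanZ //.
  apply: (@le_trans _ _ (mean P (fun x => \sum_(j <- enum (predC1 i))
     dot (delta_mx j 0) (b x) ^+ 2 * \1_A x))).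
    apply: le_mean => [||x]; [exact: bounded_rvZ|exact: bounded_rv_sum|].
    rewrite -mulr_suml indicE; have [xA|xA] := boolP (x \in A); last first.
      by rewrite !mulr0.
    rewrite !mulr1 big_enum /=.
    have -> : \sum_(j in predC1 i) dot (delta_mx j 0) (b x) ^+ 2 =
        1 - dot (delta_mx i 0) (b x) ^+ 2.
      by rewrite -(sum_sqr_coord x) [in RHS](bigD1 i) //= addrC addrK.
    have {xA} : `|dot (delta_mx i 0) (b x)| < t by move: xA; rewrite inE.
    move=> /ltW h; rewrite lerD2l lerN2 -[leLHS]real_normK ?num_real //.
    by rewrite lerXn2r ?nnegrE // ltW.
  rewrite mean_sum //; apply: (@le_trans _ _
     (\sum_(j <- enum (predC1 i)) t * S^-1)).
    rewrite !big_enum /=; apply: ler_sum => j ji.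
    apply: le_trans (slab_second_moment _ _ _ _) _ => //.
    - by rewrite dot_delta_delta eqxx.
    - by rewrite dot_delta_delta eqxx.
    - by rewrite dot_delta_delta eq_sym (negbTE ji).
    by rewrite ler_wpM2l ?mean_normr_coord_le // ltW.
  rewrite big_enum /= sumr_const cardC1 card_ord -[leLHS]mulr_natl.
  by have -> : n.-1%:R = n%:R - 1 :> R by rewrite -subn1 natrB.
have t1 : t < 1 by nra.
have tn : n%:R * t ^+ 2 < 1 by rewrite -S2 -exprMn expr_lt1 // mulr_ge0 // ltW.
have d0 : 0 < 1 - t ^+ 2 by rewrite subr_gt0 expr_lt1 // ltW.
rewrite -(ler_pM2l d0); apply: le_trans est _.
rewrite [leRHS](_ : _ = (1 - t ^+ 2) * n%:R * (t * S^-1)); last first.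
  by rewrite -S2; field; rewrite gt_eqF.
rewrite ler_wpM2r ?mulr_ge0 ?invr_ge0 ?ltW //.
by rewrite mulrBl mul1r ler_ltB // mulrC.
Qed.

Theorem slab_probability (z : 'cV[R]_n) (t : R) : 0 < t -> dot z z = 1 ->
  (P [set x | (`|dot z (b x)| < t)%R] <= (Num.sqrt n%:R * t)%:E)%E.
Proof.
move=> t0 z1; have n0 : (0 < n)%N.
  case: (n) z z1 => // z; rewrite dot_sum big_ord0 => /eqP.
  by rewrite eq_sym oner_eq0.
pose e : 'cV[R]_n := delta_mx (Ordinal n0) 0.
have e1 : dot e e = 1 by rewrite dot_delta_delta eqxx.
have mA := measurable_slab z t.
rewrite -[P _]fineK ?fin_num_measure // lee_fin.
have [->|ze] := eqVneq z e; first exact: slab_probability_coord.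
have [u [u1 hu]] := householder_swap z1 e1 ze.
apply: le_trans (slab_probability_coord (Ordinal n0) t0).
have -> : [set x | `|dot z (b x)| < t] =
    [set x | [set v | `|dot e v| < t] (householder u *m b x)].
  by apply/seteqP; split=> x /=; rewrite hu.
case: unif => _ _ /(_ (householder u) (householder_orthogonal u1)) -> //.
have -> : [set v | `|dot e v| < t] = dot e @^-1` [set y | `|y| < t] by [].
apply: continuous_preimage_borel; first exact: continuous_dot.
have -> : [set y : R | `|y| < t] = `]- t, t[%classic.
  by apply/seteqP; split=> y /=; rewrite in_itv /= ltr_norml.
exact: measurable_itv.
Qed.

End SlabProbability.

(** * The Lanczos oracle *)

Lemma le_is_derive (R : realType) (f g f' g' : R -> R) (a : R) : 0 <= a ->
  (forall s, 0 <= s <= a -> is_derive s 1 f (f' s)) ->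
  (forall s, 0 <= s <= a -> is_derive s 1 g (g' s)) ->
  (forall s, 0 <= s <= a -> f' s <= g' s) -> f 0 <= g 0 -> f a <= g a.
Proof.
move=> a0 df dg fg fg0.
have dh s : 0 <= s <= a -> is_derive s 1 (g - f) (g' s - f' s).
  by move=> sa; have := df s sa; have := dg s sa => ? ?; exact: is_deriveB.
have [||c ca e] := @MVT_segment R (g - f) (fun s => g' s - f' s) 0 a a0.
- by move=> s; rewrite in_itv /= => /andP[/ltW s0 /ltW sa]; apply: dh; rewrite s0.
- apply: derivable_within_continuous => s; rewrite in_itv /= => sa.
  by have [] := dh s sa.
have {}ca : 0 <= c <= a by move: ca; rewrite in_itv.
have : 0 <= (g' c - f' c) * (a - 0) by rewrite subr0 mulr_ge0 // subr_ge0 fg.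
rewrite -e !fctE; lra.
Qed.

Lemma expR_tanh_le (R : realType) (u : R) : 0 <= u ->
  (1 - u) * expR u <= (1 + u) * expR (- u).
Proof.
move=> u0.
apply: (@le_is_derive R (fun u => (1 - u) * expR u) (fun u => (1 + u) * expR (- u))
  (fun u => - u * expR u) (fun u => - u * expR (- u))) => // [s|s|s|].
- move=> _; apply: is_derive_eq; rewrite /GRing.scale /=; ring.
- move=> _; apply: is_derive_eq; rewrite /GRing.scale /=; ring.
- by move=> /andP[s0 _]; rewrite !mulNr lerN2 ler_wpM2l // ler_expR; lra.
by rewrite !oppr0 !addr0.
Qed.

Lemma expR_le_asinh (R : realType) (s : R) : 0 < s ->
  expR (Num.sqrt (s / (1 + s))) <= Num.sqrt s + Num.sqrt (1 + s).
Proof.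
move=> s0; have s1 : 0 < 1 + s by lra.
set S := Num.sqrt s; set C := Num.sqrt (1 + s).
have S0 : 0 < S by rewrite sqrtr_gt0.
have C0 : 0 < C by rewrite sqrtr_gt0.
have S2 : S ^+ 2 = s by rewrite sqr_sqrtr // ltW.
have C2 : C ^+ 2 = 1 + s by rewrite sqr_sqrtr // ltW.
have -> : Num.sqrt (s / (1 + s)) = S / C.
  by rewrite sqrtrM ?ltW // sqrtrV // ltW.
have u0 : 0 <= S / C by rewrite divr_ge0 // ltW.
have := expR_tanh_le u0; set u := S / C in u0 *.
rewrite expRN => h; have e0 := expR_gt0 u; set E := expR u in e0 h *.
have {h} : (1 - u) * E ^+ 2 <= 1 + u.
  by rewrite expr2 mulrA -ler_pdivlMr.
have CS : 0 < C - S by nra.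
have -> : u = S / C by [].
have -> : 1 - S / C = (C - S) / C by field; rewrite gt_eqF.
have -> : 1 + S / C = (C + S) / C by field; rewrite gt_eqF.
rewrite mulrAC ler_pM2r ?invr_gt0 // => h.
rewrite -(ler_pXn2r (n:=2)) ?nnegrE ?addr_ge0 ?(ltW e0) ?(ltW S0) ?(ltW C0) //.
rewrite -(ler_pM2l CS); apply: le_trans h _.
rewrite le_eqVlt; apply/orP; left; apply/eqP.
rewrite -[LHS]mul1r (_ : 1 = C ^+ 2 - S ^+ 2); first by ring.
by rewrite S2 C2; ring.
Qed.

Section MinimalEigenvalue.
Variables (R : realType) (k : nat) (T : 'M[R]_k).
Hypotheses (k0 : (0 < k)%N) (symT : T^T = T).

Lemma sphere_compact : compact [set x : 'rV[R]_k | dot x^T x^T = 1].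
Proof.
apply: bounded_closed_compact.
  exists 1; split; rewrite ?num_real // => M M1 x /= x1.
  have -> : `|x| = mx_norm x by [].
  apply: le_trans (ltW M1).
  rewrite mx_normrE; apply: bigmax_le => // [[i j] _] /=.
  have -> : x i j = x^T j 0 by rewrite mxE (ord1 i).
  apply: le_trans (normr_coord_le _ _) _.
  by rewrite /enorm x1 sqrtr1.
have -> : [set x : 'rV[R]_k | dot x^T x^T = 1] =
    (fun x : 'rV[R]_k => \sum_i x 0 i * x 0 i) @^-1` [set 1].
  have e (x : 'rV[R]_k) : dot x^T x^T = \sum_i x 0 i * x 0 i.
    by rewrite dot_sum; apply: eq_bigr => i _; rewrite !mxE.
  by apply/seteqP; split=> x /=; rewrite e.
apply: (@closed_comp _ _ (fun x : 'rV[R]_k => \sum_i x 0 i * x 0 i)).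
  move=> x _; apply: continuous_sum => i v.
  by apply: (@continuousM _ _ (fun x : 'rV[R]_k => x 0 i)); exact: coord_continuous.
exact: closed_eq.
Qed.

Lemma rayleigh_minimizer : exists s : 'cV[R]_k, dot s s = 1 /\
  forall v, dot s (T *m s) * dot v v <= dot v (T *m v).
Proof.
pose f (x : 'rV[R]_k) := dot x^T (T *m x^T).
have cf : continuous f.
  have -> : f = fun x => \sum_i \sum_j x 0 i * (T i j * x 0 j).
    apply/funext => x; rewrite /f dot_sum; apply: eq_bigr => i _.
    by rewrite !mxE mulr_sumr; apply: eq_bigr => j _; rewrite mxE.
  apply: continuous_sum => i; apply: continuous_sum => j v.
  apply: (@continuousM _ _ (fun x : 'rV[R]_k => x 0 i)); first exact: coord_continuous.
  apply: (@continuousM _ _ (fun=> T i j)); first exact: cst_continuous.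
  exact: coord_continuous.
have [|x x1 xmin] := @compact_EVT_min _ _ f _ _ sphere_compact
    (continuous_subspaceT cf).
  exists (delta_mx 0 (Ordinal k0)) => /=.
  by rewrite trmx_delta dot_delta mxE !eqxx.
exists x^T; split; first by move: x1; rewrite inE.
move=> v; have [->|v0] := eqVneq v 0; first by rewrite mulmx0 !dot0r mulr0.
have vv : 0 < dot v v by rewrite dot_gt0.
have v1 : enorm v != 0 by rewrite enorm_eq0.
have := xmin ((enorm v)^-1 *: v)^T.
rewrite inE /f /= trmxK !dotZl -scalemxAr !dotZr -sqr_enorm => /(_ ltac:(by field)).
move=> h; rewrite -ler_pdivlMr ?sqr_enorm //; apply: le_trans h _.
by rewrite -sqr_enorm le_eqVlt; apply/orP; left; apply/eqP; field.
Qed.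

Lemma psd_kernel (A : 'M[R]_k) (s : 'cV[R]_k) : A^T = A ->
  (forall v, 0 <= dot v (A *m v)) -> dot s (A *m s) = 0 -> A *m s = 0.
Proof.
move=> symA psd s0; apply/eqP; rewrite -dot_eq0; apply/negPn/negP => w0.
set w := A *m s in w0.
have a0 : 0 < dot w w by rewrite lt_def w0 dot_ge0.
have c0 := psd w.
have := psd (s - (dot w w / (dot w (A *m w) + 1)) *: w).
rewrite mulmxBr -scalemxAr !dotE (dot_sym s w symA) s0 -/w.
set a := dot w w in a0 *; set c := dot w (A *m w) in c0 *.
apply/negP; rewrite -ltNge.
have c1 : 0 < c + 1 by lra.
rewrite [ltLHS](_ : _ = - (a ^+ 2 * (c + 2) / (c + 1) ^+ 2)).
  by rewrite oppr_lt0 divr_gt0 ?mulr_gt0 ?exprn_gt0 //; lra.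
by field; rewrite gt_eqF.
Qed.

Lemma lambda_min_eigenvector : exists s : 'cV[R]_k,
  [/\ dot s s = 1, T *m s = lambda_min T *: s &
      forall v, lambda_min T * dot v v <= dot v (T *m v)].
Proof.
have [s [s1 smin]] := rayleigh_minimizer; set m := dot s (T *m s) in smin.
have Ts : T *m s = m *: s.
  have := @psd_kernel (T - m%:M) s.
  rewrite linearB /= tr_scalar_mx symT => /(_ erefl) h.
  apply/eqP; rewrite -subr_eq0 -mul_scalar_mx -mulmxBl; apply/eqP/h => [v|].
    by rewrite mulmxBl dotDr dotNr mul_scalar_mx dotZr subr_ge0.
  by rewrite mulmxBl dotDr dotNr mul_scalar_mx dotZr s1 mulr1 subrr.
have em : eigenvalue T m.
  apply/eigenvalueP; exists s^T.
    by rewrite -{1}symT -trmx_mul Ts linearZ.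
  apply: contra_eq_neq s1 => /(congr1 trmx); rewrite trmxK trmx0 => ->.
  by rewrite dot0r eq_sym oner_eq0.
have lb : lbound [set a : R | eigenvalue T a] m.
  move=> a /= /eigenvalueP[v va v0].
  have vT : T *m v^T = a *: v^T by rewrite -{1}symT -trmx_mul va linearZ.
  have := smin v^T; rewrite vT dotZr ler_pM2r // dot_gt0.
  by apply: contra_neq v0 => /(congr1 trmx); rewrite trmxK trmx0.
have <- : m = lambda_min T.
  apply/eqP; rewrite eq_le; apply/andP; split.
    by apply: lb_le_inf => //; exists m.
  by apply: ge_inf => //; exists m.
by exists s.
Qed.

End MinimalEigenvalue.

Section LanczosTheory.
Variables (R : realType) (n : nat) (H : 'M[R]_n) (b : 'cV[R]_n).
Hypotheses (symH : H^T = H) (b1 : dot b b = 1).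

Local Notation q := (lanczos_q H b).
Local Notation al := (lanczos_alpha H b).
Local Notation be := (lanczos_beta H b).
Local Notation Q k := (lanczos_basis H b k).

Lemma lanczos_recurrence k : H *m q k =
  al k *: q k + be k *: q k.+1 + (if k is i.+1 then be i *: q i else 0).
Proof.
have main (q' w : 'cV[R]_n) (be' : R) : lanczos_state H b k = (q', w, be') ->
    H *m q k = al k *: q k + be k *: q k.+1 + be' *: q'.
  rewrite /lanczos_alpha /lanczos_beta /lanczos_q /= => -> /=.
  set u := _ - _; have -> : enorm u *: ((enorm u)^-1 *: u) = u.
    have [->|u0] := eqVneq u 0; first by rewrite !scaler0.
    by rewrite scalerA divff ?scale1r // enorm_eq0.
  by rewrite /u -addrA subrK addrC subrK.
case: k main => [main|k main].
  by rewrite (main 0 b 0 erefl) scale0r.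
case e : (lanczos_state H b k.+1) => [[q' w] be'].
rewrite (main _ _ _ e); congr (_ + _).
move: e; rewrite /lanczos_beta /lanczos_q /=.
by case: (lanczos_state H b k) => [[? ?] ?] [<- _ <-].
Qed.

Lemma lanczos_qS k : q k.+1 = (be k)^-1 *: (be k *: q k.+1).
Proof.
have [e|b0] := eqVneq (be k) 0; last by rewrite scalerA mulVf ?scale1r.
move: e; rewrite /lanczos_beta /lanczos_q /=.
case: (lanczos_state H b k) => [[? ?] ?] /=; set u := _ - _.
move=> e; rewrite e; move/eqP: e; rewrite enorm_eq0 => /eqP->.
by rewrite !scaler0.
Qed.

Definition lanczos_regular k := forall i, (i.+1 < k)%N -> be i != 0.

Lemma lanczos_beta_sqr k : be k ^+ 2 = dot (be k *: q k.+1) (be k *: q k.+1).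
Proof.
rewrite -sqr_enorm /lanczos_beta /lanczos_q /=.
case: (lanczos_state H b k) => [[? ?] ?] /=; set u := _ - _.
have [->|u0] := eqVneq u 0; first by rewrite enorm0 !scaler0 enorm0.
by rewrite scalerA divff ?scale1r // enorm_eq0.
Qed.

Lemma lanczos_orthonormal k : lanczos_regular k -> forall i j,
  (i < k)%N -> (j < k)%N -> dot (q i) (q j) = (i == j)%:R.
Proof.
move=> reg.
suff main j : (j < k)%N ->
    dot (q j) (q j) = 1 /\ forall i, (i < j)%N -> dot (q j) (q i) = 0.
  move=> i j ik jk; have [ij|ji|->] := ltngtP i j.
  - by rewrite dotC; have [_ ->] := main j jk.
  - by have [_ ->] := main i ik.
  - by have [-> _] := main j jk.
elim/ltn_ind: j => [[|j] IH] jk; first by [].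
have bj := reg j jk.
have orth i : (i <= j)%N -> dot (be j *: q j.+1) (q i) = 0.
  move=> ij; have [jj jo] := IH j (ltnSn j) (ltnW jk).
  have -> : be j *: q j.+1 = H *m q j - al j *: q j -
      (if j is l.+1 then be l *: q l else 0).
    by rewrite lanczos_recurrence addrAC addrK addrC addKr.
  move: ij; rewrite leq_eqVlt => /orP[/eqP->|ij].
    rewrite !dotE jj mulr1 (dotC (H *m _)) -/(al j) subrr sub0r.
    case: (j) jo => [|l] jo; first by rewrite dot0l oppr0.
    by rewrite dotZl dotC jo // mulr0 oppr0.
  rewrite !dotE jo // mulr0 subr0 (dotC (H *m _)) (dot_sym _ _ symH).
  rewrite lanczos_recurrence !dotE jo // mulr0 add0r.
  have -> : dot (q j) (if i is l.+1 then be l *: q l else 0) = 0.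
    by case: (i) ij => [|l] ij; rewrite ?dot0r // dotZr jo ?mulr0 // ltnW.
  rewrite addr0; case: j ij {bj} jk IH jj jo => // j ij jk IH jj jo.
  have [j1 j1o] := IH j (leqnSn _) (ltnW (ltnW jk)).
  rewrite dotZl; move: ij; rewrite ltnS leq_eqVlt => /orP[/eqP->|ij].
    by rewrite jj j1 subrr.
  by rewrite jo ?ltnS // j1o // !mulr0 subrr.
split.
  rewrite lanczos_qS dotZl dotZr -lanczos_beta_sqr; field.
  exact: bj.
move=> i ij; rewrite lanczos_qS dotZl orth ?mulr0 //.
Qed.

Lemma lanczos_tridiagE k : lanczos_regular k -> forall i j : 'I_k,
  lanczos_tridiag H b k i j = dot (q i) (H *m q j).
Proof.
move=> reg; have orth := lanczos_orthonormal reg.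
suff upper (i j : 'I_k) : (i < j)%N -> dot (q i) (H *m q j) =
    if val j == i.+1 then be i else 0.
  move=> i j; rewrite mxE; have [->//|ij] := eqVneq i j.
  have [ltij|ltji|/ord_inj e] := ltngtP i j; last by rewrite e eqxx in ij.
    rewrite upper //; case: ifP => // _.
    by case: eqP => // e; move: ltij; rewrite e ltnNge leqnSn.
  rewrite (dot_sym _ _ symH) upper //.
  by case: eqP => [e|_ //]; move: ltji; rewrite e ltnNge leqnSn.
move=> ij; rewrite (dot_sym _ _ symH) lanczos_recurrence !dotE.
rewrite !orth //; last exact: leq_ltn_trans ij (ltn_ord j).
rewrite (gtn_eqF ij) mulr0 add0r.
have -> : dot (q j) (if val i is l.+1 then be l *: q l else 0) = 0.
  case e : (val i) => [|l]; first by rewrite dot0r.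
  have {}e : nat_of_ord i = l.+1 by [].
  have lj : (l < j)%N by lia.
  rewrite dotZr orth ?(gtn_eqF lj) ?mulr0 //.
  by have := ltn_ord j; lia.
by rewrite addr0; case: eqP => _; rewrite ?mulr1 ?mulr0.
Qed.

End LanczosTheory.

Section KrylovSpace.
Variables (R : realType) (n : nat) (H : 'M[R]_n) (b : 'cV[R]_n) (eps : R).
Hypotheses (symH : H^T = H) (b1 : dot b b = 1).

Local Notation q := (lanczos_q H b).
Local Notation al := (lanczos_alpha H b).
Local Notation be := (lanczos_beta H b).
Local Notation Q k := (lanczos_basis H b k).
Local Notation regular := (lanczos_regular H b).

Definition krylov k (w : 'cV[R]_n) :=
  exists c : nat -> R, w = \sum_(j < k) c j *: q j.

Lemma krylovD k v w : krylov k v -> krylov k w -> krylov k (v + w).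
Proof.
move=> [c ->] [c' ->]; exists (fun j => c j + c' j).
by rewrite -big_split; apply: eq_bigr => j _; rewrite scalerDl.
Qed.

Lemma krylovZ k a w : krylov k w -> krylov k (a *: w).
Proof.
move=> [c ->]; exists (fun j => a * c j).
by rewrite scaler_sumr; apply: eq_bigr => j _; rewrite scalerA.
Qed.

Lemma krylovN k w : krylov k w -> krylov k (- w).
Proof. by rewrite -scaleN1r; exact: krylovZ. Qed.

Lemma krylov0 k : krylov k 0.
Proof. by exists (fun=> 0); rewrite big1 // => j _; rewrite scale0r. Qed.

Lemma krylov_q k j : (j < k)%N -> krylov k (q j).
Proof.
move=> jk; exists (fun i => (i == j)%:R).
rewrite (bigD1 (Ordinal jk)) //= eqxx scale1r big1 ?addr0 // => i ij.
by rewrite (_ : (i == j :> nat) = false) ?scale0r //; exact: negbTE.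
Qed.

Lemma krylov_sum k l (f : 'I_l -> 'cV[R]_n) :
  (forall i, krylov k (f i)) -> krylov k (\sum_i f i).
Proof.
by move=> kf; apply: big_ind => [|v w|i _]; [exact: krylov0|exact: krylovD|].
Qed.

Lemma krylovW k l w : (k <= l)%N -> krylov k w -> krylov l w.
Proof.
move=> kl [c ->]; apply: krylov_sum => j; apply/krylovZ/krylov_q.
exact: leq_trans kl.
Qed.

Lemma krylov_mulmx_q k j : (j.+1 < k)%N -> krylov k (H *m q j).
Proof.
move=> jk; rewrite lanczos_recurrence; apply: krylovD; first apply: krylovD.
- by apply/krylovZ/krylov_q/ltnW.
- exact/krylovZ/krylov_q.
case: j jk => [_|j jk]; first exact: krylov0.
by apply/krylovZ/krylov_q; rewrite ltnW // ltnW.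
Qed.

Lemma krylov_mulmx k w : krylov k w -> krylov k.+1 (H *m w).
Proof.
move=> [c ->]; rewrite mulmx_sumr; apply: krylov_sum => j.
by rewrite -scalemxAr; apply/krylovZ/krylov_mulmx_q; rewrite ltnS.
Qed.

Lemma krylov_breakdown k w : be k = 0 -> krylov k.+1 w -> krylov k.+1 (H *m w).
Proof.
move=> bk [c ->]; rewrite mulmx_sumr; apply: krylov_sum => j.
rewrite -scalemxAr; apply: krylovZ.
have [jk|] := boolP (j.+1 < k.+1)%N; first exact: krylov_mulmx_q.
rewrite -leqNgt ltnS => kj; have {kj} -> : j = k :> nat.
  by apply/eqP; rewrite eqn_leq kj -ltnS ltn_ord.
rewrite lanczos_recurrence bk scale0r addr0; apply: krylovD.
  exact/krylovZ/krylov_q.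
case: (k) => [|l]; first exact: krylov0.
by apply/krylovZ/krylov_q; rewrite ltnW.
Qed.

Lemma lanczos_basis_mulmx k (s : 'cV[R]_k) :
  Q k *m s = \sum_(j < k) s j 0 *: q j.
Proof.
apply/matrixP => i j; rewrite (ord1 j) mxE summxE; apply: eq_bigr => l _.
by rewrite !mxE mulrC.
Qed.

Lemma lanczos_basis_isometry k (s t : 'cV[R]_k) : regular k ->
  dot (Q k *m s) (Q k *m t) = dot s t.
Proof.
move=> reg; rewrite !lanczos_basis_mulmx dot_suml [RHS]dot_sum.
apply: eq_bigr => i _; rewrite dotZl dot_sumr (bigD1 i) //= dotZr.
rewrite (lanczos_orthonormal symH b1 reg) // eqxx mulr1.
rewrite big1 ?addr0 // => j ji; rewrite dotZr.
rewrite (lanczos_orthonormal symH b1 reg) // (_ : (i == j :> nat) = false) ?mulr0 //.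
by rewrite eq_sym; exact: negbTE.
Qed.

Lemma lanczos_basis_rayleigh k (s : 'cV[R]_k) : regular k ->
  dot (Q k *m s) (H *m (Q k *m s)) = dot s (lanczos_tridiag H b k *m s).
Proof.
move=> reg; rewrite !lanczos_basis_mulmx mulmx_sumr dot_suml [RHS]dot_sum.
apply: eq_bigr => i _; rewrite dotZl dot_sumr mxE; congr (_ * _).
apply: eq_bigr => j _; rewrite -scalemxAr dotZr mulrC.
by rewrite lanczos_tridiagE.
Qed.

Lemma lanczos_no_success k : (0 < k)%N -> regular k ->
  ~ (exists v, lanczos_success H eps b k v) ->
  forall w, krylov k w -> - eps / 2 * dot w w <= dot w (H *m w).
Proof.
move=> k0 reg nos w [c ->].
have symT : (lanczos_tridiag H b k)^T = lanczos_tridiag H b k.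
  apply/matrixP => i j; rewrite mxE !lanczos_tridiagE //.
  exact: dot_sym.
have [s [s1 Ts smin]] := lambda_min_eigenvector k0 symT.
have wE : \sum_(j < k) c j *: q j = Q k *m (\col_j c j).
  by rewrite lanczos_basis_mulmx; apply: eq_bigr => j _; rewrite mxE.
rewrite wE lanczos_basis_isometry // lanczos_basis_rayleigh //.
apply: le_trans (smin _); rewrite ler_wpM2r ?dot_ge0 // leNgt.
apply/negP => lt; apply: nos; exists (Q k *m s); split.
- by exists s; split=> //; rewrite /enorm s1 sqrtr1.
- by rewrite /enorm lanczos_basis_isometry // s1 sqrtr1.
by rewrite lanczos_basis_rayleigh // Ts dotZr s1 mulr1 ltW.
Qed.

Lemma krylov_invariant_orthogonal k (z : 'cV[R]_n) (lam : R) :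
  0 < eps -> (0 < k)%N -> regular k ->
  (forall w, krylov k w -> krylov k (H *m w)) ->
  (forall w, krylov k w -> - eps / 2 * dot w w <= dot w (H *m w)) ->
  H *m z = lam *: z -> lam < - eps -> dot z b = 0.
Proof.
move=> eps0 k0 reg inv ray Hz lamlt.
pose z' := \sum_(j < k) dot (q j) z *: q j.
have kz' : krylov k z' by exists (fun j => dot (q j) z).
have proj w : krylov k w -> dot w z' = dot w z.
  move=> [c ->]; rewrite !dot_suml; apply: eq_bigr => i _; rewrite !dotZl.
  congr (_ * _); rewrite dot_sumr (bigD1 i) //= dotZr.
  rewrite (lanczos_orthonormal symH b1 reg) // eqxx mulr1 big1 ?addr0 // => j ji.
  rewrite dotZr (lanczos_orthonormal symH b1 reg) //.
  rewrite (_ : (i == j :> nat) = false) ?mulr0 //.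
  by rewrite eq_sym; exact: negbTE.
have e : dot z' (H *m z') = lam * dot z' z'.
  rewrite (dotC z' (H *m z')) (proj _ (inv _ kz')) (dotC _ z).
  by rewrite (dot_sym z z' symH) Hz dotZr -(proj _ kz').
have := ray _ kz'; rewrite e => h.
have : z' == 0.
  by rewrite -dot_eq0 eq_le dot_ge0 andbT; have := dot_ge0 z'; nra.
have kb : krylov k b := krylov_q k0.
by move=> /eqP z0; rewrite dotC -(proj _ kb) z0 dot0r.
Qed.

Lemma krylov_full w : regular n -> krylov n w.
Proof.
move=> reg; have QQ : (Q n)^T *m Q n = 1%:M.
  apply/matrixP => i j; rewrite mxE [RHS]mxE -val_eqE /=.
  rewrite -(lanczos_orthonormal symH b1 reg (ltn_ord i) (ltn_ord j)) dot_sum.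
  by apply: eq_bigr => l _; rewrite !mxE.
have := mulmx1C QQ => QQ'; exists (fun j => dot (q j) w).
rewrite -[LHS]mul1mx -QQ' -mulmxA lanczos_basis_mulmx; apply: eq_bigr => j _.
by rewrite mxE dot_sum; congr (_ *: _); apply: eq_bigr => i _; rewrite !mxE.
Qed.

End KrylovSpace.

Section ChebyshevIteration.
Variables (R : realType) (n : nat) (B : 'M[R]_n) (b : 'cV[R]_n).
Hypothesis symB : B^T = B.

(* [(V_k(B) b, W_k(B) b)], where [V_k(x) = T_{2k+1}(sqrt x) / sqrt x] and
   [W_k(x) = U_{2k}(sqrt x)] are Chebyshev polynomials of both kinds; they
   satisfy the Pell equation [x V_k(x)^2 + (1 - x) W_k(x)^2 = 1]. *)
Fixpoint cheb k : 'cV[R]_n * 'cV[R]_n :=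
  if k is i.+1 then
    let: (v, w) := cheb i in
    (2 *: (B *m v) - v - 2 *: w + 2 *: (B *m w),
     2 *: (B *m w) - w + 2 *: (B *m v))
  else (b, b).

Lemma chebS k : cheb k.+1 =
  (2 *: (B *m (cheb k).1) - (cheb k).1 - 2 *: (cheb k).2 + 2 *: (B *m (cheb k).2),
   2 *: (B *m (cheb k).2) - (cheb k).2 + 2 *: (B *m (cheb k).1)).
Proof. by rewrite /=; case: (cheb k). Qed.

Lemma cheb_pell k : let: (v, w) := cheb k in
  dot v (B *m v) + dot w (w - B *m w) = dot b b.
Proof.
elim: k => [|k]; first by rewrite /= !dotE addrCA subrr addr0.
rewrite chebS; case: (cheb k) => v w /= <-.
rewrite !(mulmxDr, mulmxN) -!scalemxAr.
set a := B *m v; set d := B *m w; set a2 := B *m a; set d2 := B *m d.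
have s1 : dot v d = dot w a by exact: dot_sym.
have s2 : dot v a2 = dot a a by rewrite /a2 (dot_sym v a symB).
have s3 : dot w d2 = dot d d by rewrite /d2 (dot_sym w d symB).
have s4 : dot v d2 = dot a d by rewrite /d2 (dot_sym v d symB) dotC.
have s5 : dot w a2 = dot a d by rewrite /a2 (dot_sym w a symB).
have s6 : dot a d2 = dot d a2 by exact: dot_sym.
rewrite !dotE ?(dotC w v) ?(dotC a v) ?(dotC a w) ?(dotC d v) ?(dotC d w) ?(dotC d a).
rewrite ?s1 ?s2 ?s3 ?s4 ?s5 ?s6; ring.
Qed.

Fixpoint cheb_coef (s : R) k : R * R :=
  if k is i.+1 then
    let: (p, o) := cheb_coef s i in
    ((1 + 2 * s) * p + 2 * (1 + s) * o, (1 + 2 * s) * o + 2 * s * p)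
  else (1, 1).

Lemma cheb_eigenvector (z : 'cV[R]_n) (s : R) k : B *m z = - s *: z ->
  dot z (cheb k).1 = (-1) ^+ k * (cheb_coef s k).1 * dot z b /\
  dot z (cheb k).2 = (-1) ^+ k * (cheb_coef s k).2 * dot z b.
Proof.
move=> Bz; have dB (v : 'cV[R]_n) : dot z (B *m v) = - s * dot z v.
  by rewrite (dot_sym _ _ symB) Bz dotZr dotC.
elim: k => [|k]; first by rewrite /= expr0 !mul1r.
rewrite chebS exprS /=; case: (cheb k) (cheb_coef s k) => v w [p o] /= [e1 e2].
by rewrite !dotE !dB e1 e2; split; ring.
Qed.

Lemma cheb_coef_growth (s : R) k : 0 < s ->
  (Num.sqrt s + Num.sqrt (1 + s)) ^+ (2 * k + 1)
    <= 2 * (Num.sqrt (1 + s) * (cheb_coef s k).2).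
Proof.
move=> s0; set S := Num.sqrt s; set C := Num.sqrt (1 + s).
have S2 : S ^+ 2 = s by rewrite sqr_sqrtr // ltW.
have C2 : C ^+ 2 = 1 + s by rewrite sqr_sqrtr //; lra.
have SC : S <= C by rewrite ler_wsqrtr //; lra.
suff [e1 e2] : S * (cheb_coef s k).1 + C * (cheb_coef s k).2 =
      (S + C) ^+ (2 * k + 1) /\
    C * (cheb_coef s k).2 - S * (cheb_coef s k).1 = (C - S) ^+ (2 * k + 1).
  have : 0 <= (C - S) ^+ (2 * k + 1) by rewrite exprn_ge0 // subr_ge0.
  by rewrite -e1 -e2; lra.
elim: k => [|k [IH1 IH2]]; first by rewrite /= !mulr1 muln0 !expr1.
have -> : (2 * k.+1 + 1 = 2 * k + 1 + 2)%N by lia.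
rewrite !(exprD _ (2 * k + 1) 2) -IH1 -IH2 /=.
case: (cheb_coef s k) => p o /=; move: S C S2 C2 {SC IH1 IH2} => S C S2 C2.
have -> : 1 + 2 * s = S ^+ 2 + C ^+ 2 by rewrite S2 C2; ring.
by rewrite -C2 -S2; split; ring.
Qed.

End ChebyshevIteration.

Section LanczosOverlap.
Variables (R : realType) (n : nat) (H : 'M[R]_n) (b : 'cV[R]_n) (eps M : R).
Hypotheses (symH : H^T = H) (b1 : dot b b = 1) (eps0 : 0 < eps) (M0 : 0 < M).
Hypothesis H_le : forall v, dot v (H *m v) <= M * dot v v.

Let B : 'M[R]_n := (M + eps / 2)^-1 *: (H + (eps / 2)%:M).

Lemma krylov_cheb k :
  krylov H b k.+1 (cheb B b k).1 /\ krylov H b k.+1 (cheb B b k).2.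
Proof.
have kB l w : krylov H b l w -> krylov H b l.+1 (B *m w).
  move=> kw; rewrite /B -scalemxAl mulmxDl mul_scalar_mx.
  apply/krylovZ/krylovD; first exact: krylov_mulmx.
  by apply: krylovZ; exact: krylovW (leqnSn l) kw.
elim: k => [|k [IHv IHw]].
  by split; exact: (@krylov_q _ _ H b 1 0).
rewrite chebS /=; have IHv' := krylovW (leqnSn _) IHv.
have IHw' := krylovW (leqnSn _) IHw.
split; repeat first [exact: IHv' | exact: IHw' | exact: IHv | exact: IHw | apply: krylovD |
  apply: krylovN | apply: krylovZ | apply: kB].
Qed.

Lemma lanczos_overlap k (z : 'cV[R]_n) (lam : R) :
  (forall w, krylov H b k.+1 w -> - eps / 2 * dot w w <= dot w (H *m w)) ->
  dot z z = 1 -> H *m z = lam *: z -> lam < - eps ->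
  let s := (- lam - eps / 2) / (M + eps / 2) in
  `|dot z b| * (Num.sqrt s + Num.sqrt (1 + s)) ^+ (2 * k + 1) <= 2.
Proof.
move=> ray z1 Hz lam_lt; have e0 := eps0; have m0 := M0.
set s := (- lam - eps / 2) / (M + eps / 2); cbv zeta.
have c0 : 0 < M + eps / 2 by rewrite addr_gt0 // divr_gt0.
have s0 : 0 < s by rewrite divr_gt0 //; lra.
have symB : B^T = B by rewrite /B linearZ /= linearD /= tr_scalar_mx symH.
have Bz : B *m z = - s *: z.
  rewrite /B -scalemxAl mulmxDl mul_scalar_mx Hz -scalerDl scalerA.
  by congr (_ *: _); rewrite /s; field; rewrite ?gt_eqF //; lra.
have dB (v : 'cV[R]_n) : dot v (B *m v) =
    (M + eps / 2)^-1 * (dot v (H *m v) + eps / 2 * dot v v).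
  by rewrite /B -scalemxAl mulmxDl mul_scalar_mx !dotE.
have [kv kw] := krylov_cheb k.
have [_ ew] := cheb_eigenvector b symB k Bz.
have := cheb_pell b symB k.
case: (cheb B b k) kv kw ew => v w /= kv kw ew; rewrite b1 => pell.
have v0 : 0 <= dot v (B *m v).
  by rewrite dB mulr_ge0 ?invr_ge0 ?(ltW c0) //; have := ray _ kv; lra.
have [x xE] : exists x, x = w - dot z w *: z by exists (w - dot z w *: z).
have xz : dot x z = 0 by rewrite xE !dotE z1 (dotC w z); ring.
have x0 : 0 <= dot x (x - B *m x).
  rewrite dotDr dotNr dB -(pmulr_rge0 _ c0) mulrBr mulrA divff ?gt_eqF // mul1r.
  by have := H_le x; lra.
have wE : dot w (w - B *m w) = (1 + s) * dot z w ^+ 2 + dot x (x - B *m x).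
  have {1 2 3}-> : w = x + dot z w *: z by rewrite xE subrK.
  move: (dot z w) => ze.
  rewrite mulmxDr -scalemxAr Bz !dotE (dotC z x) xz z1.
  by rewrite (dot_sym z x symB) Bz !dotE xz; ring.
have le1 : (1 + s) * dot z w ^+ 2 <= 1 by lra.
have growth := cheb_coef_growth k s0.
set rho := _ + _ in growth *.
apply: le_trans (ler_wpM2l (normr_ge0 _) growth) _.
set C := Num.sqrt (1 + s); have C2 : C ^+ 2 = 1 + s by rewrite sqr_sqrtr //; lra.
rewrite mulrCA -[leRHS]mulr1 ler_pM2l //.
have C0 : 0 <= C by exact: sqrtr_ge0.
have : (`|dot z b| * (C * (cheb_coef s k).2)) ^+ 2 <= 1.
  apply: le_trans le1; rewrite ew !exprMn sqrr_sign C2 real_normK ?num_real //.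
  by rewrite le_eqVlt; apply/orP; left; apply/eqP; ring.
by set t := _ * _; nra.
Qed.

End LanczosOverlap.

Lemma lanczos_iterations_suffice (R : realType) (N delta eps M s : R) (k : nat) :
  2 <= N -> 0 < delta < 1 -> 0 < eps < M ->
  (eps / 2) / (M + eps / 2) <= s ->
  ln (275%:R / 100%:R * N / delta ^+ 2) / 2 * Num.sqrt (M / eps) <= k%:R ->
  2 * Num.sqrt N / delta < (Num.sqrt s + Num.sqrt (1 + s)) ^+ (2 * k + 1).
Proof.
move=> N2 /andP[d0 d1] /andP[eps0 epsM] s_ge k_ge.
have M0 : 0 < M by lra.
have c0 : 0 < M + eps / 2 by lra.
have s0 : 0 < s by apply: lt_le_trans s_ge; rewrite !divr_gt0.
set a := 275%:R / 100%:R * N / delta ^+ 2 in k_ge.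
have a_ge : 11 / 2 <= a.
  rewrite /a ler_pdivlMr ?exprn_gt0 //.
  have : delta ^+ 2 <= 1 by rewrite expr_le1 // ltW.
  by nra.
have a0 : 0 < a by lra.
set l := ln a in k_ge.
have l_ge : 6 / 5 <= l.
  rewrite -(expRK (6 / 5)) ler_ln ?posrE ?expR_gt0 //; apply: le_trans a_ge.
  have e : expR (- (3 / 10)) >= 7 / 10 :> R.
    by apply: le_trans (expR_ge1Dx _); lra.
  have e1 : expR (3 / 10) <= 10 / 7 :> R.
    rewrite -[3 / 10]opprK expRN invf_ple ?posrE ?expR_gt0 //; lra.
  have -> : 6 / 5 = 4%:R * (3 / 10) :> R by field.
  rewrite expRM_natl.
  apply: (@le_trans _ _ ((10 / 7) ^+ 4)); first by rewrite lerXn2r ?nnegrE ?expR_ge0 //; lra.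
  by rewrite !exprS expr0; lra.
set r := Num.sqrt (eps / M).
have r2 : r ^+ 2 = eps / M by rewrite sqr_sqrtr // divr_ge0 ?ltW.
have r0 : 0 < r by rewrite sqrtr_gt0 divr_gt0.
have r1 : r < 1.
  by rewrite -sqrtr1 ltr_sqrt // ltr_pdivrMr // mul1r.
have ri : Num.sqrt (M / eps) = r^-1.
  by rewrite -sqrtrV ?divr_ge0 ?ltW // invf_div.
rewrite ri in k_ge.
set u := Num.sqrt (s / (1 + s)).
have rho_ge := expR_le_asinh s0; rewrite -/u in rho_ge.
set D := Num.sqrt (2 * (1 + r ^+ 2)).
have D2 : D ^+ 2 = 2 * (1 + r ^+ 2) by rewrite sqr_sqrtr //; nra.
have D0 : 0 < D by rewrite sqrtr_gt0; nra.
have u_ge : r / D <= u.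
  rewrite -(ler_pXn2r (n:=2)) ?nnegrE ?sqrtr_ge0 ?divr_ge0 ?(ltW r0) ?(ltW D0) //.
  have u2 : u ^+ 2 = s / (1 + s) by rewrite sqr_sqrtr // divr_ge0 //; lra.
  rewrite expr_div_n D2 u2 r2 ler_pdivlMr; last by lra.
  have -> : eps / M / (2 * (1 + eps / M)) = eps / (2 * (M + eps)).
    by field; rewrite ?gt_eqF //; lra.
  rewrite mulrAC ler_pdivrMr; last by lra.
  move: s_ge; rewrite ler_pdivrMr //; nra.
have u0 : 0 < u by apply: lt_le_trans u_ge; rewrite divr_gt0.
have key : (l + 5 / 11) / 2 < (2 * k + 1)%:R * u.
  apply: (@lt_le_trans _ _ ((l / r + 1) * (r / D))).
    have -> : (l / r + 1) * (r / D) = (l + r) / D by field; rewrite !gt_eqF.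
    rewrite ltr_pdivrMr // mulrAC ltr_pdivlMr //.
    rewrite -(ltr_pXn2r (n:=2)) ?nnegrE; [|done|nra|lra].
    rewrite exprMn D2.
    have h0 : 0 < 2 * l ^+ 2 - (l + 5 / 11) ^+ 2 by nra.
    have h1 : 0 < (l + 1) ^+ 2 - (l + 5 / 11) ^+ 2 by nra.
    have h2 : 0 < (l + 5 / 11) ^+ 2 - 2 by nra.
    have := mulr_gt0 h0 (_ : 0 < 1 - r); rewrite subr_gt0 => /(_ r1).
    have := mulr_gt0 h1 r0.
    have := mulr_gt0 (mulr_gt0 h2 r0) (_ : 0 < 1 - r).
    rewrite subr_gt0 => /(_ r1).
    lra.
  apply: ler_pM => //.
  - by rewrite addr_ge0 // divr_ge0 ?(ltW r0) //; lra.
  - by rewrite divr_ge0 // ltW.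
  by rewrite natrD natrM lerD2r; move: k_ge; lra.
have rhs : expR ((2 * k + 1)%:R * u) <=
    (Num.sqrt s + Num.sqrt (1 + s)) ^+ (2 * k + 1).
  by rewrite expRM_natl lerXn2r // nnegrE ?expR_ge0 // addr_ge0 ?sqrtr_ge0.
apply: lt_le_trans rhs.
apply: (@le_lt_trans _ _ (expR ((l + 5 / 11) / 2))); last by rewrite ltr_expR.
rewrite -(ler_pXn2r (n:=2)) ?nnegrE ?expR_ge0 ?divr_ge0 ?mulr_ge0 ?sqrtr_ge0 ?(ltW d0) //.
rewrite -[expR _ ^+ 2]expRM_natl [2%:R * (_ / 2)]mulrC divfK // expRD.
rewrite lnK ?posrE // expr_div_n exprMn sqr_sqrtr; last by lra.
apply: (@le_trans _ _ (a * (16 / 11))).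
  rewrite /a le_eqVlt; apply/orP; left; apply/eqP; field.
  by rewrite gt_eqF.
by rewrite ler_pM2l //; apply: le_trans (expR_ge1Dx _); lra.
Qed.

Section OracleCertificate.
Variables (R : realType) (n : nat) (H : 'M[R]_n) (eps delta : R).
Hypotheses (n0 : (0 < n)%N) (symH : H^T = H).
Hypotheses (eps0 : 0 < eps) (delta01 : 0 < delta < 1).

Lemma oracle_certificate_overlap (b z : 'cV[R]_n) (lam : R) k : enorm b = 1 ->
  dot z z = 1 -> H *m z = lam *: z -> lam < - eps ->
  oracle_certifies H eps delta b k -> `|dot z b| < delta / Num.sqrt n%:R.
Proof.
move=> nb z1 Hz lam_lt [[k0 kN reg] nperf nosucc].
have e0 := eps0; have /andP[d0 d1] := delta01.
have b1 : dot b b = 1 by rewrite -sqr_enorm nb expr1n.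
have rn0 : 0 < (n%:R : R) by rewrite ltr0n.
have sn0 : 0 < Num.sqrt (n%:R : R) by rewrite sqrtr_gt0.
have ray : forall w, krylov H b k w -> - eps / 2 * dot w w <= dot w (H *m w).
  by apply: lanczos_no_success => //; apply: nosucc; rewrite k0 leqnn.
case: k k0 kN reg nperf nosucc ray => // k _ kN reg nperf _ ray.
have ortho : (forall w, krylov H b k.+1 w -> krylov H b k.+1 (H *m w)) ->
    `|dot z b| < delta / Num.sqrt n%:R.
  move=> inv; rewrite (krylov_invariant_orthogonal symH b1 eps0 _ reg inv ray Hz) //.
  by rewrite normr0 divr_gt0.
have [bk|bk] := eqVneq (lanczos_beta H b k) 0.
  by apply: ortho => w; exact: krylov_breakdown.
have kN' : oracle_N H eps delta = k.+1%:Z.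
  apply/eqP; rewrite eq_le kN andbT leNgt; apply/negP => lt.
  apply: nperf; split=> //.
  by move=> i; rewrite !ltnS leq_eqVlt => /orP[/eqP->//|ik]; apply: reg.
set M := spectral_norm H.
have lamM : - lam <= M.
  have nz : enorm z = 1 by rewrite /enorm z1 sqrtr1.
  have := enorm_mulmx_le H z; rewrite Hz enormZ nz !mulr1.
  by apply: le_trans; rewrite -normrN ler_norm.
have epsM : 0 < eps < M by rewrite eps0 /=; lra.
have M0 : 0 < M by lra.
have [kn|kn] := leqP n k.+1.
  have ek : k.+1 = n.
    apply/eqP; rewrite eqn_leq kn andbT -lez_nat -kN' /oracle_N ge_min.
    by rewrite lexx.
  by apply: ortho => w _; rewrite ek in reg *; exact: krylov_full.
have kX : ln (275%:R / 100%:R * n%:R / delta ^+ 2) / 2 * Num.sqrt (M / eps) <= k%:R.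
  move: kN'; rewrite /oracle_N /Num.min; set X := (_ / 2 * _).
  case: ifP => _ e; first by case: e kn => ->; rewrite ltnn.
  have -> : k%:R = (Num.ceil X)%:~R.
    by have -> : Num.ceil X = k%:Z by apply: (addrI 1); rewrite e.
  exact: ceil_ge.
have H_le v : dot v (H *m v) <= M * dot v v.
  apply: le_trans (ler_norm _) _; apply: le_trans (normr_dot_mulmx_le _ _ _) _.
  by rewrite -mulrA -expr2 sqr_enorm.
have c0 : 0 < M + eps / 2 by lra.
have := lanczos_overlap symH b1 eps0 M0 H_le ray z1 Hz lam_lt; cbv zeta.
set s := (- lam - eps / 2) / _.
have s_ge : (eps / 2) / (M + eps / 2) <= s by rewrite ler_pM2r ?invr_gt0 //; lra.
have n2 : 2 <= n%:R :> R by rewrite ler_nat (leq_trans _ kn).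
have := lanczos_iterations_suffice n2 delta01 epsM s_ge kX.
set rho := _ ^+ _ => h1 h2.
rewrite ltr_pdivlMr // -(ltr_pM2r (x := 2 / delta)) ?divr_gt0 //.
rewrite [ltRHS](_ : _ = 2); last by field; rewrite gt_eqF.
have [->|bz] := eqVneq (dot z b) 0; first by rewrite normr0 !mul0r.
apply: lt_le_trans h2; rewrite -mulrA ltr_pM2l ?normr_gt0 //.
by apply: le_lt_trans h1; rewrite mulrCA mulrA.
Qed.

Lemma eigenvector_of_lambda_min_lt : lambda_min H < - eps ->
  exists z lam, [/\ dot z z = 1, H *m z = lam *: z & lam < - eps].
Proof.
have e0 := eps0; rewrite /lambda_min; set E := [set a | _] => infE.
have E0 : E !=set0.
  apply/set0P/eqP => e; move: infE; rewrite e inf0; lra.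
have eigen a : E a -> exists z, dot z z = 1 /\ H *m z = a *: z.
  move=> /eigenvalueP[v va v0].
  have vT : H *m v^T = a *: v^T by rewrite -{1}symH -trmx_mul va linearZ.
  have v1 : enorm v^T != 0.
    rewrite enorm_eq0; apply: contra_neq v0 => /(congr1 trmx).
    by rewrite trmxK trmx0.
  exists ((enorm v^T)^-1 *: v^T); split.
    by rewrite dotZl dotZr -sqr_enorm; field.
  by rewrite -scalemxAr vT !scalerA mulrC.
have hinf : has_inf E.
  split=> //; exists (- spectral_norm H) => a /eigen[z [z1 Hz]].
  have nz : enorm z = 1 by rewrite /enorm z1 sqrtr1.
  have := enorm_mulmx_le H z; rewrite Hz enormZ nz !mulr1.
  by rewrite ler_norml => /andP[].
have [|a Ea lt] := inf_adherent (_ : 0 < - eps - inf E) hinf; first by lra.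
by have [z [z1 Hz]] := eigen a Ea; exists z, a; split=> //; lra.
Qed.

Context (d : measure_display) (W : measurableType d) (P : probability W R).

Theorem oracle_certificate_probability (b : W -> 'cV[R]_n) :
  uniform_on_sphere P b ->
  with_probability_ge P (1 - delta)
    [set w | forall k, oracle_certifies H eps delta (b w) k ->
               - eps <= lambda_min H].
Proof.
move=> unif; have /andP[d0 d1] := delta01.
have [le|lt] := leP (- eps) (lambda_min H).
  exists setT; split=> //; rewrite probability_setT lee_fin; lra.
have [z [lam [z1 Hz lam_lt]]] := eigenvector_of_lambda_min_lt lt.
have sn0 : 0 < Num.sqrt (n%:R : R) by rewrite sqrtr_gt0 ltr0n.
have t0 := divr_gt0 d0 sn0.
pose A := [set w | `|dot z (b w)| < delta / Num.sqrt n%:R].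
have mA : measurable A by exact: (measurable_slab unif).
exists (~` A); split; first exact: measurableC.
- move=> w nA k cert; exfalso; apply: nA; case: unif => _ b1 _.
  exact: oracle_certificate_overlap z1 Hz lam_lt cert.
rewrite probability_setC // EFinB leeB //.
have := slab_probability unif t0 z1.
by rewrite [Num.sqrt _ * _]mulrC divfK // gt_eqF.
Qed.

End OracleCertificate.

(** * Taylor estimates and the line search *)

Section LineDerivatives.
Variables (R : realType) (n : nat).
Implicit Types (f F : 'cV[R]_n -> R) (x d e : 'cV[R]_n).

Lemma derive_coord f x d : differentiable f x ->
  'D_d f x = \sum_j d j 0 * 'D_(delta_mx j 0) f x.
Proof.
move=> df; rewrite deriveE // {1}[d]vector_sum linear_sum; apply: eq_bigr => j _.
by rewrite linearZ /= deriveE.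
Qed.

Lemma is_derive_line f x d s : differentiable f (x + s *: d) ->
  is_derive s 1 (fun s => f (x + s *: d)) ('D_d f (x + s *: d)).
Proof.
move=> df.
have e : (fun h : R => h^-1 *: (((fun s => f (x + s *: d)) \o shift s) (h *: 1) -
      f (x + s *: d))) =
    (fun h => h^-1 *: ((f \o shift (x + s *: d)) (h *: d) - f (x + s *: d))).
  apply/funext => h /=; congr (_ *: (f _ - _)).
  by rewrite [h *: 1]mulr1 scalerDl addrCA.
have := diff_derivable (v := d) df; rewrite /derivable => cv.
by split; rewrite /derivable /derive e.
Qed.

Lemma is_derive_F_line F x d s : differentiable F (x + s *: d) ->
  is_derive s 1 (fun s => F (x + s *: d)) (dot (grad F (x + s *: d)) d).
Proof.
move=> dF; apply: is_derive_eq; first exact: is_derive_line.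
rewrite derive_coord // dot_sum; apply: eq_bigr => j _.
by rewrite mxE mulrC.
Qed.

Lemma is_derive_grad_line F x d e s : differentiable (grad F) (x + s *: d) ->
  is_derive s 1 (fun s => dot e (grad F (x + s *: d)))
    (dot e (hess F (x + s *: d) *m d)).
Proof.
move=> dG.
have dGi i : differentiable ('D_(delta_mx i 0) F) (x + s *: d).
  have -> : 'D_(delta_mx i 0) F = (fun M : 'cV[R]_n => M i 0) \o grad F.
    by apply/funext => y /=; rewrite mxE.
  by apply: differentiable_comp => //; exact: differentiable_coord.
have -> : (fun s => dot e (grad F (x + s *: d))) =
    \sum_i (e i 0 \*: (fun s => 'D_(delta_mx i 0) F (x + s *: d))).
  apply/funext => t; rewrite fct_sumE dot_sum; apply: eq_bigr => i _.
  by rewrite mxE.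
have dl i := is_derive_line (dGi i).
apply: is_derive_eq.
rewrite dot_sum; apply: eq_bigr => i _; congr (_ * _).
rewrite derive_coord // mxE; apply: eq_bigr => j _.
by rewrite mxE mulrC.
Qed.

End LineDerivatives.

Section SecondOrderModel.
Variables (R : realType) (n : nat) (F : 'cV[R]_n -> R) (u0 : 'cV[R]_n).
Variables (Omega : set 'cV[R]_n) (LH Flow Ug UH : R).
Hypothesis FA : ncg_assumptions F u0 Omega LH Flow Ug UH.
Implicit Types (x d e v w : 'cV[R]_n).

Lemma Omega_segment x d (s a : R) : Omega x -> Omega (x + a *: d) ->
  0 <= s <= a -> Omega (x + s *: d).
Proof.
move=> Ox Oxa /andP[s0 sa].
have [a0|a0] := eqVneq a 0.
  by have -> : s = 0 by [lra]; rewrite scale0r addr0.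
have a1 : 0 < a by rewrite lt_def a0 (le_trans s0).
have t01 : 0 <= s / a <= 1 by rewrite divr_ge0 ?ler_pdivrMr ?mul1r // ltW.
have [t te] : exists t : {i01 R}, t%:inum = s / a.
  by have /andP[t0 t1] := t01; exists (Itv01 t0 t1).
have := Omega_convex FA t (mem_set Oxa) (mem_set Ox).
rewrite inE; congr (Omega _).
rewrite -[LHS]/(t%:inum *: (x + a *: d) + (1 - t%:inum) *: x) te.
rewrite scalerDr scalerA divfK // addrAC -scalerDl.
by rewrite [s / a + _]addrC subrK scale1r.
Qed.

Lemma Omega_ball x : Omega x ->
  exists r : R, 0 < r /\ forall d, enorm d < r -> Omega (x + d).
Proof.
move=> Ox; have /nbhs_ballP[r /= r0 rO] := open_nbhs_nbhs (conj (Omega_open FA) Ox).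
exists r; split=> // d dr; apply: rO.
split=> // i j; rewrite (ord1 j) /ball /= mxE opprD addrA subrr sub0r normrN.
exact: le_lt_trans (normr_coord_le d i) dr.
Qed.

Lemma grad_expansion x d (a : R) : 0 <= a -> Omega x -> Omega (x + a *: d) ->
  enorm (grad F (x + a *: d) - grad F x - a *: (hess F x *m d))
    <= LH / 2 * a ^+ 2 * enorm d ^+ 2.
Proof.
move=> a0 Ox Oxa; have L0 := LH_gt0 FA.
apply: enorm_le_dot => [|e].
  by rewrite mulr_ge0 ?sqr_ge0 // mulr_ge0 ?sqr_ge0 // divr_ge0 // ltW.
rewrite !dotDr !dotNr dotZr.
suff : dot e (grad F (x + a *: d)) <= dot e (grad F x) + a * dot e (hess F x *m d)
    + LH / 2 * a ^+ 2 * (enorm d ^+ 2 * enorm e) by lra.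
have Os s : 0 <= s <= a -> Omega (x + s *: d) by exact: Omega_segment.
apply: (@le_is_derive R (fun s => dot e (grad F (x + s *: d)))
  (fun s => dot e (grad F x) + s * dot e (hess F x *m d)
    + LH / 2 * s ^+ 2 * (enorm d ^+ 2 * enorm e))
  (fun s => dot e (hess F (x + s *: d) *m d))
  (fun s => dot e (hess F x *m d) + LH * s * (enorm d ^+ 2 * enorm e))) => // [s sa|s sa|s sa|].
- exact/is_derive_grad_line/(grad_differentiable FA)/Os.
- by apply: is_derive_eq; rewrite /GRing.scale /=; field.
- rewrite -lerBlDl -dotNr -dotDr -mulNmx -mulmxDl.
  apply: le_trans (ler_norm _) _; apply: le_trans (normr_dot_mulmx_le _ _ _) _.
  have := hess_lipschitz FA (Os s sa) Ox.
  have -> : x + s *: d - x = s *: d by rewrite addrC addKr.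
  rewrite enormZ ger0_norm; last by case/andP: sa.
  move=> h; have := ler_wpM2r (enorm_ge0 d) (ler_wpM2r (enorm_ge0 e) h).
  by move/le_trans; apply; rewrite le_eqVlt; apply/orP; left; apply/eqP; ring.
by rewrite scale0r addr0 mul0r expr0n mulr0 mul0r !addr0.
Qed.

Lemma F_expansion x d (a : R) : 0 <= a -> Omega x -> Omega (x + a *: d) ->
  F (x + a *: d) <= F x + a * dot (grad F x) d
    + a ^+ 2 / 2 * dot d (hess F x *m d) + LH / 6 * a ^+ 3 * enorm d ^+ 3.
Proof.
move=> a0 Ox Oxa.
have Os s : 0 <= s <= a -> Omega (x + s *: d) by exact: Omega_segment.
apply: (@le_is_derive R (fun s => F (x + s *: d))
  (fun s => F x + s * dot (grad F x) d
    + s ^+ 2 / 2 * dot d (hess F x *m d) + LH / 6 * s ^+ 3 * enorm d ^+ 3)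
  (fun s => dot (grad F (x + s *: d)) d)
  (fun s => dot (grad F x) d + s * dot d (hess F x *m d)
    + LH / 2 * s ^+ 2 * enorm d ^+ 3)) => // [s sa|s sa|s sa|].
- exact/is_derive_F_line/(F_differentiable FA)/Os.
- by apply: is_derive_eq; rewrite /GRing.scale /=; field.
- have /andP[s0 _] := sa; have := grad_expansion s0 Ox (Os s sa).
  set E := _ - _ - _ => hE.
  have := dot_le E d; rewrite /E !dotDl !dotNl dotZl (dotC (_ *m d)).
  by have := enorm_ge0 d; nra.
by rewrite scale0r addr0 mul0r !expr0n /= !mul0r !mulr0 !mul0r !addr0.
Qed.

Lemma second_difference x v w (r t : R) : 0 < t ->
  t * (enorm v + enorm w) < r -> (forall d, enorm d < r -> Omega (x + d)) ->
  `|F (x + t *: w + t *: v) - F (x + t *: v) - F (x + t *: w) + F x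
     - t ^+ 2 * dot v (hess F x *m w)|
    <= LH * (enorm v + enorm w) ^+ 3 * t ^+ 3.
Proof.
move=> t0 tr Or; set K := enorm v + enorm w in tr *.
have v0 := enorm_ge0 v; have w0 := enorm_ge0 w; have L0 := LH_gt0 FA.
have K0 : 0 <= K by exact: addr_ge0.
have r0 : 0 < r by apply: le_lt_trans tr; rewrite mulr_ge0 // ltW.
have Ox : Omega x by have := Or 0; rewrite enorm0 addr0; apply.
have dsmall s : 0 <= s <= t -> enorm (t *: w + s *: v) <= t * K.
  move=> /andP[s0 st]; apply: le_trans (enormD _ _) _.
  by rewrite !enormZ !ger0_norm // /K; nra.
have vsmall s : 0 <= s <= t -> enorm (s *: v) <= t * K.
  by move=> /andP[s0 st]; rewrite enormZ ger0_norm // /K; nra.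
have O1 s : 0 <= s <= t -> Omega (x + t *: w + s *: v).
  by move=> st; rewrite -addrA; apply: Or; exact: le_lt_trans (dsmall s st) tr.
have O2 s : 0 <= s <= t -> Omega (x + s *: v).
  by move=> st; apply: Or; exact: le_lt_trans (vsmall s st) tr.
have err d : enorm d <= t * K ->
    enorm (grad F (x + d) - grad F x - hess F x *m d) <= LH / 2 * (t * K) ^+ 2.
  move=> dK; have := @grad_expansion x d 1 ler01 Ox.
  rewrite !scale1r expr1n mulr1 => /(_ (Or _ (le_lt_trans dK tr))).
  move/le_trans; apply; rewrite ler_wpM2l ?divr_ge0 ?(ltW L0) //.
  by rewrite lerXn2r ?nnegrE ?enorm_ge0 // mulr_ge0 // ltW.
pose psi' s := dot (grad F (x + t *: w + s *: v)) v - dot (grad F (x + s *: v)) v.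
pose psi s := F (x + t *: w + s *: v) - F (x + s *: v).
have dpsi (s : R) : 0 <= s <= t -> is_derive s 1 psi (psi' s).
  move=> st; have D1 := is_derive_F_line (F_differentiable FA (O1 s st)).
  have D2 := is_derive_F_line (F_differentiable FA (O2 s st)).
  exact: is_deriveB.
pose m := t * dot v (hess F x *m w); pose c := LH * K ^+ 3 * t ^+ 2.
have bnd s : 0 <= s <= t -> m - c <= psi' s <= m + c.
  move=> st; rewrite -[m - c <= _ <= _]ler_distl /psi' -dotNl -dotDl /m -dotZr.
  set e1 := grad F (x + t *: w + s *: v) - grad F x - hess F x *m (t *: w + s *: v).
  set e2 := grad F (x + s *: v) - grad F x - hess F x *m (s *: v).
  rewrite (dotC _ v) -dotNr -dotDr.
  rewrite (_ : _ - _ = e1 - e2); last first.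
    rewrite /e1 /e2 mulmxDr -scalemxAr.
    by apply/matrixP => i j; rewrite !mxE; ring.
  apply: le_trans (normr_dot_le _ _) _.
  have h1 : enorm e1 <= LH / 2 * (t * K) ^+ 2.
    by rewrite /e1 -[x + _ + _]addrA; apply: err; exact: dsmall.
  have h2 : enorm e2 <= LH / 2 * (t * K) ^+ 2 by apply: err; exact: vsmall.
  have h3 : enorm (e1 - e2) <= LH * (t * K) ^+ 2.
    by apply: le_trans (enormD _ _) _; rewrite enormN; lra.
  have vK : enorm v <= K by rewrite /K lerDl.
  apply: (@le_trans _ _ (K * (LH * (t * K) ^+ 2))).
    by apply: ler_pM; rewrite ?enorm_ge0.
  by rewrite /c le_eqVlt; apply/orP; left; apply/eqP; ring.
have dlin (a s : R) : is_derive s 1 (fun s => psi 0 + s * a) a.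
  by apply: is_derive_eq; rewrite /GRing.scale /=; ring.
have up : psi t <= psi 0 + t * (m + c).
  apply: (@le_is_derive R psi (fun s => psi 0 + s * (m + c)) psi' (fun=> m + c) t).
  - exact: ltW.
  - by move=> s /bnd /andP[].
  by rewrite mul0r addr0.
have lo : psi 0 + t * (m - c) <= psi t.
  apply: (@le_is_derive R (fun s => psi 0 + s * (m - c)) psi (fun=> m - c) psi' t).
  - exact: ltW.
  - by move=> s /bnd /andP[].
  by rewrite mul0r addr0.
have p0 : psi 0 = F (x + t *: w) - F x by rewrite /psi !scale0r !addr0.
have tm : t * m = t ^+ 2 * dot v (hess F x *m w) by rewrite /m; ring.
have tc : t * c = LH * K ^+ 3 * t ^+ 3 by rewrite /c; ring.
rewrite -tm -tc ler_norml; rewrite p0 /psi in up lo; apply/andP; split; lra.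
Qed.

Lemma hess_symmetric x : Omega x -> (hess F x)^T = hess F x.
Proof.
move=> Ox; have [r [r0 Or]] := Omega_ball Ox.
suff le v w : dot v (hess F x *m w) <= dot w (hess F x *m v).
  apply/matrixP => i j; rewrite [LHS]mxE.
  have entry k l : hess F x k l = dot (delta_mx k 0) (hess F x *m delta_mx l 0).
    by rewrite dot_delta -colE [RHS]mxE.
  by rewrite !entry; apply/eqP; rewrite eq_le !le.
rewrite leNgt; apply/negP => lt.
pose D := dot v (hess F x *m w) - dot w (hess F x *m v).
have D0 : 0 < D by rewrite subr_gt0.
have L0 := LH_gt0 FA; set K := enorm v + enorm w.
have K0 : 0 <= K by rewrite addr_ge0 ?enorm_ge0.
pose C := LH * K ^+ 3; have C0 : 0 <= C by rewrite mulr_ge0 ?exprn_ge0 // ltW.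
pose t := Num.min (r / (K + 1) / 2) (D / (C + 1) / 4).
have K1 : 0 < K + 1 by lra.
have C1 : 0 < C + 1 by lra.
have t0 : 0 < t by rewrite lt_min !divr_gt0.
have tK : t * K < r.
  have : t <= r / (K + 1) / 2 by rewrite ge_min lexx.
  rewrite ler_pdivlMr // ler_pdivlMr //; nra.
have tC : t * (C + 1) * 4 <= D.
  have : t <= D / (C + 1) / 4 by rewrite ge_min lexx orbT.
  by rewrite ler_pdivlMr // ler_pdivlMr // mulrAC.
have h1 := @second_difference x v w r t t0 tK Or.
have := @second_difference x w v r t t0.
rewrite [enorm w + _]addrC => /(_ tK Or) h2.
move: h1 h2; rewrite !ler_norml -/K -/C => /andP[h1 _] /andP[_ h2].
have e : x + t *: v + t *: w = x + t *: w + t *: v by rewrite addrAC.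
rewrite e in h2.
have : t ^+ 2 * D <= 2 * (C * t ^+ 3).
  move: h1 h2; rewrite /D; set f1 := F (x + t *: w + t *: v); lra.
have -> : 2 * (C * t ^+ 3) = t ^+ 2 * (2 * C * t) by ring.
rewrite ler_pM2l ?exprn_gt0 // => h; have := mulr_ge0 C0 (ltW t0); lra.
Qed.

End SecondOrderModel.

Lemma geometric_lt (R : realType) (theta c : R) :
  0 < theta < 1 -> 0 < c -> exists j, theta ^+ j < c.
Proof.
move=> /andP[t0 t1] c0.
have t1' : `|theta| < 1 by rewrite gtr0_norm.
have /cvgr0Pnorm_lt/(_ c c0)[N _ h] := cvg_geometric 1 t1'.
exists N; have := h N (leqnn N); rewrite /= mul1r; exact: le_lt_trans (ler_norm _).
Qed.

Lemma mul_sgn (R : realType) (s : R) : sgn s * s = `|s|.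
Proof.
rewrite /sgn; case: ifPn => [s0|]; first by rewrite mul1r ger0_norm.
by rewrite -ltNge => s0; rewrite mulN1r ltr0_norm.
Qed.

Lemma normr_sgn (R : realType) (s : R) : `|sgn s| = 1.
Proof. by rewrite /sgn; case: ifP => _; rewrite ?normrN normr1. Qed.

Section Descent.
Variables (R : realType) (n : nat) (F : 'cV[R]_n -> R) (u0 : 'cV[R]_n).
Variables (Omega : set 'cV[R]_n) (LH Flow Ug UH : R).
Hypothesis FA : ncg_assumptions F u0 Omega LH Flow Ug UH.
Implicit Types (x d e v w : 'cV[R]_n).

Lemma level_complement_ball y : F u0 < F y ->
  exists r : R, 0 < r /\ forall d, enorm d < r -> F u0 < F (y + d).
Proof.
move=> yL.
have cl : closed [set x | F x <= F u0].
  apply: compact_closed (level_compact FA); exact: norm_hausdorff.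
have /nbhs_ballP[r /= r0 rO] : nbhs y (~` [set x | F x <= F u0]).
  by apply: open_nbhs_nbhs; split; [exact: closed_openC|apply/negP; rewrite -ltNge].
exists r; split=> // d dr; rewrite ltNge; apply/negP; apply: rO.
split=> // i j; rewrite (ord1 j) /ball /= mxE opprD addrA subrr sub0r normrN.
exact: le_lt_trans (normr_coord_le d i) dr.
Qed.

Lemma line_stays_in_Omega x d (A : R) : F x <= F u0 -> 0 < A ->
  (forall a, 0 < a <= A -> Omega (x + a *: d) -> F (x + a *: d) <= F u0) ->
  Omega (x + A *: d).
Proof.
move=> xL A0 stay; apply: contrapT => nOA.
have Ox : Omega x by exact: (level_sub_Omega FA).
pose S := [set a : R | 0 <= a <= A /\ Omega (x + a *: d)].
have S0 : S 0 by split; rewrite ?lexx ?ltW // scale0r addr0.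
have ubS : ubound S A by move=> a [/andP[]].
have hS : has_sup S by split; [exists 0|exists A].
pose T := sup S.
have T0 : 0 <= T by exact: ub_le_sup (hS.2) _ S0.
have TA : T <= A by apply: ge_sup => //; exists 0.
have nd : 0 < enorm d + 1 by rewrite ltr_wpDl ?enorm_ge0.
have small (c r : R) : 0 < r -> `|c| <= r / (enorm d + 1) / 2 -> enorm (c *: d) < r.
  move=> r0; rewrite enormZ ler_pdivlMr // ler_pdivlMr // => h.
  by have := enorm_ge0 d; have := normr_ge0 c; nra.
have inS (a b : R) : 0 <= a <= b -> S b -> S a.
  move=> /andP[a0 ab] [/andP[b0 bA] Ob]; split; first by rewrite a0 (le_trans ab).
  by apply: (Omega_segment FA Ox Ob); rewrite a0.
have TL : F (x + T *: d) <= F u0.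
  have [->|T1] := eqVneq T 0; first by rewrite scale0r addr0.
  have {}T1 : 0 < T by rewrite lt_def T1.
  rewrite leNgt; apply/negP => /level_complement_ball[r [r0 hr]].
  pose del := Num.min T (r / (enorm d + 1) / 2).
  have del0 : 0 < del by rewrite lt_min T1 !divr_gt0.
  have delT : del <= T by rewrite ge_min lexx.
  have [b Sb ltb] := sup_adherent (del0) hS.
  have bT : b <= T by apply: ub_le_sup Sb; case: hS.
  have b0 : 0 < b by rewrite -/T in ltb; lra.
  have e : x + T *: d + (b - T) *: d = x + b *: d.
    by rewrite -addrA -scalerDl addrCA subrr addr0.
  have := hr ((b - T) *: d); rewrite e.
  have [/andP[_ bA] Ob] := Sb.
  have := stay b; rewrite b0 bA => /(_ isT Ob) le1 /(_ _) lt1.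
  suff : F u0 < F (x + b *: d) by rewrite ltNge le1.
  apply: lt1; apply: small => //.
  rewrite ler0_norm; last by lra.
  by apply: (@le_trans _ _ del); [rewrite -/T in ltb; lra|rewrite ge_min lexx orbT].
have OT : Omega (x + T *: d) by exact: (level_sub_Omega FA).
have [r [r0 hr]] := Omega_ball FA OT.
have TA' : T < A by rewrite lt_neqAle TA andbT; apply/eqP => e; rewrite e in OT.
pose del := Num.min (A - T) (r / (enorm d + 1) / 2).
have del0 : 0 < del by rewrite lt_min subr_gt0 TA' !divr_gt0.
have : S (T + del).
  split.
    have : del <= A - T by rewrite ge_min lexx.
    by move=> ?; apply/andP; split; lra.
  rewrite scalerDl addrA; apply: hr; apply: small => //.
  by rewrite gtr0_norm // ge_min lexx orbT.
move=> /(ub_le_sup hS.2); rewrite -/T; lra.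
Qed.

Variables (eps_H theta zeta eta : R).
Hypotheses (eps0 : 0 < eps_H) (theta01 : 0 < theta < 1) (eta01 : 0 < eta < 1).

Lemma sol_success x d (a : R) : F x <= F u0 -> d != 0 ->
  dot d (grad F x) = - dot d (cg_Hbar (hess F x) eps_H *m d) ->
  eps_H * dot d d <= dot d (cg_Hbar (hess F x) eps_H *m d) ->
  0 < a <= 1 -> LH * a ^+ 2 * enorm d < Num.min (6 * (1 - eta)) 2 * eps_H ->
  F (x + a *: d) < F x - eta * eps_H * a ^+ 2 * enorm d ^+ 2.
Proof.
move=> xL dn0 gd curv /andP[a0 a1] small.
have e0 := eps0; have /andP[eta0 eta1] := eta01; have L0 := LH_gt0 FA.
have Ox : Omega x by exact: (level_sub_Omega FA).
have N0 : 0 < enorm d by rewrite enorm_gt0.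
have dec b : 0 < b <= a -> Omega (x + b *: d) ->
    F (x + b *: d) < F x - eta * eps_H * b ^+ 2 * enorm d ^+ 2.
  move=> /andP[b0 ba] Ob.
  apply: le_lt_trans (F_expansion FA (ltW b0) Ox Ob) _.
  move: gd curv; rewrite (dotC _ d) cg_curvE -sqr_enorm => ->.
  set q := dot d (hess F x *m d); move: (enorm d) N0 small => N N0 small curv.
  set m := Num.min _ _ in small.
  have m2 : m <= 2 by rewrite ge_min lexx orbT.
  have sb : LH * b ^+ 2 * N < m * eps_H.
    apply: le_lt_trans small; rewrite ler_pM2r // ler_pM2l //.
    by rewrite lerXn2r ?nnegrE // ltW // (lt_le_trans b0).
  have h1 : 0 <= (b - b ^+ 2 / 2) * (q + 2 * eps_H * N ^+ 2 - eps_H * N ^+ 2).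
    by rewrite mulr_ge0 //; nra.
  have N2 : 0 < N ^+ 2 by rewrite exprn_gt0.
  have h2 : 0 < (m * eps_H - LH * b ^+ 2 * N) * (b * N ^+ 2).
    by rewrite mulr_gt0 ?subr_gt0 // mulr_gt0.
  have h3 : 0 <= (2 - m) * eps_H * b * N ^+ 2.
    by rewrite !mulr_ge0 ?subr_ge0 // ltW.
  have h4 : 0 <= (1 - eta) * b * (eps_H * b * N ^+ 2).
    by rewrite !mulr_ge0 ?subr_ge0 // ltW.
  have h5 : 0 <= (1 - b) * (eps_H * b * N ^+ 2).
    by rewrite !mulr_ge0 ?subr_ge0 ?(le_trans ba) // ltW.
  have h6 : 0 < eps_H * b * N ^+ 2 by rewrite !mulr_gt0.
  lra.
apply: (dec a); first by rewrite a0 lexx.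
apply: line_stays_in_Omega => // b ba Ob; apply: le_trans xL.
apply/ltW/(lt_le_trans (dec b ba Ob)); rewrite gerBl.
by rewrite !mulr_ge0 ?exprn_ge0 ?enorm_ge0 ?ltW //; case/andP: ba.
Qed.

Lemma nc_success x d (a : R) : F x <= F u0 -> d != 0 ->
  dot d (grad F x) <= 0 -> dot d (hess F x *m d) = - enorm d ^+ 3 ->
  0 < a -> LH * a < Num.min (3 * (1 - eta)) 1 ->
  F (x + a *: d) < F x - eta * a ^+ 2 * enorm d ^+ 3 / 2.
Proof.
move=> xL dn0 gd curv a0 small.
have /andP[eta0 eta1] := eta01; have L0 := LH_gt0 FA.
have Ox : Omega x by exact: (level_sub_Omega FA).
have N0 : 0 < enorm d by rewrite enorm_gt0.
have dec b : 0 < b <= a -> Omega (x + b *: d) ->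
    F (x + b *: d) < F x - eta * b ^+ 2 * enorm d ^+ 3 / 2.
  move=> /andP[b0 ba] Ob.
  apply: le_lt_trans (F_expansion FA (ltW b0) Ox Ob) _.
  rewrite (dotC _ d) curv; set g := dot d _ in gd *.
  have N3 : 0 < enorm d ^+ 3 by rewrite exprn_gt0.
  move: (enorm d ^+ 3) N3 => N3 N30.
  set m := Num.min _ _ in small.
  have m3 : m <= 3 * (1 - eta) by rewrite ge_min lexx.
  have sb : LH * b < 3 * (1 - eta) by nra.
  have h1 : 0 < (3 * (1 - eta) - LH * b) * (b ^+ 2 * N3).
    by rewrite !mulr_gt0 ?subr_gt0 // exprn_gt0.
  have h2 : b * g <= 0 by rewrite pmulr_rle0.
  lra.
apply: (dec a); first by rewrite a0 lexx.
apply: line_stays_in_Omega => // b ba Ob; apply: le_trans xL.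
apply/ltW/(lt_le_trans (dec b ba Ob)); rewrite gerBl.
by rewrite divr_ge0 // !mulr_ge0 ?exprn_ge0 ?enorm_ge0 ?ltW //; case/andP: ba.
Qed.

Lemma exists_line_search x ty d :
  (exists j, sufficient_decrease F eps_H theta eta x ty d j) ->
  exists j, line_search F eps_H theta eta x ty d j.
Proof.
move=> [j sj]; have ex : exists j, `[< sufficient_decrease F eps_H theta eta x ty d j >].
  by exists j; apply/asboolP.
case: (ex_minnP ex) => i /asboolP si mini; exists i; split=> // l li sl.
by have := mini l (asboolT sl); rewrite leqNgt li.
Qed.

Definition sol_direction x d :=
  [/\ d != 0,
      dot d (grad F x) = - dot d (cg_Hbar (hess F x) eps_H *m d),
      eps_H * dot d d <= dot d (cg_Hbar (hess F x) eps_H *m d) &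
      enorm (cg_Hbar (hess F x) eps_H *m d + grad F x)
        <= zeta * eps_H / 2 * enorm d].

Definition nc_direction x d :=
  [/\ eps_H / 2 <= enorm d, dot d (grad F x) <= 0 &
      dot d (hess F x *m d) = - enorm d ^+ 3].

Lemma scaled_nc_direction x v (e : R) : eps_H / 2 <= e ->
  v != 0 -> dot v (hess F x *m v) <= - e * dot v v ->
  nc_direction x ((- sgn (dot v (grad F x)) *
     (`|dot v (hess F x *m v)| / enorm v ^+ 3)) *: v).
Proof.
move=> e_ge v0 curv; have e0 := eps0.
have ee : 0 < e by lra.
have N0 : 0 < enorm v by rewrite enorm_gt0.
have vv : 0 < dot v v by rewrite dot_gt0.
have q0 : dot v (hess F x *m v) < 0 by nra.
have nq : `|dot v (hess F x *m v)| = - dot v (hess F x *m v) by rewrite ltr0_norm.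
rewrite /nc_direction enormZ normrM normrN normr_sgn mul1r.
rewrite ger0_norm; last by rewrite divr_ge0 // exprn_ge0 // ltW.
have N1 : enorm v != 0 by rewrite gt_eqF.
split.
- apply: le_trans e_ge _; rewrite nq.
  rewrite (_ : _ * _ = - dot v (hess F x *m v) / enorm v ^+ 2); last by field.
  by rewrite ler_pdivlMr ?exprn_gt0 // sqr_enorm; lra.
- rewrite dotZl mulrAC mulNr mul_sgn mulNr oppr_le0.
  by rewrite mulr_ge0 // divr_ge0 // exprn_ge0 // ltW.
rewrite -scalemxAr !dotE nq.
set q := dot v (hess F x *m v); set s := sgn _.
have s2 : s * s = 1 by rewrite -expr2 -real_normK ?num_real // normr_sgn expr1n.
have -> : - s * (- q / enorm v ^+ 3) * (- s * (- q / enorm v ^+ 3) * q) =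
    (s * s) * ((- q / enorm v ^+ 3) * ((- q / enorm v ^+ 3) * q)) by ring.
by rewrite s2; field.
Qed.

Lemma line_search_exists x ty d : F x <= F u0 ->
  (match ty with SOL => sol_direction x d | NC => nc_direction x d end) ->
  exists j, line_search F eps_H theta eta x ty d j.
Proof.
move=> xL dir; apply: exists_line_search.
have e0 := eps0; have /andP[eta0 eta1] := eta01; have /andP[t0 t1] := theta01.
have L0 := LH_gt0 FA.
case: ty dir => [[d0 gd curv _]|[nd gd curv]].
  have N0 : 0 < enorm d by rewrite enorm_gt0.
  have m0 : 0 < Num.min (6 * (1 - eta)) 2 by rewrite lt_min; apply/andP; split; lra.
  have [j hj] := geometric_lt theta01 (divr_gt0 (mulr_gt0 m0 e0) (mulr_gt0 L0 N0)).
  exists j; rewrite /sufficient_decrease mulnC exprM; apply: sol_success => //.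
    by rewrite exprn_gt0 // exprn_ile1 // ltW.
  rewrite ltr_pdivlMr ?mulr_gt0 // in hj; apply: le_lt_trans hj.
  have -> : LH * (theta ^+ j) ^+ 2 * enorm d =
      theta ^+ j * (theta ^+ j * (LH * enorm d)) by ring.
  apply: ler_piMl; last by rewrite exprn_ile1 // ltW.
  by rewrite !mulr_ge0 ?exprn_ge0 // ltW.
have N0 : 0 < enorm d by lra.
have d0 : d != 0 by rewrite -enorm_gt0.
have m0 : 0 < Num.min (3 * (1 - eta)) 1 by rewrite lt_min; apply/andP; split; lra.
have [j hj] := geometric_lt theta01 (divr_gt0 m0 L0).
exists j; rewrite /sufficient_decrease mulnC exprM; apply: nc_success => //.
  by rewrite exprn_gt0.
by move: hj; rewrite ltr_pdivlMr // mulrC.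
Qed.

End Descent.

Lemma oracle_answers (R : realType) (n : nat) (H : 'M[R]_n) (eps delta : R)
    (b : 'cV[R]_n) : (0 < n)%N -> 0 < delta < 1 ->
  (exists k, oracle_certifies H eps delta b k) \/
  (exists v k, oracle_returns H eps delta b v k).
Proof.
move=> n0 /andP[d0 d1].
have perf1 : lanczos_performed H eps delta b 1.
  split=> //; rewrite /oracle_N le_min lez_nat n0 /= lerDl.
  rewrite ceil_ge0 // (lt_le_trans (ltrN10 _)) // mulr_ge0 ?sqrtr_ge0 // divr_ge0 //.
  apply: ln_ge0; rewrite ler_pdivlMr ?exprn_gt0 // mul1r.
  have : delta ^+ 2 <= 1 by rewrite expr_le1 // ltW.
  have : 1 <= n%:R :> R by rewrite ler1n.
  lra.
have perf_le i k : (0 < i <= k)%N -> lanczos_performed H eps delta b k ->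
    lanczos_performed H eps delta b i.
  move=> /andP[i0 ik] [_ kN reg]; split=> //.
    by apply: le_trans kN; rewrite lez_nat.
  by move=> j ji; apply: reg; exact: leq_trans ik.
pose succ k := `[< lanczos_performed H eps delta b k /\
                   exists v, lanczos_success H eps b k v >].
have [ex|nex] := pselect (exists k, succ k).
  right; case: (ex_minnP ex) => k /asboolP[pk [v sv]] mink.
  exists v, k; split=> // i /andP[i0 ik] si.
  have : succ i by apply/asboolP; split=> //; apply: perf_le pk; rewrite i0 ltnW.
  by move=> /mink; rewrite leqNgt ik.
left; pose perf k := `[< lanczos_performed H eps delta b k >].
have exp : exists k, perf k by exists 1%N; apply/asboolP.
have ubp k : perf k -> (k <= n)%N.
  by move=> /asboolP[_ + _]; rewrite /oracle_N le_min lez_nat => /andP[].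
case: (ex_maxnP exp ubp) => k /asboolP pk maxk.
exists k; split=> // [pk1|i /andP[i0 ik] si].
  by have := maxk k.+1 (asboolT pk1); rewrite ltnn.
apply: nex; exists i; apply/asboolP; split=> //.
by apply: perf_le pk; rewrite i0.
Qed.

Section NewtonCGStep.
Variables (R : realType) (n : nat) (F : 'cV[R]_n -> R) (u0 : 'cV[R]_n).
Variables (Omega : set 'cV[R]_n) (LH Flow Ug UH : R).
Hypothesis FA : ncg_assumptions F u0 Omega LH Flow Ug UH.
Variables (eps_g eps_H theta zeta eta delta : R).
Hypotheses (n0 : (0 < n)%N) (epsg01 : 0 < eps_g < 1) (epsH01 : 0 < eps_H < 1).
Hypotheses (theta01 : 0 < theta < 1) (zeta01 : 0 < zeta < 1).
Hypotheses (eta01 : 0 < eta < 1) (delta01 : 0 < delta < 1).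
Implicit Types (x d b : 'cV[R]_n).

Let eps0 : 0 < eps_H. Proof. by case/andP: epsH01. Qed.

Lemma level_hess_symmetric x : F x <= F u0 -> (hess F x)^T = hess F x.
Proof. by move=> xL; apply: (hess_symmetric FA); exact: (level_sub_Omega FA). Qed.

Lemma calls_capped_cg_grad x : calls_capped_cg F eps_g x -> grad F x != 0.
Proof.
rewrite /calls_capped_cg -enorm_gt0; apply: lt_trans; by case/andP: epsg01.
Qed.

Lemma ncg_direction_valid b x ty d m : F x <= F u0 ->
  ncg_direction F eps_g eps_H zeta delta b x ty d m ->
  match ty with
  | SOL => sol_direction F eps_H zeta x d /\ calls_capped_cg F eps_g x
  | NC => nc_direction F eps_H x d
  end.
Proof.
move=> xL; rewrite /ncg_direction; have symH := level_hess_symmetric xL.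
have e0 := eps0.
case: ifPn => [cg|_]; last first.
  move=> [v [k [[_ [_ nv curv] _] -> -> _]]].
  have v0 : v != 0 by rewrite -enorm_gt0 nv.
  have := @scaled_nc_direction _ _ F eps_H eps0 x v (eps_H / 2) (lexx _) v0.
  by rewrite -sqr_enorm nv !expr1n divr1 mulr1 -mulNr; exact.
have g0 := calls_capped_cg_grad cg.
move=> [v [J [+ -> _]]]; case: ty => run.
  by have := capped_cg_SOL symH eps0 zeta01 g0 run.
have curv := capped_cg_NC run.
have v0 : v != 0.
  by apply: contraTneq curv => ->; rewrite mulmx0 !dot0r mulr0 ltxx.
by apply: scaled_nc_direction (ltW curv) => //; lra.
Qed.

Lemma ncg_iteration_succeeds_level b x : F x <= F u0 ->
  ncg_iteration_succeeds F eps_g eps_H theta zeta eta delta b x.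
Proof.
move=> xL; have symH := level_hess_symmetric xL; split; last first.
  move=> ty d m dir; apply: (line_search_exists (zeta := zeta) FA) => //.
  by have := ncg_direction_valid xL dir; case: ty {dir} => [[]|].
have [cg|cg] := boolP (calls_capped_cg F eps_g x).
  right; have g0 := calls_capped_cg_grad cg.
  have [ty [v [J run]]] := capped_cg_terminates symH eps0 zeta01 g0.
  do 3!eexists; rewrite /ncg_direction cg; exists v, J; split; first exact: run.
    by [].
  by [].
have [[k cert]|[v [k ret]]] :=
  oracle_answers (hess F x) eps_H b n0 delta01.
  by left; exists k; split.
right; exists NC; do 2!eexists; rewrite /ncg_direction (negbTE cg).
by exists v, k; split.
Qed.

Local Notation csol := (c_sol theta zeta eta LH).
Local Notation cnc := (c_nc theta eta LH).
Local Notation rate := (eps_rate eps_g eps_H).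

Lemma c_nc_gt0 : 0 < cnc.
Proof.
have /andP[t0 t1] := theta01; have /andP[eta0 eta1] := eta01.
have L0 := LH_gt0 FA.
rewrite /c_nc mulr_gt0 ?divr_gt0 // lt_min ltr01 exprn_gt0 // divr_gt0 //.
by rewrite mulr_gt0 // lt_min ltr01 andbT; lra.
Qed.

Lemma c_sol_gt0 : 0 < csol.
Proof.
have /andP[t0 t1] := theta01; have /andP[eta0 eta1] := eta01.
have /andP[z0 z1] := zeta01.
have L0 := LH_gt0 FA.
rewrite /c_sol mulr_gt0 // lt_min !exprn_gt0 //.
  by rewrite divr_gt0 // mulr_gt0 // lt_min ltr0n andbT; lra.
by rewrite divr_gt0 // ltr_wpDr ?sqrtr_ge0 //; lra.
Qed.

Lemma rate_ge1 : 1 <= rate.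
Proof.
have /andP[e0 e1] := epsH01.
rewrite /eps_rate le_max; apply/orP; right.
by rewrite invf_ge1 ?exprn_gt0 // exprn_ile1 // ltW.
Qed.

Lemma rateV_le_cube : rate^-1 <= eps_H ^+ 3.
Proof.
have r1 := rate_ge1; have e0 := eps0.
rewrite -[leRHS]invrK lef_pV2 ?posrE ?invr_gt0 ?exprn_gt0 //; last by lra.
by rewrite /eps_rate le_max lexx orbT.
Qed.

Lemma rateV_le_grad : rate^-1 <= eps_g ^+ 2 / eps_H.
Proof.
have r1 := rate_ge1; have e0 := eps0; have /andP[g0 _] := epsg01.
rewrite -[leRHS]invrK lef_pV2 ?posrE ?invr_gt0 ?divr_gt0 ?exprn_gt0 //; last by lra.
by rewrite invf_div mulrC /eps_rate le_max lexx.
Qed.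

Lemma nc_step_decrease x d j : F x <= F u0 -> nc_direction F eps_H x d ->
  line_search F eps_H theta eta x NC d j ->
  F (x + theta ^+ j *: d) <= F x - cnc * eps_H ^+ 3.
Proof.
move=> xL [nd gd curv] [suff_j nsuff].
have e0 := eps0; have /andP[t0 t1] := theta01; have /andP[eta0 eta1] := eta01.
have L0 := LH_gt0 FA.
have N0 : 0 < enorm d by lra.
have d0 : d != 0 by rewrite -enorm_gt0.
apply: le_trans (ltW suff_j) _; rewrite lerD2l lerN2.
set m := Num.min (3 * (1 - eta)) 1.
have m0 : 0 < m by rewrite lt_min; apply/andP; split; lra.
set c := Num.min 1 ((m * theta / LH) ^+ 2).
have tj : c <= theta ^+ (2 * j).
  case: j suff_j nsuff => [_ _|j _ nsuff]; first by rewrite muln0 expr0 ge_min lexx.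
  have : ~ (LH * theta ^+ j < m).
    move=> h; apply: (nsuff j (ltnSn j)).
    rewrite /sufficient_decrease mulnC exprM.
    by apply: (nc_success FA) => //; rewrite exprn_gt0.
  move=> /negP; rewrite -leNgt => h.
  rewrite ge_min; apply/orP; right; rewrite mulnC exprM lerXn2r ?nnegrE //.
  - by rewrite divr_ge0 ?mulr_ge0 // ltW.
  - by rewrite exprn_ge0 // ltW.
  rewrite ler_pdivrMr // exprSr mulrAC ler_pM2r // mulrC //.
have c0 : 0 < c.
  by rewrite lt_min ltr01 exprn_gt0 // divr_gt0 // mulr_gt0.
rewrite /c_nc -/m -/c.
have N3 : eps_H ^+ 3 / 8 <= enorm d ^+ 3.
  have -> : eps_H ^+ 3 / 8 = (eps_H / 2) ^+ 3 by field.
  by rewrite lerXn2r ?nnegrE ?enorm_ge0 // divr_ge0 // ltW.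
have h : c * (eps_H ^+ 3 / 8) <= theta ^+ (2 * j) * enorm d ^+ 3.
  by apply: ler_pM => //; rewrite ?(ltW c0) // divr_ge0 // exprn_ge0 // ltW.
have := ler_wpM2l (ltW eta0) h; lra.
Qed.

Lemma sol_step_decrease x d j : F x <= F u0 -> sol_direction F eps_H zeta x d ->
  line_search F eps_H theta eta x SOL d j ->
  F (x + theta ^+ j *: d) <= F x /\
  (calls_capped_cg F eps_g (x + theta ^+ j *: d) ->
   F (x + theta ^+ j *: d) <= F x - csol / rate).
Proof.
move=> xL [d0 gd curv resid] [suff_j nsuff].
have e0 := eps0; have /andP[t0 t1] := theta01; have /andP[eta0 eta1] := eta01.
have /andP[g0 g1] := epsg01; have /andP[z0 z1] := zeta01.
have L0 := LH_gt0 FA.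
have N0 : 0 < enorm d by rewrite enorm_gt0.
have dec0 : F (x + theta ^+ j *: d) <= F x.
  apply: le_trans (ltW suff_j) _; rewrite gerBl.
  by rewrite !mulr_ge0 ?exprn_ge0 ?enorm_ge0 // ltW.
split=> // cg'.
apply: le_trans (ltW suff_j) _; rewrite lerD2l lerN2.
have ri0 : 0 <= rate^-1 by rewrite invr_ge0; have := rate_ge1; lra.
set m := Num.min (6 * (1 - eta)) 2.
have m0 : 0 < m by rewrite lt_min; apply/andP; split; lra.
case: j suff_j nsuff dec0 cg' => [_ _|j _ nsuff _ _].
  rewrite expr0 scale1r => dec0 cg'; rewrite ?muln0 ?expr0 mulr1.
  set c0 := 4 / (4 + zeta + Num.sqrt ((4 + zeta) ^+ 2 + 8 * LH)).
  set S := Num.sqrt _ in c0.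
  have S2 : S ^+ 2 = (4 + zeta) ^+ 2 + 8 * LH.
    by rewrite sqr_sqrtr // addr_ge0 ?sqr_ge0 // mulr_ge0 // ltW.
  have S0 : 0 <= S by exact: sqrtr_ge0.
  have den0 : 0 < 4 + zeta + S by lra.
  have c00 : 0 < c0 by rewrite divr_gt0.
  have c0E : LH / 2 * c0 ^+ 2 + (4 + zeta) / 2 * c0 = 1.
    have -> : LH = (S ^+ 2 - (4 + zeta) ^+ 2) / 8 by rewrite S2; field.
    by rewrite /c0; field; rewrite gt_eqF.
  have Ox : Omega x by exact: (level_sub_Omega FA).
  have Ox' : Omega (x + 1 *: d).
    by rewrite scale1r; apply: (level_sub_Omega FA); exact: le_trans xL.
  have := grad_expansion FA ler01 Ox Ox'; rewrite !scale1r expr1n mulr1 => gexp.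
  have big : eps_g < LH / 2 * enorm d ^+ 2 + (4 + zeta) / 2 * (eps_H * enorm d).
    apply: lt_le_trans cg' _.
    set E := grad F (x + d) - _ - _ in gexp.
    set r := _ + grad F x in resid.
    have -> : grad F (x + d) = E + (r + (- (2 * eps_H)) *: d).
      rewrite /E /r /cg_Hbar mulmxDl mul_scalar_mx.
      by apply/matrixP => k l; rewrite !mxE; ring.
    apply: le_trans (enormD _ _) _.
    have := enormD r ((- (2 * eps_H)) *: d).
    rewrite enormZ normrN ger0_norm ?mulr_ge0 ?(ltW e0) //; lra.
  have dlow D : 0 <= D -> LH / 2 * D ^+ 2 + (4 + zeta) / 2 * (eps_H * D) <= eps_g ->
      D <= enorm d.
    move=> D0 h; rewrite leNgt; apply/negP => lt.
    have : enorm d ^+ 2 <= D ^+ 2 by rewrite lerXn2r ?nnegrE // ltW.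
    have : 0 < LH / 2 by rewrite divr_gt0.
    have : eps_H * enorm d <= eps_H * D by rewrite ler_pM2l // ltW.
    nra.
  have N2 : c0 ^+ 2 / rate <= eps_H * enorm d ^+ 2.
    have [le|lt] := leP (eps_g / eps_H) eps_H.
      apply: (@le_trans _ _ (c0 ^+ 2 * (eps_g ^+ 2 / eps_H))).
        by rewrite ler_wpM2l ?sqr_ge0 // rateV_le_grad.
      have -> : c0 ^+ 2 * (eps_g ^+ 2 / eps_H) = eps_H * (c0 * (eps_g / eps_H)) ^+ 2.
        have fE (c g e : R) : e != 0 -> c ^+ 2 * (g ^+ 2 / e) = e * (c * (g / e)) ^+ 2.
          by move=> en0; field.
        by apply: fE; rewrite gt_eqF.
      rewrite ler_pM2l // lerXn2r ?nnegrE ?enorm_ge0 //.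
        by rewrite mulr_ge0 ?divr_ge0 // ltW.
      apply: dlow; first by rewrite mulr_ge0 ?divr_ge0 // ltW.
      rewrite ler_pdivrMr // in le.
      have -> : eps_H * (c0 * (eps_g / eps_H)) = c0 * eps_g.
        by field; rewrite gt_eqF.
      have : (c0 * (eps_g / eps_H)) ^+ 2 <= c0 ^+ 2 * eps_g.
        rewrite exprMn ler_pM2l ?exprn_gt0 // expr_div_n ler_pdivrMr ?exprn_gt0 //.
        by rewrite expr2 ler_pM2l.
      move=> h; have := ler_wpM2l (ltW (divr_gt0 L0 (ltr0n R 2))) h.
      have := congr1 (fun y => y * eps_g) c0E; rewrite /= mul1r; lra.
    apply: (@le_trans _ _ (c0 ^+ 2 * eps_H ^+ 3)).
      by rewrite ler_wpM2l ?sqr_ge0 // rateV_le_cube.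
    have -> : c0 ^+ 2 * eps_H ^+ 3 = eps_H * (c0 * eps_H) ^+ 2 by ring.
    rewrite ler_pM2l // lerXn2r ?nnegrE ?enorm_ge0 //.
      by rewrite mulr_ge0 // ltW.
    apply: dlow; first by rewrite mulr_ge0 // ltW.
    rewrite ltr_pdivlMr // in lt; apply/ltW; apply: le_lt_trans lt.
    have := congr1 (fun y => y * (eps_H * eps_H)) c0E; rewrite /= mul1r; lra.
  apply: (@le_trans _ _ (eta * (c0 ^+ 2 / rate))).
    rewrite /c_sol -mulrA ler_pM2l // ler_wpM2r //.
    by rewrite -/S -/c0 ge_min lexx.
  by rewrite -mulrA ler_pM2l.
have fail i : (i < j.+1)%N -> m * eps_H <= LH * theta ^+ (2 * i) * enorm d.
  move=> ij; rewrite leNgt; apply/negP => h; apply: (nsuff i ij).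
  rewrite /sufficient_decrease mulnC exprM.
  apply: (sol_success FA) => //; last by rewrite -exprM mulnC.
  by rewrite exprn_gt0 // exprn_ile1 // ltW.
have f0 := fail 0%N (ltn0Sn j); rewrite muln0 expr0 mulr1 in f0.
have fj := fail j (ltnSn j).
have t2 : theta ^+ (2 * j.+1) = theta ^+ 2 * theta ^+ (2 * j).
  by rewrite mulnS exprD.
rewrite t2; move: (theta ^+ (2 * j)) fj => tj fj.
have prod : (m * eps_H) * (m * eps_H) <= (LH * tj * enorm d) * (LH * enorm d).
  by apply: ler_pM => //; rewrite mulr_ge0 // ltW.
apply: (@le_trans _ _ (eta * (m * theta / LH) ^+ 2 * eps_H ^+ 3)).
  apply: ler_pM => //; first exact: (ltW c_sol_gt0).
    by rewrite /c_sol ler_pM2l // ge_min lexx orbT.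
  exact: rateV_le_cube.
rewrite -subr_ge0 (_ : _ - _ = eta * eps_H * theta ^+ 2 / LH ^+ 2 *
   ((LH * tj * enorm d) * (LH * enorm d) - (m * eps_H) * (m * eps_H))).
  by rewrite mulr_ge0 ?subr_ge0 // !mulr_ge0 ?invr_ge0 ?sqr_ge0 // ltW.
by field; rewrite gt_eqF.
Qed.

Lemma ncg_step_decrease b x x' m : F x <= F u0 ->
  ncg_step F eps_g eps_H theta zeta eta delta b x x' m ->
  [/\ F x' <= F x,
      calls_oracle F eps_g x -> F x' <= F x - cnc * eps_H ^+ 3 &
      calls_capped_cg F eps_g x' -> F x' <= F x - Num.min csol cnc / rate].
Proof.
move=> xL [ty [d [j [dir ls ->]]]].
have := ncg_direction_valid xL dir.
have c0 := c_nc_gt0; have e0 := eps0.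
have ri0 : 0 < rate^-1 by rewrite invr_gt0; have := rate_ge1; lra.
case: ty dir ls => _ ls.
  move=> [sd cg]; have [h1 h2] := sol_step_decrease xL sd ls.
  split=> // [|cg']; first by rewrite /calls_oracle cg.
  apply: le_trans (h2 cg') _; rewrite lerD2l lerN2 ler_pM2r //.
  by rewrite ge_min lexx.
move=> nd; have h := nc_step_decrease xL nd ls; split=> //.
  by apply: le_trans h _; rewrite gerBl mulr_ge0 ?exprn_ge0 // ltW.
move=> _; apply: le_trans h _; rewrite lerD2l lerN2.
apply: (@le_trans _ _ (cnc / rate)); first by rewrite ler_pM2r // ge_min lexx orbT.
by rewrite ler_pM2l // rateV_le_cube.
Qed.

End NewtonCGStep.

(** * Counting iterations and products *)

Lemma decrease_count (R : realType) (a : nat -> R) (c : R) (p : pred nat) k :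
  (forall t, (t < k)%N -> a t.+1 <= a t) ->
  (forall t, (t < k)%N -> p t -> a t.+1 <= a t - c) ->
  c * (\sum_(0 <= t < k) p t)%N%:R <= a 0%N - a k.
Proof.
elim: k => [|k IH] mono dec; first by rewrite big_geq // mulr0 subrr.
have {}IH : c * (\sum_(0 <= t < k) p t)%N%:R <= a 0%N - a k.
  by apply: IH => t tk; [apply: mono|apply: dec]; exact: ltnW.
rewrite big_nat_recr //= natrD mulrDr.
have := mono k (ltnSn k); have := dec k (ltnSn k).
by case: (p k) => /= [/(_ isT)|_]; rewrite ?mulr1 ?mulr0; lra.
Qed.

Lemma count_le_ceil (R : realType) (c G : R) (N : nat) : 0 < c ->
  c * N%:R <= G -> N%:Z <= Num.ceil (G / c).
Proof.
move=> c0 h; rewrite -(ler_int R); apply: le_trans (ceil_ge _).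
by rewrite ler_pdivlMr // mulrC.
Qed.

Section NewtonCGComplexity.
Variables (R : realType) (n : nat) (F : 'cV[R]_n -> R) (u0 : 'cV[R]_n).
Variables (Omega : set 'cV[R]_n) (LH Flow Ug UH : R).
Hypothesis FA : ncg_assumptions F u0 Omega LH Flow Ug UH.
Variables (eps_g eps_H theta zeta eta delta : R).
Hypotheses (n0 : (0 < n)%N) (epsg01 : 0 < eps_g < 1) (epsH01 : 0 < eps_H < 1).
Hypotheses (theta01 : 0 < theta < 1) (zeta01 : 0 < zeta < 1).
Hypotheses (eta01 : 0 < eta < 1) (delta01 : 0 < delta < 1).
Variables (b x : nat -> 'cV[R]_n) (m : nat -> nat) (k : nat).
Hypothesis run : ncg_reaches F u0 eps_g eps_H theta zeta eta delta b x m k.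

Local Notation csol := (c_sol theta zeta eta LH).
Local Notation cnc := (c_nc theta eta LH).
Local Notation rate := (eps_rate eps_g eps_H).
Local Notation gap := (F u0 - Flow).
Local Notation cg t := (calls_capped_cg F eps_g (x t)).
Local Notation oracle t := (calls_oracle F eps_g (x t)).

Lemma ncg_reaches_level t : (t <= k)%N -> F (x t) <= F u0.
Proof.
have [x0 steps] := run; elim: t => [_|t IH tk]; first by rewrite x0.
have xL := IH (ltnW tk).
have [h _ _] := ncg_step_decrease FA epsg01 epsH01 theta01 zeta01 eta01 xL (steps t tk).
exact: le_trans xL.
Qed.

Let decrease t : (t < k)%N -> [/\ F (x t.+1) <= F (x t),
   oracle t -> F (x t.+1) <= F (x t) - cnc * eps_H ^+ 3 &
   cg t.+1 -> F (x t.+1) <= F (x t) - Num.min csol cnc / rate].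
Proof.
move=> tk; have [_ steps] := run.
exact: (ncg_step_decrease FA) (ncg_reaches_level (ltnW tk)) (steps t tk).
Qed.

Let total_decrease : F (x 0%N) - F (x k) <= gap.
Proof.
have [-> _] := run; rewrite lerD2l lerN2; apply: (F_ge_Flow FA).
exact: ncg_reaches_level.
Qed.

Lemma completed_oracle_calls_le :
  (\sum_(0 <= t < k) oracle t)%N%:Z <= Num.ceil (gap / cnc * eps_H ^- 3).
Proof.
have /andP[e0 _] := epsH01; have c0 := c_nc_gt0 FA theta01 eta01.
rewrite -mulrA -invfM; apply: count_le_ceil; first by rewrite mulr_gt0 ?exprn_gt0.
apply: le_trans total_decrease; apply: (decrease_count (a := fun t => F (x t))).
  by move=> t /decrease[].
by move=> t /decrease[].
Qed.

Lemma oracle_calls_le :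
  (\sum_(0 <= t < k.+1) oracle t)%N%:Z <= T2 theta eta LH gap eps_H.
Proof.
rewrite big_nat_recr //= PoszD /T2 lerD ?completed_oracle_calls_le //.
by case: (oracle k).
Qed.

Lemma capped_cg_calls_le :
  (\sum_(0 <= t < k.+1) cg t)%N%:Z <= T1 theta zeta eta LH gap eps_g eps_H.
Proof.
have c1 := c_nc_gt0 FA theta01 eta01.
have c2 := c_sol_gt0 FA theta01 zeta01 eta01.
have r1 := rate_ge1 eps_g epsH01.
have consecutive : (\sum_(0 <= t < k) (cg t && cg t.+1))%N%:Z <=
    Num.ceil (gap / Num.min csol cnc * rate).
  rewrite -mulrA -[rate]invrK -invfM; apply: count_le_ceil.
    by rewrite divr_gt0 ?lt_min ?c1 ?c2 // (lt_le_trans ltr01).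
  apply: le_trans total_decrease.
  apply: (decrease_count (a := fun t => F (x t)) (p := fun t => cg t && cg t.+1)).
    by move=> t /decrease[].
  by move=> t /decrease[_ _ h] /andP[_ /h].
have split_sum : (\sum_(0 <= t < k.+1) cg t <=
    \sum_(0 <= t < k) (cg t && cg t.+1) + \sum_(0 <= t < k) oracle t + 1)%N.
  have -> : (\sum_(0 <= t < k.+1) cg t =
      \sum_(0 <= t < k) (cg t && cg t.+1) + \sum_(0 <= t < k) (cg t && oracle t.+1)
      + cg k)%N.
    rewrite big_nat_recr //= -big_split /=; congr (_ + _)%N.
    apply: eq_bigr => t _; rewrite /calls_oracle.
    by case: (cg t); case: (cg t.+1).
  rewrite -!addnA leq_add2l.
  have h : (\sum_(0 <= t < k) (cg t && oracle t.+1) <=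
      \sum_(0 <= t < k.+1) oracle t)%N.
    rewrite big_nat_recl //; apply: leq_trans (leq_addl _ _).
    by apply: leq_sum => t _; case: (cg t).
  have ko : (oracle k + cg k = 1)%N by rewrite /calls_oracle; case: (cg k).
  rewrite big_nat_recr //= in h; apply: leq_trans (leq_add h (leqnn _)) _.
  by rewrite -addnA ko.
apply: (@le_trans _ _ (\sum_(0 <= t < k) (cg t && cg t.+1) +
    \sum_(0 <= t < k) oracle t + 1)%N%:Z); first by rewrite lez_nat.
rewrite !PoszD /T1 lerD2r lerD //; exact: completed_oracle_calls_le.
Qed.

Lemma iterations_le : k.+1%:Z <=
  T1 theta zeta eta LH gap eps_g eps_H + T2 theta eta LH gap eps_H.
Proof.
have -> : k.+1%:Z = (\sum_(0 <= t < k.+1) cg t + \sum_(0 <= t < k.+1) oracle t)%N%:Z.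
  congr Posz; rewrite -big_split /= (eq_bigr (fun=> 1%N)).
    by rewrite sum_nat_const_nat subn0 muln1.
  by move=> t _; rewrite /calls_oracle; case: (cg t).
by rewrite PoszD lerD ?capped_cg_calls_le ?oracle_calls_le.
Qed.

End NewtonCGComplexity.

Section OrderOfConstants.
Variables (R : realType) (theta zeta eta : R).
Hypotheses (theta01 : 0 < theta < 1) (zeta01 : 0 < zeta < 1).
Hypothesis eta01 : 0 < eta < 1.

Lemma decrease_constants_lower_bound (l : R) : 0 < l -> exists c : R, 0 < c /\
  forall LH, l <= LH ->
    c / LH ^+ 2 <= Num.min (c_sol theta zeta eta LH) (c_nc theta eta LH).
Proof.
move=> l0; have /andP[t0 t1] := theta01; have /andP[z0 z1] := zeta01.
have /andP[eta0 eta1] := eta01.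
pose c1 := (4 / (30 / l + 8)) ^+ 2.
pose c2 := (Num.min (6 * (1 - eta)) 2 * theta) ^+ 2.
pose c3 := l ^+ 2 / 16.
pose c4 := (Num.min (3 * (1 - eta)) 1 * theta) ^+ 2 / 16.
have c10 : 0 < c1 by rewrite exprn_gt0 // divr_gt0 // addr_gt0 // divr_gt0.
have c20 : 0 < c2.
  by rewrite exprn_gt0 // mulr_gt0 // lt_min ltr0n andbT; lra.
have c30 : 0 < c3 by rewrite divr_gt0 ?exprn_gt0.
have c40 : 0 < c4.
  by rewrite divr_gt0 // exprn_gt0 // mulr_gt0 // lt_min ltr01 andbT; lra.
exists (eta * Num.min (Num.min c1 c2) (Num.min c3 c4)); split.
  by rewrite mulr_gt0 // !lt_min c10 c20 c30 c40.
move=> L lL; have L0 : 0 < L by lra.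
have L20 : 0 < L ^+ 2 by rewrite exprn_gt0.
set c := Num.min _ _.
have [h1 h2 h3 h4] : [/\ c <= c1, c <= c2, c <= c3 & c <= c4].
  by split; rewrite /c !ge_min lexx ?orbT.
have div_le a y : c <= a -> a <= y * L ^+ 2 -> c / L ^+ 2 <= y.
  by move=> ca ay; rewrite ler_pdivrMr //; exact: le_trans ay.
rewrite /c_sol /c_nc -mulrA le_min; apply/andP; split.
  rewrite ler_pM2l // le_min; apply/andP; split.
    apply: (div_le _ _ h1).
    set S := Num.sqrt _.
    have S_le : S <= 25 + 8 * L.
      rewrite -[leRHS]ger0_norm; last by lra.
      rewrite -sqrtr_sqr ler_wsqrtr //; nra.
    have S0 : 0 <= S := sqrtr_ge0 _.
    have den : 4 + zeta + S <= (30 / l + 8) * L.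
      have : 30 <= 30 / l * L by rewrite mulrAC ler_pdivlMr // ler_pM2l.
      by lra.
    rewrite /c1 -exprMn lerXn2r ?nnegrE //.
    - by rewrite divr_ge0 // addr_ge0 // divr_ge0 // ltW.
    - by rewrite mulr_ge0 ?divr_ge0 //; lra.
    have d0 : 0 < 4 + zeta + S by lra.
    have d1 : 0 < 30 / l + 8 by rewrite addr_gt0 // divr_gt0.
    have le1 : 1 <= L * (30 / l + 8) / (4 + zeta + S).
      by rewrite ler_pdivlMr // mul1r mulrC.
    by rewrite ler_pdivrMr //; lra.
  apply: (div_le _ _ h2).
  by rewrite expr_div_n divfK // gt_eqF.
set mn := Num.min 1 _.
have mle : 16 * (c / L ^+ 2) <= mn.
  rewrite /mn le_min mulrA; apply/andP; split.
    rewrite ler_pdivrMr // mul1r.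
    have : l ^+ 2 <= L ^+ 2 by rewrite lerXn2r ?nnegrE // ltW.
    by move: h3; rewrite /c3; lra.
  rewrite expr_div_n ler_pM2r ?invr_gt0 //.
  by move: h4; rewrite /c4; lra.
have := ler_wpM2l (ltW eta0) mle; lra.
Qed.

Lemma eps_rate_ge1 (eps_g eps_H : R) : 0 < eps_H < 1 -> 1 <= eps_rate eps_g eps_H.
Proof.
move=> /andP[e0 e1].
rewrite /eps_rate le_max; apply/orP; right.
by rewrite invf_ge1 ?exprn_gt0 // exprn_ile1 // ltW.
Qed.

Lemma iteration_bound_order (l : R) : 0 < l -> exists C : R, 0 < C /\
  forall LH gap eps_g eps_H : R,
  l <= LH -> l <= gap -> 0 < eps_g < 1 -> 0 < eps_H < 1 ->
  (T1 theta zeta eta LH gap eps_g eps_H + T2 theta eta LH gap eps_H)%:~R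
    <= C * (gap * LH ^+ 2 * eps_rate eps_g eps_H).
Proof.
move=> l0; have [c [c0 hc]] := decrease_constants_lower_bound l0.
exists (3 / c + 5 / l ^+ 3); split; first by rewrite addr_gt0 ?divr_gt0 ?exprn_gt0.
move=> LH gap eps_g eps_H lL lg g01 h01.
have /andP[e0 e1] := h01.
have rate1 := eps_rate_ge1 eps_g h01.
have L0 : 0 < LH by lra.
have L20 : 0 < LH ^+ 2 by rewrite exprn_gt0.
have gap0 : 0 < gap by lra.
have := hc LH lL; set mn := Num.min _ _ => mn_ge.
have mn0 : 0 < mn by apply: lt_le_trans mn_ge; rewrite divr_gt0.
set rate := eps_rate eps_g eps_H in rate1 *.
have ceil_lt (y : R) : (Num.ceil y)%:~R <= y + 1.
  by have := ceilB1_lt y; rewrite intrB; lra.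
have A_le : gap / mn * rate <= c^-1 * (gap * LH ^+ 2 * rate).
  have -> : c^-1 * (gap * LH ^+ 2 * rate) = gap * (c / LH ^+ 2)^-1 * rate.
    by rewrite invf_div; field; rewrite gt_eqF.
  rewrite ler_wpM2r //; first by lra.
  by rewrite ler_pM2l // lef_pV2 ?posrE // divr_gt0.
have B_le : gap / c_nc theta eta LH * eps_H ^- 3 <= gap / mn * rate.
  have cn : mn <= c_nc theta eta LH by rewrite ge_min lexx orbT.
  apply: ler_pM; rewrite ?divr_ge0 ?invr_ge0 ?exprn_ge0 ?(ltW gap0) ?(ltW e0) //.
  - by rewrite (le_trans (ltW mn0)).
  - by rewrite ler_pM2l // lef_pV2 ?posrE // (lt_le_trans mn0).
  by rewrite /rate /eps_rate le_max lexx orbT.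
have five : 5 <= 5 / l ^+ 3 * (gap * LH ^+ 2 * rate).
  rewrite mulrAC ler_pdivlMr ?exprn_gt0 // ler_pM2l //.
  rewrite -[leLHS]mulr1 exprS; apply: ler_pM => //.
  - by rewrite mulr_ge0 ?exprn_ge0 // ltW.
  - apply: ler_pM; rewrite ?exprn_ge0 ?(ltW l0) //.
    by rewrite lerXn2r ?nnegrE // ltW.
rewrite /T1 /T2 -/mn -/rate !intrD.
have h1 := ceil_lt (gap / mn * rate).
have h2 := ceil_lt (gap / c_nc theta eta LH * eps_H ^- 3).
lra.
Qed.

End OrderOfConstants.

Section SubroutineProducts.
Variables (R : realType) (zeta delta l : R).
Hypotheses (zeta01 : 0 < zeta < 1) (delta01 : 0 < delta < 1) (l0 : 0 < l).

Lemma absorb_constants (a c1 c2 N s Lg r : R) : 0 < r <= s -> 1 <= N ->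
  1 <= Lg -> 0 <= c1 -> 0 <= c2 -> a <= N -> a <= c1 + c2 * Lg * s ->
  a <= (1 + c1 / r + c2) * (Lg * Num.min N s).
Proof.
move=> /andP[r0 rs] N1 Lg1 c10 c20 aN as'.
have c1r : 0 <= c1 / r by rewrite divr_ge0 // ltW.
have [Ns|sN] := leP N s.
  have NL : N <= Lg * N by rewrite ler_peMl //; lra.
  apply: (le_trans aN); apply: (le_trans NL).
  by rewrite ler_peMl //; lra.
have c1s : c1 <= c1 / r * s by rewrite mulrAC ler_pdivlMr // ler_wpM2l.
have s0 : 0 < s by lra.
have sL : s <= Lg * s by rewrite ler_peMl // ltW.
have : c1 / r * s <= c1 / r * (Lg * s) by rewrite ler_wpM2l.
lra.
Qed.

Lemma log_terms_ge (LH gap eps_g eps_H UH : R) n :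
  1 + `|ln n%:R| + `|ln UH| + `|ln eps_H| <= log_terms LH gap eps_g eps_H n UH.
Proof.
rewrite /log_terms; have := normr_ge0 (ln LH); have := normr_ge0 (ln gap).
have := normr_ge0 (ln eps_g); lra.
Qed.

Lemma ln_le_lnD (c U e y : R) : 0 < c -> 0 < U -> 0 < e -> 0 < y ->
  y <= c * (U / e) -> ln y <= ln c + `|ln U| + `|ln e|.
Proof.
move=> c0 U0 e0 y0 h.
have : ln y <= ln (c * (U / e)) by rewrite ler_ln ?posrE // !mulr_gt0 ?invr_gt0.
rewrite lnM ?posrE ?divr_gt0 // ln_div ?posrE //.
have := ler_norm (ln U); have := ler_norm (- ln e); rewrite normrN; lra.
Qed.

Lemma capped_cg_loop_order : exists C : R, 0 <= C /\
  forall (n : nat) (H : 'M[R]_n) (g : 'cV[R]_n) (eps UH Lg : R) ty v J,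
  H^T = H -> g != 0 -> 0 < eps < 1 -> l <= UH -> spectral_norm H <= UH ->
  1 + `|ln UH| + `|ln eps| <= Lg ->
  capped_cg H g eps zeta 0 ty v J ->
  J%:R <= 1 + C * Lg * Num.sqrt (UH / eps).
Proof.
have /andP[z0 z1] := zeta01; have l0' := l0.
pose K := 1 + 2 / l.
have K1 : 1 <= K by rewrite lerDl divr_ge0 // ltW.
have K0 : 0 < K by lra.
pose C1 := ln (24 / zeta) + 4 * ln K + 4.
have C10 : 0 <= C1.
  have : 0 <= ln (24 / zeta) by apply: ln_ge0; rewrite ler_pdivlMr //; lra.
  have := ln_ge0 K1; rewrite /C1; lra.
exists (4 * Num.sqrt K * C1); split; first by rewrite !mulr_ge0 ?sqrtr_ge0.
move=> n H g eps UH Lg ty v J symH g0 /andP[e0 e1] lU normH LgE run.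
have UH0 : 0 < UH by lra.
have s0 : 0 <= Num.sqrt (UH / eps) by exact: sqrtr_ge0.
have Lg1 : 1 <= Lg.
  by have := normr_ge0 (ln UH); have := normr_ge0 (ln eps); lra.
have C0 : 0 <= 4 * Num.sqrt K * C1 * Lg * Num.sqrt (UH / eps).
  by rewrite !mulr_ge0 ?sqrtr_ge0 //; lra.
case: J run => [_|[_|J run]]; [by rewrite mulr0n; lra|by rewrite mulr1n; lra|].
move: run; rewrite /capped_cg; case: ifP => [_ [] //|_ [_ /(_ J.+1)]].
rewrite ltnS leqnn => /(_ isT) + _ _.
rewrite /cg_applicable => /norP[_ /norP[+ /norP[_]]].
rewrite /cg_small_residual /cg_slow_decay -ltNge -leNgt.
have U0 := cg_U_ge0 H g eps J.+1; have UM := cg_U_le H g eps J.+1.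
move: (cg_U _ _ _ _ _) U0 UM => U U0 UM.
rewrite -[cg_r _ _ _ 0]/g => h1 h2; have {h1 h2} := lt_le_trans h1 h2.
rewrite ltr_pM2r ?enorm_gt0 //.
have K2 := cg_kappa_ge2 e0 U0.
have UeK : 2 <= 2 / l * (UH / eps).
  rewrite mulrAC ler_pdivlMr // ler_pM2l //; rewrite ler_pdivlMr //; nra.
have kap_le : cg_kappa eps U <= K * (UH / eps).
  have -> : cg_kappa eps U = U / eps + 2 by rewrite /cg_kappa; field; rewrite gt_eqF.
  have : U / eps <= UH / eps by rewrite ler_pM2r ?invr_gt0 // (le_trans UM).
  rewrite /K; lra.
rewrite /cg_zetahat /cg_T /cg_tau; move: (cg_kappa eps U) K2 kap_le => ka K2 kap_le.
have ka0 : 0 < ka by lra.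
set S := Num.sqrt ka; have S2 : S ^+ 2 = ka by rewrite sqr_sqrtr // ltW.
have S1 : 1 <= S by rewrite /S -[leLHS]sqrtr1 ler_wsqrtr //; lra.
have S10 : 0 < S + 1 by lra.
set t := S / (S + 1).
have tE : t = 1 - (S + 1)^-1 by rewrite /t; field; rewrite gt_eqF.
have t0 : 0 < t by rewrite divr_gt0 //; lra.
have iS0 : 0 < (S + 1)^-1 by rewrite invr_gt0.
have t1 : t < 1 by lra.
set q := Num.sqrt t; have q2 : q ^+ 2 = t by rewrite sqr_sqrtr // ltW.
have q0 : 0 < q by rewrite sqrtr_gt0.
have q1 : q < 1 by rewrite -sqrtr1 ltr_sqrt.
have q_le : (S + 1)^-1 / 2 <= 1 - q by nra.
have -> : Num.sqrt (4 * ka ^+ 4 / (1 - q) ^+ 2) = 2 * ka ^+ 2 / (1 - q).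
  rewrite -[RHS]ger0_norm; last by rewrite divr_ge0 ?mulr_ge0 ?exprn_ge0 //; lra.
  rewrite -sqrtr_sqr; congr Num.sqrt; field; rewrite gt_eqF //; lra.
move=> lt.
have d1 : 0 < 1 - q by lra.
have Tle : 2 * ka ^+ 2 / (1 - q) <= 8 * ka ^+ 3.
  rewrite ler_pdivrMr //.
  have S_ka : S + 1 <= 2 * ka by rewrite -S2; nra.
  have h : 1 <= 4 * ka * (1 - q).
    apply: (@le_trans _ _ (4 * ka * ((S + 1)^-1 / 2))).
      have -> : 4 * ka * ((S + 1)^-1 / 2) = 2 * ka / (S + 1).
        by field; rewrite gt_eqF.
      by rewrite ler_pdivlMr // mul1r.
    by rewrite ler_pM2l //; lra.
  have := ler_wpM2l (_ : 0 <= 2 * ka ^+ 2) h.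
  by rewrite mulr_ge0 ?exprn_ge0 ?(ltW ka0) // => /(_ isT); lra.
have zlt : zeta / 24 / ka ^+ 4 < t `^ (J.+1%:R / 2).
  have p0 : 0 < t `^ (J.+1%:R / 2) by rewrite powR_gt0.
  have := lt_le_trans lt (ler_wpM2r (ltW p0) Tle).
  rewrite !ltr_pdivrMr ?exprn_gt0 ?mulr_gt0 //; move: (_ `^ _) p0 => y p0; lra.
have lnlt : ln (zeta / 24 / ka ^+ 4) < J.+1%:R / 2 * ln t.
  by rewrite -ln_powR ltr_ln ?posrE ?powR_gt0 ?divr_gt0 ?exprn_gt0 //; lra.
have lnt : ln t <= - (S + 1)^-1.
  by rewrite tE; apply: le_ln1Dx; lra.
have lnz : ln (zeta / 24 / ka ^+ 4) = - (ln (24 / zeta) + 4 * ln ka).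
  rewrite ln_div ?posrE ?divr_gt0 ?exprn_gt0 // lnXn ?posrE // !ln_div ?posrE //.
  by rewrite -[ln ka *+ 4]mulr_natl; ring.
have lnka := ln_le_lnD K0 UH0 e0 ka0 kap_le.
have bnd : ln (24 / zeta) + 4 * ln ka <= C1 * Lg.
  have : 0 <= ln (24 / zeta) by apply: ln_ge0; rewrite ler_pdivlMr //; lra.
  move=> a0; have k0 := ln_ge0 K1.
  have : 0 <= (ln (24 / zeta) + 4 * ln K) * (Lg - 1) by rewrite mulr_ge0 //; lra.
  by rewrite /C1; lra.
have J2 : J.+1%:R / 2 / (S + 1) <= C1 * Lg.
  apply: le_trans bnd; rewrite -lerN2 -lnz; apply/ltW/(lt_le_trans lnlt).
  by rewrite -mulrN ler_wpM2l // divr_ge0.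
rewrite ler_pdivrMr // ler_pdivrMr // in J2.
have S_le : S <= Num.sqrt K * Num.sqrt (UH / eps).
  by rewrite -sqrtrM ?(ltW K0) // ler_wsqrtr.
rewrite -natr1 addrC lerD2l; apply: le_trans J2 _.
have CL : 0 <= C1 * Lg by rewrite mulr_ge0 //; lra.
have : C1 * Lg * (S + 1) * 2 <= C1 * Lg * (4 * S) by rewrite -mulrA ler_wpM2l //; lra.
move/le_trans; apply.
apply: (@le_trans _ _ (C1 * Lg * (4 * (Num.sqrt K * Num.sqrt (UH / eps))))).
  by rewrite ler_wpM2l // ler_pM2l.
by rewrite le_eqVlt; apply/orP; left; apply/eqP; ring.
Qed.

Lemma oracle_N_order : exists C : R, 0 <= C /\
  forall (n : nat) (H : 'M[R]_n) (eps UH Lg : R) (k : nat),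
  (0 < n)%N -> 0 < eps < 1 -> spectral_norm H <= UH ->
  1 + `|ln n%:R| <= Lg -> k%:Z <= oracle_N H eps delta ->
  k%:R <= 2 + C * Lg * Num.sqrt (UH / eps).
Proof.
have /andP[d0 d1] := delta01.
have d2 : 0 < delta ^+ 2 by rewrite exprn_gt0.
pose C := ln (275%:R / 100%:R / delta ^+ 2).
have C0 : 0 <= C.
  apply: ln_ge0; rewrite ler_pdivlMr //.
  by have : delta ^+ 2 <= 1 by [rewrite expr_le1 // ltW]; lra.
exists (C + 1); split; first by lra.
move=> n H eps UH Lg k n0 /andP[e0 e1] normH LgE.
rewrite /oracle_N le_min => /andP[_].
rewrite -(ler_int R) intrD => h; apply: (le_trans h).
set X := _ / 2 * _.
have hX : (Num.ceil X)%:~R <= X + 1.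
  by have := ceilB1_lt X; rewrite intrB; lra.
suff : X <= (C + 1) * Lg * Num.sqrt (UH / eps) by lra.
apply: ler_pM; rewrite ?sqrtr_ge0 //.
- rewrite divr_ge0 // ln_ge0 // ler_pdivlMr //.
  have : delta ^+ 2 <= 1 by rewrite expr_le1 // ltW.
  have : 1 <= n%:R :> R by rewrite ler1n.
  lra.
- have rn0 : 0 < (n%:R : R) by rewrite ltr0n.
  rewrite mulrAC lnM ?posrE ?divr_gt0 // -/C.
  have := ler_norm (ln (n%:R : R)); have := normr_ge0 (ln (n%:R : R)).
  nra.
by rewrite ler_wsqrtr // ler_pM2r ?invr_gt0.
Qed.

End SubroutineProducts.

Lemma capped_cg_productsE J : (capped_cg_products J + 1 = 4 * J + 2)%N.
Proof. by rewrite /capped_cg_products; lia. Qed.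

Section MatrixVectorProducts.
Variables (R : realType) (theta zeta eta delta l : R).
Hypotheses (theta01 : 0 < theta < 1) (zeta01 : 0 < zeta < 1).
Hypotheses (eta01 : 0 < eta < 1) (delta01 : 0 < delta < 1) (l0 : 0 < l).

Lemma iteration_products_order : exists K : R, 0 <= K /\
  forall (n : nat) (F : 'cV[R]_n -> R) (u0 : 'cV[R]_n)
    (Omega : set 'cV[R]_n) (LH Flow Ug UH eps_g eps_H Lg : R),
  (0 < n)%N -> ncg_assumptions F u0 Omega LH Flow Ug UH -> l <= UH ->
  0 < eps_g < 1 -> 0 < eps_H < 1 ->
  1 + `|ln n%:R| + `|ln UH| + `|ln eps_H| <= Lg ->
  forall b x m, F x <= F u0 ->
  ncg_output F eps_g eps_H delta b x m \/
    (exists x', ncg_step F eps_g eps_H theta zeta eta delta b x x' m) ->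
  m%:R <= K * (Lg * Num.min n%:R (Num.sqrt (UH / eps_H))).
Proof.
have [C1 [C10 cg_order]] := capped_cg_loop_order zeta01 l0.
have [C2 [C20 or_order]] := oracle_N_order delta01.
have sl0 : 0 < Num.sqrt l by rewrite sqrtr_gt0.
have pos (a c : R) : 0 <= a -> 0 <= c -> 0 <= 1 + a / Num.sqrt l + c.
  by move=> a0 c0; rewrite !addr_ge0 // divr_ge0 // ltW.
exists (4 * (1 + 1 / Num.sqrt l + C1) + (1 + 2 / Num.sqrt l + C2) +
  2 * (1 + 1 / Num.sqrt l + 0)); split.
  by rewrite !addr_ge0 ?mulr_ge0 ?pos.
move=> n F u0 Omega LH Flow Ug UH eps_g eps_H Lg n0 FA lU g01 h01 LgE b x m xL run.
have /andP[e0 e1] := h01; have l0' := l0.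
have UH0 : 0 < UH by lra.
have rn1 : 1 <= n%:R :> R by rewrite ler1n.
have [a1 a2 a3] : [/\ 0 <= `|ln n%:R : R|, 0 <= `|ln UH| & 0 <= `|ln eps_H|] by [].
have Lg1 : 1 <= Lg by lra.
have sr : 0 < Num.sqrt l <= Num.sqrt (UH / eps_H).
  rewrite sl0 ler_wsqrtr // ler_pdivlMr //; nra.
have absorb := absorb_constants sr rn1 Lg1.
set W := Lg * _ in absorb *.
have one : 1 <= (1 + 1 / Num.sqrt l + 0) * W by apply: absorb; lra.
have normH := hess_le_UH FA xL.
have symH := level_hess_symmetric FA xL.
have W0 : 0 <= W.
  by rewrite mulr_ge0 ?le_min ?sqrtr_ge0 ?ler0n //; lra.
have oracle_bound k : k%:Z <= oracle_N (hess F x) eps_H delta ->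
    k%:R <= (1 + 2 / Num.sqrt l + C2) * W.
  move=> kN; apply: absorb => //.
    by rewrite ler_nat; move: kN; rewrite /oracle_N le_min lez_nat => /andP[].
  by apply: or_order n0 h01 normH _ kN; lra.
have cg_bound ty v J : grad F x != 0 ->
    capped_cg (hess F x) (grad F x) eps_H zeta 0 ty v J ->
    J%:R <= (1 + 1 / Num.sqrt l + C1) * W.
  move=> gn0 run'; apply: absorb => //.
    by rewrite ler_nat; exact: (capped_cg_size symH e0 zeta01 gn0 run').
  by apply: cg_order symH gn0 h01 lU normH _ run'; lra.
have p1 : 0 <= (1 + 1 / Num.sqrt l + C1) * W by rewrite mulr_ge0 ?pos.
have p2 : 0 <= (1 + 2 / Num.sqrt l + C2) * W by rewrite mulr_ge0 ?pos.
have {run} [[ty [v [J [gn0 run ->]]]]|[k [kN mk]]] :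
    (exists ty v J, [/\ grad F x != 0,
       capped_cg (hess F x) (grad F x) eps_H zeta 0 ty v J &
       m = (capped_cg_products J + 1)%N]) \/
    (exists k, k%:Z <= oracle_N (hess F x) eps_H delta /\ (m <= k + 1)%N).
  case: run => [[_ [[_ mN _] _ _]]|[x' [ty [d [j [+ _ _]]]]]].
    by right; exists m; split=> //; rewrite leq_addr.
  rewrite /ncg_direction; case: ifPn => [cg [v [J [run _ ->]]]|_ [v [k [ret _ _ ->]]]].
    left; exists ty, v, J; split=> //.
    exact: (calls_capped_cg_grad g01 cg).
  by right; exists k; split=> //; case: ret => [[]].
- have hJ := cg_bound _ _ _ gn0 run.
  have -> : (capped_cg_products J + 1)%:R = 4 * J%:R + 2 :> R.
    by rewrite capped_cg_productsE natrD natrM.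
  move: (1 + 1 / _ + C1) (1 + 2 / _ + C2) (1 + 1 / _ + 0) one p1 p2 hJ.
  by move=> A B D; lra.
have hk := oracle_bound k kN.
have : m%:R <= k%:R + 1 :> R by rewrite natr1 ler_nat -addn1.
move: (1 + 1 / _ + C1) (1 + 2 / _ + C2) (1 + 1 / _ + 0) one p1 p2 hk.
by move=> A B D; lra.
Qed.

End MatrixVectorProducts.

Unset Implicit Arguments.

Theorem theorem3p1 (R : realType) (theta zeta eta delta : R)
    (htheta : 0 < theta < 1) (hzeta : 0 < zeta < 1)
    (heta : 0 < eta < 1) (hdelta : 0 < delta < 1) :
  (* call counts, termination, and guarantees on the output *)
  (forall (n : nat) (F : 'cV[R]_n -> R) (u0 : 'cV[R]_n)
      (Omega : set 'cV[R]_n) (LH Flow Ug UH eps_g eps_H : R),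
    (0 < n)%N -> ncg_assumptions F u0 Omega LH Flow Ug UH ->
    0 < eps_g < 1 -> 0 < eps_H < 1 ->
    let N1 := T1 theta zeta eta LH (F u0 - Flow) eps_g eps_H in
    let N2 := T2 theta eta LH (F u0 - Flow) eps_H in
    forall (b x : nat -> 'cV[R]_n) (m : nat -> nat) (k : nat),
    (forall t, enorm (b t) = 1) ->
    ncg_reaches F u0 eps_g eps_H theta zeta eta delta b x m k ->
    [/\ (\sum_(0 <= t < k.+1) calls_oracle F eps_g (x t))%N%:Z <= N2,
        (\sum_(0 <= t < k.+1) calls_capped_cg F eps_g (x t))%N%:Z <= N1,
        k.+1%:Z <= N1 + N2 /\
        ncg_iteration_succeeds F eps_g eps_H theta zeta eta delta (b k) (x k),
        (forall mk, ncg_output F eps_g eps_H delta (b k) (x k) mk ->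
           enorm (grad F (x k)) <= eps_g) &
        (* [bk] is the draw of the oracle call at x^k, conditionally on the
           history, which has fixed x^0, ..., x^k *)
        forall (disp : measure_display) (W : measurableType disp)
          (P : probability W R) (bk : W -> 'cV[R]_n),
          uniform_on_sphere P bk ->
          with_probability_ge P (1 - delta)
            [set w | forall mk, ncg_output F eps_g eps_H delta (bk w) (x k) mk ->
                       - eps_H <= lambda_min (hess F (x k))]])
  /\
  (* order of the iteration bound *)
  (forall l : R, 0 < l -> exists C : R,
    forall LH gap eps_g eps_H : R,
    l <= LH -> l <= gap -> 0 < eps_g < 1 -> 0 < eps_H < 1 ->
    (T1 theta zeta eta LH gap eps_g eps_H + T2 theta eta LH gap eps_H)%:~R
      <= C * (gap * LH ^+ 2 * eps_rate eps_g eps_H))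
  /\
  (* Hessian-vector products *)
  (forall l : R, 0 < l -> exists (C : R) (a : nat),
    forall (n : nat) (F : 'cV[R]_n -> R) (u0 : 'cV[R]_n)
      (Omega : set 'cV[R]_n) (LH Flow Ug UH eps_g eps_H : R),
    (0 < n)%N -> ncg_assumptions F u0 Omega LH Flow Ug UH ->
    l <= LH -> l <= F u0 - Flow -> l <= UH ->
    0 < eps_g < 1 -> 0 < eps_H < 1 ->
    forall (b x : nat -> 'cV[R]_n) (m : nat -> nat) (k : nat),
    (forall t, enorm (b t) = 1) ->
    ncg_complete_run F u0 eps_g eps_H theta zeta eta delta b x m k ->
    (\sum_(0 <= t < k.+1) m t)%N%:R
      <= C * log_terms LH (F u0 - Flow) eps_g eps_H n UH ^+ a
         * ((F u0 - Flow) * LH ^+ 2 * eps_rate eps_g eps_H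
            * Num.min n%:R (Num.sqrt (UH / eps_H)))).
Proof.
split; [|split].
- move=> n F u0 Omega LH Flow Ug UH eps_g eps_H n0 FA g01 h01 N1 N2 b x m k nb run.
  have xL := ncg_reaches_level FA g01 h01 htheta hzeta heta run (leqnn k).
  have symH := level_hess_symmetric FA xL.
  have /andP[e0 _] := h01.
  split.
  + exact: (oracle_calls_le FA g01 h01 htheta hzeta heta run).
  + exact: (capped_cg_calls_le FA g01 h01 htheta hzeta heta run).
  + split; first exact: (iterations_le FA g01 h01 htheta hzeta heta run).
    exact: (ncg_iteration_succeeds_level FA).
  + by move=> mk [+ _]; rewrite /calls_oracle /calls_capped_cg -leNgt.
  move=> disp W P bk unif.
  have [A [mA sA PA]] := oracle_certificate_probability n0 symH e0 hdelta unif.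
  exists A; split=> // w /sA cert mk [_ out]; exact: cert out.
- move=> l l0; have [C [_ hC]] := iteration_bound_order htheta hzeta heta l0.
  by exists C.
move=> l l0.
have [C [C0 hC]] := iteration_bound_order htheta hzeta heta l0.
have [K [K0 hK]] := iteration_products_order theta eta hzeta hdelta l0.
exists (C * K), 1%N => n F u0 Omega LH Flow Ug UH eps_g eps_H n0 FA lL lg lU g01 h01.
move=> b x m k nb [run out].
set Lg := log_terms _ _ _ _ _ _.
have LgE := log_terms_ge LH (F u0 - Flow) eps_g eps_H UH n; rewrite -/Lg in LgE.
set Mn := Num.min n%:R _.
have m_le t : (t < k.+1)%N -> (m t)%:R <= K * (Lg * Mn).
  rewrite ltnS => tk.
  apply: (hK n F u0 Omega LH Flow Ug UH eps_g eps_H Lg n0 FA lU g01 h01 LgE (b t) (x t)).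
    exact: (ncg_reaches_level FA g01 h01 htheta hzeta heta run).
  move: tk; rewrite leq_eqVlt => /orP[/eqP->|tk]; first by left.
  by right; exists (x t.+1); case: run => _; exact.
have W0 : 0 <= K * (Lg * Mn) := le_trans (ler0n R (m 0%N)) (m_le 0%N isT).
apply: (@le_trans _ _ (k.+1%:R * (K * (Lg * Mn)))).
  rewrite natr_sum big_mkord; apply: (@le_trans _ _ (\sum_(t < k.+1) K * (Lg * Mn))).
    by apply: ler_sum => t _; exact: m_le.
  by rewrite sumr_const card_ord mulr_natl.
have iters := iterations_le FA g01 h01 htheta hzeta heta run.
have k_le : k.+1%:R <= C * ((F u0 - Flow) * LH ^+ 2 * eps_rate eps_g eps_H).
  by apply: le_trans (hC LH _ eps_g eps_H lL lg g01 h01); rewrite -(ler_int R) in iters.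
apply: le_trans (ler_wpM2r W0 k_le) _.
by rewrite expr1 le_eqVlt; apply/orP; left; apply/eqP; ring.
Qed.
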